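(* Let $m \ge 1$ be an integer, let $p\in(0,1]$, $A_1, A_2 >0$, and suppose that $pA_1 < 1$. Let $\hat{G}_n$ be the undirected graph underlying the Spatial Preferential Attachment (SPA) graph $G_n$ in dimension $m$ with parameters $p, A_1, A_2$. Then asymptotically almost surely (as $n\to\infty$) $$ q^*(\hat{G}_n) = 1 - O \left( n^{\max \{-1/m,\,-1+pA_1\} / 2} \log^{9/2} n \right) = 1 - o(1). $$ That is, there is a constant $C$ (depending only on the parameters of the model) such that with probability tending to $1$ as $n\to\infty$, $q^*(\hat{G}_n) \ge 1 - C n^{\max\{-1/m,\,-1+pA_1\}/2}\log^{9/2} n$ (and always $q^*(\hat G_n)\le 1$).
   Context: SPA model. Let $S=[0,1]^m$ be the unit hypercube in $\mathbb{R}^m$ with the torus metric derived from some fixed $L_r$ norm: $d(x,y) = \min\{\|x-y+u\|_r : u\in\{-1,0,1\}^m\}$. The parameters are the link probability $p$ and positive constants $A_1,A_2$ with $pA_1<1$. The model generates a random sequence of directed graphs $G_t=(V_t,E_t)$, $t\ge 0$, with $V_t\subseteq S$. Let $\deg^-(v,t)$ be the in-degree of $v$ in $G_t$. The sphere of influence $S(v,t)$ of a vertex $v$ at time $t\ge1$ is the ball centred at $v$ (in the torus metric) with volume $$|S(v,t)| = \min\left\{\frac{A_1\deg^-(v,t)+A_2}{t},\,1\right\}.$$ $G_0$ is the null graph. At each time step $t\ge1$, a new vertex $v_t$ is chosen uniformly at random from $S$ and added to $V_{t-1}$ to create $V_t$; then, independently for each $u\in V_{t-1}$ such that $v_t\in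 S(u,t-1)$, a directed link $(v_t,u)$ is created with probability $p$. The graph $\hat G_n$ is obtained from $G_n$ by replacing each directed edge $(u,v)$ by the undirected edge $uv$; it is a simple graph. Modularity: for a graph $G$ with at least one edge and a partition $\mathcal{A}$ of $V(G)$, $$q_{\mathcal{A}}(G) = \sum_{A \in \mathcal{A}} \left( \frac{e(A)}{|E(G)|} - \frac{(\sum_{v\in A}\deg(v))^2}{4|E(G)|^2}\right),$$ where $e(A) = |\{uv\in E(G): u,v\in A\}|$. The modularity is $q^*(G) = \max_{\mathcal{A}} q_{\mathcal{A}}(G)$ over all partitions $\mathcal{A}$ of $V(G)$. An event holds asymptotically almost surely if its probability tends to $1$ as $n\to\infty$. *)

(* Defs.v *)
From HB Require Import structures.
From mathcomp Require Import all_boot all_order all_algebra.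
From mathcomp Require Import all_classical all_reals all_analysis.
Import Order.TTheory GRing.Theory Num.Theory.
Import numFieldNormedType.Exports.

Set Implicit Arguments.
Unset Strict Implicit.
Unset Printing Implicit Defensive.

Local Open Scope ring_scope.

(* A simple graph is a symmetric irreflexive relation [e] on a finite type. *)

Section Modularity.
Variables (R : realType) (V : finType) (e : rel V).

(* Edges are unordered pairs, so each edge is counted once. *)
Definition edges : {set {set V}} :=
  [set [set x.1; x.2] | x in [set x : V * V | e x.1 x.2]].

Definition edges_in (A : {set V}) : {set {set V}} :=
  [set f in edges | f \subset A].

Definition degree (v : V) : nat := #|[set u | e v u]|.

Definition modularity_of (AA : {set {set V}}) : R :=
  \sum_(A in AA)
    (#|edges_in A|%:R / #|edges|%:R
     - (\sum_(v in A) degree v)%N%:R ^+ 2 / (4 * #|edges|%:R ^+ 2)).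

(* The default value 0 of the iterated maximum does not affect it: the
   one-block partition has modularity 1 - 1 = 0 as soon as there is an edge.
   For an edgeless graph, where modularity is not defined mathematically, the
   value is 0. *)
Definition modularity : R :=
  \big[Num.max/0]_(AA : {set {set V}} | finset.partition AA [set: V])
     modularity_of AA.

End Modularity.

Local Open Scope classical_set_scope.

Section Torus.
Variables (R : realType) (m : nat).

Definition cube : set (m.-tuple R) :=
  [set x | forall i, 0 <= tnth x i <= 1].

(* Meant for r in [1, +oo]. *)
Definition lr_norm (r : \bar R) (z : 'I_m -> R) : R :=
  if r is s%:E then (\sum_(i < m) `|z i| `^ s) `^ s^-1
  else \big[Num.max/0]_(i < m) `|z i|.

(* [u i : 'I_3] encodes the shift [u i - 1] in {-1, 0, 1}; the default value
   of the minimum is the one obtained from the zero shift. *)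
Definition torus_dist (r : \bar R) (x y : m.-tuple R) : R :=
  \big[Num.min/lr_norm r (fun i => tnth x i - tnth y i)]_(u : {ffun 'I_m -> 'I_3})
     lr_norm r (fun i => tnth x i - tnth y i + ((u i : nat)%:R - 1)).

Definition torus_ball (r : \bar R) (x : m.-tuple R) (rho : R) :
    set (m.-tuple R) :=
  [set y | cube y /\ torus_dist r x y <= rho].

End Torus.

(* m-dimensional Lebesgue measure of A `&` [0,1]^m, for Borel sets A, as an
   iterated integral of the indicator function over the coordinates. *)
Fixpoint cube_volume (R : realType) (m : nat) :
    set (m.-tuple R) -> \bar R :=
  if m is k.+1 then
    fun A => (\int[@lebesgue_measure R]_(x in `[0%R, 1%R])
               cube_volume [set y : k.-tuple R | A [tuple of x :: y]])%E
  else fun A => (\1_A [tuple])%:E.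

Section SPA.
Variables (R : realType) (m : nat) (r : \bar R) (A1 A2 : R).

(* The ball centred at x of volume a.  For 0 < a < 1 the radius is unique;
   for a = 1 every admissible radius gives the whole cube. *)
Definition ball_of_volume (x : m.-tuple R) (a : R) : set (m.-tuple R) :=
  torus_ball r x
    (get [set rho | 0 <= rho /\ cube_volume (torus_ball r x rho) = a%:E]).

(* Vertices are numbered from 0: vertex k is the one added at time k.+1, so
   that the vertex set at time t is {k | k < t}. *)
Definition in_degree (t : nat) (G : rel nat) (v : nat) : nat :=
  #|[pred u : 'I_t | G u v]|.

Definition influence (pos : nat -> m.-tuple R) (t : nat) (G : rel nat)
    (v : nat) : set (m.-tuple R) :=
  ball_of_volume (pos v)
    (Num.min ((A1 * (in_degree t G v)%:R + A2) / t%:R) 1).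

(* [spa_graph pos coin t u v]: the directed link (u, v) is present at time t,
   where [pos k] is the position of vertex k and [coin u v] decides whether
   the link (u, v) is created once u falls into the sphere of influence of v. *)
Fixpoint spa_graph (pos : nat -> m.-tuple R) (coin : nat -> nat -> bool)
    (t : nat) : rel nat :=
  if t is s.+1 then
    let G := spa_graph pos coin s in
    fun u v => G u v ||
      [&& u == s, (v < s)%N, `[< influence pos s G v (pos s) >] & coin s v]
  else fun _ _ => false.

Definition spa_undirected (pos : nat -> m.-tuple R)
    (coin : nat -> nat -> bool) (n : nat) : rel 'I_n :=
  fun u v => spa_graph pos coin n u v || spa_graph pos coin n v u.

End SPA.

Section Randomness.
Variables (R : realType) (d : measure_display) (T : measurableType d).
Variable P : probability T R.

Definition mutually_independent (I : eqType) (F : I -> set_system T) : Prop :=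
  forall (J : seq I) (E : I -> set T), uniq J ->
    (forall i, i \in J -> F i (E i)) ->
    P (\bigcap_(i in [set` J]) E i) = \big[mule/1%E]_(i <- J) P (E i).

Definition sigma_of d' (T' : measurableType d') (X : T -> T') : set_system T :=
  preimage_set_system setT X measurable.

Variable m : nat.
Variables (X : nat -> {RV P >-> m.-tuple R}).
Variables (B : nat -> nat -> {RV P >-> bool}).

Definition noise_sigma (i : nat + nat * nat) : set_system T :=
  match i with
  | inl k => sigma_of (X k)
  | inr (u, v) => sigma_of (B u v)
  end.

(* Positions are required to lie in the cube surely, not just almost surely:
   outside the cube the torus distance is meaningless.  There is one coin for
   each potential link, ignored when the link is not eligible. *)
Definition spa_noise (p : R) : Prop :=
  [/\ forall k w, cube (X k w),
      forall k A, measurable A -> distribution P (X k) A = cube_volume A,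
      forall u v A, distribution P (B u v) A = bernoulli_prob p A &
      mutually_independent noise_sigma].

Definition asymptotically_almost_surely (E : nat -> set T) : Prop :=
  P (E n) @[n --> \oo] --> 1%E.

End Randomness.

Definition spa_rate (R : realType) (m : nat) (p A1 : R) (n : nat) : R :=
  n%:R `^ (Num.max (- m%:R^-1) (-1 + p * A1) / 2) * ln n%:R `^ (9 / 2).

(* Main.v *)
Require Import Defs.
From HB Require Import structures.
From mathcomp Require Import all_boot all_order all_algebra.
From mathcomp Require Import all_classical all_reals all_analysis.
From mathcomp Require Import measurable_realfun lra ring zify.
Import Order.TTheory GRing.Theory Num.Theory.
Import numFieldNormedType.Exports.

(** Cut the torus by hyperplanes orthogonal to the first axis into [k] parallel
    strips of width [1/k], and let the strips be the parts of a partition of the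
    vertices.  The modularity of this partition falls short of [1] by the
    proportion of links between different strips, and by the degree tax, the sum
    of the squared relative volumes of the strips.  Every out-link leaves its strip
    or is counted by an in-degree inside it, so [modularity_ge] bounds the tax by
    the proportion of crossing links and by the sum of the products of in-degrees
    over the pairs of vertices in a common strip.

    In-degrees are easy to control.  Given the past, the in-degree [D] of a vertex
    grows at time [s] with probability at most [p (A1 D + A2) / s].  Hence suitably
    shifted in-degrees, and products of two of them, grow at most by the factors
    [1 + a / s] and [1 + 2a / s] in expectation, where [a = p A1 < 1]
    ([second_moment_growth]); the expected in-degree of vertex [j] at time [s] is of
    order [(s / j)^a].  Two vertices lie in a common strip with probability about
    [1 / k], so the tax is of order [1 / k] up to logarithms ([same_strip_Ex_le]).
    A link is as long as the radius of the sphere of influence, the [m]-th root of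
    its volume [V], up to a constant; it is cut with probability of order
    [k V^(1/m)].  Summing [V^(1 + 1/m)] over all vertices and times gives
    [n^(1 + b)], up to logarithms, where [b] is the larger of [-1/m] and [-1 + a]
    ([crossing_cost_Ex_le]).  There are linearly many links ([few_links_prob]), by
    Chebyshev's inequality for the links inside balls of volume [A2 / n]; hence the
    proportion of crossing links is of order [k n^b].  With [k] about [n^(-b/2)]
    both losses are of order [n^(b/2)] up to logarithms, and Markov's inequality
    concludes ([modularity_prob]).

    The strips are shifted to minimise the number of crossing links: the expected
    number, averaged over [k] shifts of a division of the axis into [k^2] cells,
    bounds the one of some fixed shift ([good_shift]).  Only the links among the
    first [n] vertices and the cells of these vertices matter, so all expectations
    are finite sums over such outcomes; the probability space itself enters through
    [Ex_past], which conditions on the past.  There a fresh position must fall into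
    a ball of prescribed volume around a known centre with exactly this volume as
    its probability, which rests on three facts about balls of the torus:
    homogeneity ([torus_ball_volume]), the existence of a ball of each volume,
    because spheres are null ([ball_volume_surj]), and the bound of the radius by
    the volume ([torus_ball_coord]). *)

Set Implicit Arguments.
Unset Strict Implicit.
Unset Printing Implicit Defensive.
Local Open Scope ring_scope.

(** * Modularity of a graph cut into strips *)

Section ModularityBounds.
Variables (R : realType) (V : finType).

Lemma edges_in_sum_le (e : rel V) (AA : {set {set V}}) :
  finset.partition AA [set: V] ->
  (\sum_(A in AA) #|edges_in e A| <= #|edges e|)%N.
Proof.
move=> /and3P[_ tI _].
have -> : (\sum_(A in AA) #|edges_in e A| =
    \sum_(f in edges e) \sum_(A in AA) (f \subset A))%N.
  rewrite exchange_big /=; apply: eq_bigr => A _.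
  rewrite -sum1_card big_mkcond [RHS]big_mkcond /=; apply: eq_bigr => f _.
  by rewrite inE; case: (f \in edges e); case: (f \subset A).
rewrite -sum1_card; apply: leq_sum => f /imsetP[x _ ->].
have [[A AAA sA]|noA] := pselect (exists2 A, A \in AA & [set x.1; x.2] \subset A).
  rewrite (bigD1 A) //= sA big1 ?addn0 // => C /andP[AAC CA].
  apply/eqP; rewrite eqb0; apply/negP => sC.
  have xA : x.1 \in A by apply: (fintype.subsetP sA); rewrite !inE eqxx.
  have xC : x.1 \in C by apply: (fintype.subsetP sC); rewrite !inE eqxx.
  by move/eqP: CA; apply; rewrite -(def_pblock tI AAC xC) -(def_pblock tI AAA xA).
rewrite big1 // => A AAA; apply/eqP; rewrite eqb0; apply/negP => sA.
by apply: noA; exists A.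
Qed.

Lemma modularity_le1 (e : rel V) : modularity R e <= 1.
Proof.
apply/bigmax_leP; split => // AA pAA; rewrite /modularity_of.
have [E0|E0] := eqVneq #|edges e| 0%N.
  rewrite big1 // => A _; rewrite E0 invr0 mulr0 expr0n /= mulr0 invr0 mulr0.
  by rewrite subrr.
have Epos : 0 < #|edges e|%:R :> R by rewrite ltr0n lt0n.
apply: (@le_trans _ _ (\sum_(A in AA) #|edges_in e A|%:R / #|edges e|%:R)).
  by apply: ler_sum => A _; rewrite gerBl divr_ge0 ?mulr_ge0 ?exprn_ge0.
rewrite -mulr_suml ler_pdivrMr // mul1r -natr_sum ler_nat.
exact: edges_in_sum_le.
Qed.

End ModularityBounds.

Section StripPartition.
Variables (R : realType) (n k : nat) (l : rel 'I_n) (st : 'I_n -> 'I_k).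
Hypothesis l_lt : forall u v, l u v -> (v < u)%N.

Definition sym_link : rel 'I_n := fun u v => l u v || l v u.

Definition links : {set 'I_n * 'I_n} := [set x | l x.1 x.2].
Definition crossing : {set 'I_n * 'I_n} := [set x in links | st x.1 != st x.2].
Definition in_deg (v : 'I_n) : nat := (\sum_u l u v)%N.

Let edge_of (x : 'I_n * 'I_n) : {set 'I_n} := [set x.1; x.2].
Let strip (i : 'I_k) : {set 'I_n} := [set v | st v == i].

(** Since links point from a vertex to an older one, an edge remembers the
    direction of its link. *)
Lemma edge_of_inj : {in links &, injective edge_of}.
Proof.
move=> [u v] [u' v']; rewrite !inE /= => /l_lt vu /l_lt vu' /finset.setP E.
have /orP hu : (u == u') || (u == v') by have := E u; rewrite !inE eqxx => <-.
have /orP hv : (v == u') || (v == v') by have := E v; rewrite !inE eqxx orbT => <-.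
case: hu => /eqP uE; case: hv => /eqP vE; subst => //; exfalso; lia.
Qed.

Lemma edges_links : edges sym_link = edge_of @: links.
Proof.
apply/finset.setP => f; apply/imsetP/imsetP => -[[u v]]; rewrite inE /= => h ->.
  move/orP: h => [h|h]; first by exists (u, v); rewrite ?inE.
  by exists (v, u); rewrite ?inE // /edge_of finset.setUC.
by exists (u, v); rewrite ?inE //= /sym_link h.
Qed.

Lemma card_edges : #|edges sym_link| = #|links|.
Proof. by rewrite edges_links card_in_imset //; exact: edge_of_inj. Qed.

Lemma card_edges_in A :
  #|edges_in sym_link A| = #|[set x in links | (x.1 \in A) && (x.2 \in A)]|.
Proof.
rewrite -(card_in_imset (f := edge_of)); last first.
  by move=> x y; rewrite !inE => /andP[hx _] /andP[hy _]; apply: edge_of_inj; rewrite inE.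
congr #|pred_of_set _|; apply/finset.setP => f; rewrite inE edges_links.
apply/andP/imsetP.
  move=> [/imsetP[x xl ->]] sx; exists x => //; rewrite !inE in xl *; rewrite xl /=.
  by apply/andP; split; apply: (fintype.subsetP sx); rewrite !inE eqxx ?orbT.
move=> [x]; rewrite !inE => /and3P[xl xA xB] ->; split.
  by apply/imsetP; exists x; rewrite ?inE.
by apply/fintype.subsetP => y; rewrite !inE => /orP[]/eqP ->.
Qed.

Lemma sum_edges_in :
  (\sum_(i < k) #|edges_in sym_link (strip i)| + #|crossing| = #|links|)%N.
Proof.
have cardE (Q : pred ('I_n * 'I_n)) : #|[set x in links | Q x]| =
    (\sum_(x in links) Q x)%N.
  rewrite -sum1_card big_mkcond [RHS]big_mkcond /=; apply: eq_bigr => x _.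
  by rewrite inE; case: (x \in links); case: (Q x).
under eq_bigr do rewrite card_edges_in cardE.
rewrite exchange_big /= /crossing cardE -big_split /= -sum1_card.
apply: eq_bigr => x _; rewrite (bigD1 (st x.1)) //= big1 ?addn0.
  by rewrite !inE eqxx /= [st x.2 == _]eq_sym; case: (_ == _).
by move=> i hi; rewrite !inE eq_sym (negbTE hi).
Qed.

(** A link out of a vertex of the strip either ends in the strip, where an
    in-degree counts it, or is crossing.  This trades the out-degrees for
    in-degrees, whose growth can be followed one vertex at a time. *)
Lemma strip_volume i :
  (\sum_(v in strip i) degree sym_link v <=
   2 * \sum_(v in strip i) in_deg v + #|[set x in crossing | x.1 \in strip i]|)%N.
Proof.
have cardE : #|[set x in crossing | x.1 \in strip i]| =
    (\sum_(u in strip i) \sum_v (l u v && (st v != i)))%N.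
  rewrite pair_big_dep -sum1_card big_mkcond [RHS]big_mkcond /=.
  apply: eq_bigr => -[u v] _; rewrite !inE /=; case: (eqVneq (st u) i) => [->|]; rewrite ?andbF //=.
  by rewrite andbT eq_sym; case: (l u v && _).
have inE' : (\sum_(v in strip i) in_deg v = \sum_u \sum_(v in strip i) l u v)%N.
  by rewrite exchange_big.
have ini : (\sum_(u in strip i) \sum_v (l u v && (st v == i)) <= \sum_(v in strip i) in_deg v)%N.
  rewrite inE' [leqRHS](bigID (mem (strip i))) /=.
  apply: leq_trans (leq_addr _ _); apply: leq_sum => u _.
  rewrite [leqRHS]big_mkcond; apply: leq_sum => v _; rewrite inE.
  by case: (st v == i); rewrite ?andbT ?andbF.
have dv v : (degree sym_link v <= in_deg v + \sum_u l v u)%N.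
  rewrite /degree -sum1_card big_mkcond -big_split /=; apply: leq_sum => u _.
  by rewrite inE /sym_link; case: (l v u); case: (l u v).
apply: (@leq_trans (\sum_(v in strip i) (in_deg v + \sum_u l v u))).
  exact: leq_sum.
rewrite big_split /= mul2n -addnn -addnA leq_add2l cardE.
apply: leq_trans (leq_add ini (leqnn _)); rewrite -big_split /=; apply: leq_sum => u _.
rewrite -big_split /=; apply: leq_sum => v _.
by case: (l u v); case: (st v == i).
Qed.

Lemma strip_partition :
  finset.partition [set strip i | i in [set i | strip i != finset.set0]] [set: 'I_n].
Proof.
apply/and3P; split.
- apply/eqP/finset.setP => v; rewrite inE; apply/finset.bigcupP; exists (strip (st v)); last by rewrite inE.
  apply/imsetP; exists (st v) => //; rewrite inE; apply/finset.set0Pn; exists v; by rewrite inE.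
- apply/finset.trivIsetP => _ _ /imsetP[i _ ->] /imsetP[j _ ->] ij.
  rewrite -finset.setI_eq0; apply/eqP/finset.setP => v; rewrite !inE; apply/negP => /andP[/eqP vi /eqP vj].
  by move/eqP: ij; apply; rewrite -vi -vj.
- by apply/negP => /imsetP[i]; rewrite inE => /[swap] <-; rewrite eqxx.
Qed.

(** With [x] the sum of the in-degrees of a strip and [y] the number of the
    crossing links that leave it, the volume of the strip is at most [2x + y],
    and [(2x + y)^2 <= 8x^2 + 2y^2].  The [x^2] add up to the double sum over the
    pairs of vertices in a common strip, and the [y^2] to at most the number of
    links times that of crossing links.  After division by four times the
    square of the number of links, the [y^2] thus cost half a crossing ratio, in
    addition to the one lost by the edges between different strips. *)
Lemma modularity_ge : (0 < #|links|)%N ->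
  1 - 3 / 2 * (#|crossing|%:R / #|links|%:R)
    - 2 * (\sum_(v < n) \sum_(w < n) (st v == st w)%:R * ((in_deg v)%:R * (in_deg w)%:R))
      / #|links|%:R ^+ 2 <= modularity R sym_link.
Proof.
move=> E0; set E : R := #|links|%:R; have Epos : 0 < E by rewrite ltr0n.
pose AA := [set strip i | i in [set i | strip i != finset.set0]].
apply: (@le_trans _ _ (modularity_of R sym_link AA)); last first.
  by apply: (bigmax_sup AA) => //; exact: strip_partition.
pose vol i : R := (\sum_(v in strip i) degree sym_link v)%N%:R.
pose inn i : R := (\sum_(v in strip i) in_deg v)%N%:R.
pose co i : R := #|[set x in crossing | x.1 \in strip i]|%:R.
have -> : modularity_of R sym_link AA =
    \sum_(i < k) (#|edges_in sym_link (strip i)|%:R / E - vol i ^+ 2 / (4 * E ^+ 2)).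
  rewrite /modularity_of /AA card_edges big_imset /=; last first.
    move=> i j; rewrite !inE => /finset.set0Pn[v]; rewrite inE => /eqP <- _ /finset.setP/(_ v).
    by rewrite !inE eqxx => /esym/eqP.
  rewrite big_mkcond /=; apply: eq_bigr => i _; rewrite inE; case: eqP => //= si.
  rewrite /vol si big_set0 expr0n /= mul0r subr0 card_edges_in.
  rewrite (_ : [set _ in _ | _] = finset.set0) ?cards0 ?mul0r //.
  by apply/finset.setP => x; rewrite !inE !andbF.
have volE i : vol i ^+ 2 <= 8 * inn i ^+ 2 + 2 * co i ^+ 2.
  have h : vol i <= 2 * inn i + co i.
    by rewrite /vol /inn /co -natrM -natrD ler_nat strip_volume.
  apply: (@le_trans _ _ ((2 * inn i + co i) ^+ 2)).
    by rewrite lerXn2r ?nnegrE ?addr_ge0 ?mulr_ge0.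
  rewrite -subr_ge0 [leRHS](_ : _ = (2 * inn i - co i) ^+ 2) ?sqr_ge0 //; ring.
have sco : \sum_(i < k) co i ^+ 2 <= E * #|crossing|%:R.
  have coE i : co i <= E.
    rewrite ler_nat; apply: subset_leq_card; apply/fintype.subsetP => x.
    by rewrite !inE => /andP[/andP[]].
  apply: (@le_trans _ _ (\sum_(i < k) E * co i)).
    by apply: ler_sum => i _; rewrite expr2 ler_wpM2r.
  rewrite -mulr_sumr ler_wpM2l ?(ltW Epos) // -natr_sum ler_nat.
  rewrite (eq_bigr (fun i => \sum_(x in crossing) (x.1 \in strip i)))%N; last first.
    move=> i _; rewrite -sum1_card big_mkcond [RHS]big_mkcond /=; apply: eq_bigr => x _.
    by rewrite inE; case: (x \in crossing); case: (x.1 \in _).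
  rewrite exchange_big /= -sum1_card; apply: leq_sum => x _.
  rewrite (bigD1 (st x.1)) //= big1 ?addn0 ?leq_b1 // => i hi.
  by rewrite inE eq_sym (negbTE hi).
have sinn : \sum_(i < k) inn i ^+ 2 =
    \sum_(v < n) \sum_(w < n) (st v == st w)%:R * ((in_deg v)%:R * (in_deg w)%:R).
  have innE i : inn i = \sum_(v < n) (st v == i)%:R * (in_deg v)%:R.
    rewrite /inn natr_sum big_mkcond /=; apply: eq_bigr => v _.
    by rewrite inE; case: (st v == i); rewrite ?mul1r ?mul0r.
  under eq_bigr do rewrite innE expr2 mulr_suml; rewrite exchange_big /=.
  apply: eq_bigr => v _; rewrite (bigD1 (st v)) //= [X in _ + X]big1 ?addr0; last first.
    by move=> i hi; rewrite eq_sym (negbTE hi) !mul0r.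
  rewrite eqxx mul1r mulr_sumr; apply: eq_bigr => w _.
  by rewrite eq_sym; ring.
have se : \sum_(i < k) #|edges_in sym_link (strip i)|%:R = E - #|crossing|%:R.
  by rewrite /E -sum_edges_in natrD natr_sum addrK.
rewrite sumrB -mulr_suml se -mulr_suml -sinn.
have H : \sum_(i < k) vol i ^+ 2 <= 8 * \sum_(i < k) inn i ^+ 2 + 2 * (E * #|crossing|%:R).
  apply: (@le_trans _ _ (\sum_(i < k) (8 * inn i ^+ 2 + 2 * co i ^+ 2))).
    by apply: ler_sum => i _.
  by rewrite big_split /= -!mulr_sumr lerD2l ler_wpM2l.
have E4 : 0 < 4 * E ^+ 2 by rewrite mulr_gt0 ?exprn_gt0.
apply: (@le_trans _ _ ((E - #|crossing|%:R) / E -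
   (8 * \sum_(i < k) inn i ^+ 2 + 2 * (E * #|crossing|%:R)) / (4 * E ^+ 2))).
  rewrite le_eqVlt; apply/orP; left; apply/eqP; field; by rewrite gt_eqF.
by rewrite lerD2l lerN2 ler_wpM2r // invr_ge0 ltW.
Qed.

End StripPartition.

Local Open Scope classical_set_scope.
Local Open Scope ring_scope.

(** * Balls of the torus *)

(** ** The torus distance, coordinate by coordinate *)

Section LrNorm.
Variables (R : realType) (m : nat) (r : \bar R).
Hypothesis hr : (1 <= r)%E.

Lemma le_lr_norm (z z' : 'I_m -> R) :
  (forall i, `|z i| <= `|z' i|) -> lr_norm r z <= lr_norm r z'.
Proof.
move=> zz'; rewrite /lr_norm; case: r hr => [s| |]; last by [].
- rewrite lee_fin => s1; apply: ge0_ler_powR; rewrite ?nnegrE.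
  + by rewrite invr_ge0 (le_trans ler01).
  + by apply: sumr_ge0 => i _; exact: powR_ge0.
  + by apply: sumr_ge0 => i _; exact: powR_ge0.
  + apply: ler_sum => i _; apply: ge0_ler_powR; rewrite ?nnegrE //.
    by rewrite (le_trans ler01).
- by move=> _; apply: le_bigmax2.
Qed.

Lemma lr_norm_ge0 (z : 'I_m -> R) : 0 <= lr_norm r z.
Proof.
rewrite /lr_norm; case: r hr => [s| |] _; [exact: powR_ge0|exact: bigmax_ge_id..].
Qed.

Lemma eq_lr_norm (z z' : 'I_m -> R) :
  (forall i, `|z i| = `|z' i|) -> lr_norm r z = lr_norm r z'.
Proof.
by move=> zz'; apply/eqP; rewrite eq_le !le_lr_norm // => i; rewrite zz'.
Qed.

Lemma lr_norm_ge_coord (z : 'I_m -> R) i : `|z i| <= lr_norm r z.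
Proof.
rewrite /lr_norm; case: r hr => [s| |]; last by [].
- rewrite lee_fin => s1; have s0 : s != 0 by rewrite gt_eqF // (lt_le_trans ltr01).
  rewrite -[leLHS](powRr1 (normr_ge0 _)) -(mulfV s0) powRrM.
  apply: ge0_ler_powR; rewrite ?nnegrE ?powR_ge0 //.
  + by rewrite invr_ge0 (le_trans ler01).
  + by apply: sumr_ge0 => j _; exact: powR_ge0.
  + rewrite (bigD1 i) //= lerDl; apply: sumr_ge0 => j _; exact: powR_ge0.
- by move=> _; apply: (le_bigmax _ (fun i => `|z i|)).
Qed.

(** The factor [m] is the price of a bound that holds for all norms at once. *)
Lemma lr_norm_le_box (z : 'I_m -> R) (c : R) : 
  (0 < m)%N -> 0 <= c -> (forall i, `|z i| <= c / m%:R) -> lr_norm r z <= c.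
Proof.
move=> m0 c0 zc; have m0R : 0 < m%:R :> R by rewrite ltr0n.
have m1R : 1 <= m%:R :> R by rewrite ler1n.
rewrite /lr_norm; case: r hr => [s| |]; last by [].
- rewrite lee_fin => s1; have s0 : 0 < s by rewrite (lt_le_trans ltr01).
  rewrite -[leRHS](powRr1 c0) -(mulfV (lt0r_neq0 s0)) powRrM.
  apply: ge0_ler_powR; rewrite ?nnegrE ?powR_ge0 ?invr_ge0 ?(ltW s0) //.
    by apply: sumr_ge0 => j _; exact: powR_ge0.
  have cm0 : 0 <= c / m%:R by rewrite divr_ge0.
  apply: (@le_trans _ _ (\sum_(i < m) (c / m%:R) `^ s)).
    by apply: ler_sum => i _; apply: ge0_ler_powR; rewrite ?nnegrE // ltW.
  rewrite sumr_const card_ord -[leLHS]mulr_natl.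
  have -> : c `^ s = m%:R `^ s * (c / m%:R) `^ s.
    by rewrite -powRM // mulrC divfK ?lt0r_neq0.
  rewrite ler_wpM2r ?powR_ge0 // -[leLHS]powRr1 //.
  by apply: ler_powR.
- move=> _; apply/bigmax_leP; split => // i _; rewrite (le_trans (zc i)) //.
  by rewrite ler_pdivrMr // ler_peMr.
Qed.

End LrNorm.

(** The distance on the circle of length 1 of two points of [0, 1] whose
    difference is [t]. *)
Definition circ (R : realType) (t : R) : R := Num.min `|t| (1 - `|t|).

Section Circle.
Variable R : realType.
Implicit Types t x y : R.

Lemma circN t : circ (- t) = circ t.
Proof. by rewrite /circ normrN. Qed.

Lemma circ_ge0 t : `|t| <= 1 -> 0 <= circ t.
Proof. by move=> t1; rewrite /circ le_min normr_ge0 subr_ge0. Qed.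

Lemma circ_le_half t : circ t <= 2^-1.
Proof. rewrite /circ ge_min; case: (leP `|t| 2^-1) => //= h; lra. Qed.

Lemma cube_diff_le1 x y : 0 <= x <= 1 -> 0 <= y <= 1 -> `|x - y| <= 1.
Proof. by rewrite ler_norml => /andP[? ?] /andP[? ?]; lra. Qed.

Lemma circ_le_shift t (u : 'I_3) : `|t| <= 1 ->
  circ t <= `|t + ((u : nat)%:R - 1)|.
Proof.
move=> t1; rewrite /circ ge_min; apply/orP.
have /ler_normlP[t1' t1''] := t1.
case: u => [[|[|[|//]]]] /= _.
- right; have [t0|t0] := leP 0 t; first by rewrite (ger0_norm t0) ler0_norm; lra.
  by rewrite (ltr0_norm t0) ler0_norm; lra.
- by left; rewrite subrr addr0.
- right; have [t0|t0] := leP 0 t; first by rewrite (ger0_norm t0) ger0_norm; lra.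
  by rewrite (ltr0_norm t0) ger0_norm; lra.
Qed.

Lemma circ_eq_shift t : `|t| <= 1 ->
  exists u : 'I_3, `|t + ((u : nat)%:R - 1)| = circ t.
Proof.
move=> t1; rewrite /circ; case: (leP `|t| (1 - `|t|)) => h.
  by exists (inord 1); rewrite inordK //= subrr addr0.
have /ler_normlP[t1' t1''] := t1.
have [t0|t0] := leP 0 t.
  exists (inord 0); rewrite inordK //= (ger0_norm t0) ler0_norm; lra.
exists (inord 2); rewrite inordK //= (ltr0_norm t0) ger0_norm; lra.
Qed.

End Circle.

Section TorusDist.
Variables (R : realType) (m : nat) (r : \bar R).
Hypothesis hr : (1 <= r)%E.
Implicit Types x y : m.-tuple R.

(** The shifts can be optimised coordinatewise, because the norm is monotone
    in the absolute value of every coordinate. *)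
Lemma torus_distE x y : cube x -> cube y ->
  torus_dist r x y = lr_norm r (fun i => circ (tnth x i - tnth y i)).
Proof.
move=> cx cy.
have d1 i : `|tnth x i - tnth y i| <= 1 by exact: cube_diff_le1.
apply/eqP; rewrite eq_le; apply/andP; split.
  pose u := [ffun i => projT1 (cid (circ_eq_shift (d1 i)))].
  apply: (@le_trans _ _ (lr_norm r (fun i =>
     tnth x i - tnth y i + ((u i : nat)%:R - 1)))).
    rewrite /torus_dist.
    exact: (bigmin_le _ u (fun v : {ffun 'I_m -> 'I_3} => lr_norm r (fun i =>
     tnth x i - tnth y i + ((v i : nat)%:R - 1)))).
  apply: le_lr_norm => // i; rewrite ffunE.
  by rewrite (projT2 (cid (circ_eq_shift (d1 i)))) ler_norm.
apply/bigmin_geP; split.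
  apply: le_lr_norm => // i; rewrite ger0_norm ?circ_ge0 //.
  by rewrite /circ ge_min lexx.
move=> u _; apply: le_lr_norm => // i; rewrite ger0_norm ?circ_ge0 //.
exact: circ_le_shift.
Qed.

Lemma torus_distC x y : cube x -> cube y -> torus_dist r x y = torus_dist r y x.
Proof.
move=> cx cy; rewrite !torus_distE //; apply: eq_lr_norm => // i.
by rewrite -circN opprB.
Qed.

End TorusDist.

(** Dynkin's pi-lambda argument for two image measures.  It serves to compare the
    laws of the distance vectors to two different centres: for one coordinate
    with the rays, and for all of them with the products of Borel sets. *)
Lemma eq_preimage_measure (R : realType) d d1 d2 (T : measurableType d)
    (T1 : measurableType d1) (T2 : measurableType d2)
    (m1 : {measure set T1 -> \bar R}) (m2 : {measure set T2 -> \bar R})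
    (f1 : T1 -> T) (f2 : T2 -> T) (G : set_system T) :
  measurable_fun setT f1 -> measurable_fun setT f2 ->
  measurable = <<s G >> -> setI_closed G ->
  (m1 setT < +oo)%E -> m1 setT = m2 setT ->
  (forall A, G A -> m1 (f1 @^-1` A) = m2 (f2 @^-1` A)) ->
  forall A, measurable A -> m1 (f1 @^-1` A) = m2 (f2 @^-1` A).
Proof.
move=> mf1 mf2 mG IG m1oo m12 agree A mA.
pose n1 : {measure set T -> \bar R} :=
  measure_function_pushforward__canonical__measure_function_Measure m1 mf1.
pose n2 : {measure set T -> \bar R} :=
  measure_function_pushforward__canonical__measure_function_Measure m2 mf2.
change (n1 A = n2 A).
(* Adding the whole space to the pi-system keeps it a pi-system, and makes it
   cover the space by a set of finite measure. *)
apply: (@measure_unique _ R T (setT |` G) (fun=> setT)) => //.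
- rewrite mG; apply/seteqP; split; apply: smallest_sub;
    try exact: smallest_sigma_algebra.
    by move=> B GB; apply: sub_sigma_algebra; right.
  move=> B [->|GB]; last exact: sub_sigma_algebra.
  by rewrite -mG.
- move=> B C [->|GB] [->|GC]; rewrite ?setTI ?setIT;
    by [left|right|right; exact: IG].
- by move=> _; left.
- by rewrite bigcup_const.
- by move=> B [->|/agree].
Qed.

(** ** The law of the coordinates of a uniform point *)

Section CubeVolume.
Variable R : realType.
Notation mu := (@lebesgue_measure R).

Lemma cube_volume0 m : cube_volume (set0 : set (m.-tuple R)) = 0%E.
Proof.
elim: m => [|m IH] /=; first by rewrite indic0.
apply: integral0_eq => x _.
by rewrite (_ : [set y | _] = set0) // -subset0 => y.
Qed.

Lemma cube_volume_prod m (B : 'I_m -> set R) : (forall i, measurable (B i)) ->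
  cube_volume [set y : m.-tuple R | forall i, B i (tnth y i)] =
  (\prod_(i < m) mu (B i `&` `[0%R, 1%R]))%E.
Proof.
elim: m B => [|m IH] B mB /=.
  by rewrite big_ord0 indicE mem_set // => -[].
rewrite big_ord_recl.
set c := (\prod_(i < m) _)%E.
transitivity (\int[mu]_(x in `[0%R, 1%R]) ((\1_(B ord0) x)%:E * c))%E.
  apply: eq_integral => x _; rewrite indicE; case: (pselect (B ord0 x)) => Bx.
    rewrite mem_set // mul1e /c -IH //; congr cube_volume; apply/seteqP; split.
      by move=> y /= By i; have := By (lift ord0 i); rewrite tnthS.
    move=> y /= By i; case: (unliftP ord0 i) => [j ->|->].
      by rewrite tnthS; exact: By.
    by rewrite tnth0.
  rewrite memNset // mul0e (_ : [set y | _] = set0) ?cube_volume0 //.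
  by rewrite -subset0 => y /= /(_ ord0); rewrite tnth0.
have cfin : c \is a fin_num.
  rewrite /c; apply: prode_fin_num => i _.
  have le1 : (mu (B (lift ord0 i) `&` `[0%R, 1%R]) <= 1)%E.
    have <- : mu `[0%R, 1%R]%classic = 1%E.
      by rewrite lebesgue_measure_itv /= lte01 oppr0 adde0.
    have mBI : measurable (B (lift ord0 i) `&` `[0%R, 1%R]) by exact: measurableI.
    by apply: le_measure; rewrite ?inE.
  by rewrite ge0_fin_numE // (le_lt_trans le1) // ltry.
rewrite -(fineK cfin).
apply: etrans; first apply: ge0_integralZr => //=.
- have mi : measurable_fun [set: R] (\1_(B ord0) : R -> R).
    exact: measurable_indic.
  apply/measurable_EFinP. apply: measurable_funTS. exact: mi.
- by rewrite lee_fin fine_ge0 // /c; apply: prode_ge0 => i _.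
- have m01 : measurable (`[0%R, 1%R]%classic : set R) by [].
  by congr (_ * _)%E; exact: (integral_indic mu m01 (mB ord0)).
Qed.

(** The right-hand side is the tail of the uniform law on [0, 1/2].  What matters
    is that [x] does not occur in it: this is the homogeneity of the circle. *)
Lemma circ_ray_volume (x c : R) : 0 <= x <= 1 ->
  mu [set t | (0 <= t <= 1) /\ c <= circ (x - t)] =
  (if c <= 0 then 1 else Num.max (1 - 2 * c) 0)%:E.
Proof.
move=> /andP[x0 x1]; case: leP => c0.
  rewrite (_ : [set t | _] = `[0, 1]%classic).
    by rewrite lebesgue_measure_itv /= lte01 oppr0 adde0.
  apply/seteqP; split=> t /=; rewrite in_itv /=; first by case.
  move=> t01; split => //; rewrite (le_trans c0) // circ_ge0 //.
  by apply: cube_diff_le1 => //; rewrite x0.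
have [c2|c2] := ltP (1 - 2 * c) 0.
  rewrite (_ : [set t | _] = set0) ?measure0 //.
  rewrite -subset0 => t /= [_ h].
  by have := circ_le_half (x - t); lra.
(* The points at distance at least [c] on either side of [x], without those
   that are close to [x] when going around the circle. *)
pose a1 := Num.max 0 (x - 1 + c); pose b2 := Num.min 1 (x + 1 - c).
rewrite (_ : [set t | _] = `[a1, x - c]%classic `|` `[x + c, b2]%classic).
  have itvE (u v : R) : mu `[u, v]%classic = (Num.max (v - u) 0)%:E.
    rewrite lebesgue_measure_itv /= lte_fin /Order.max.
    by case: (ltP u v) => uv; case: ltP => ? //; congr EFin; lra.
  apply: etrans; first apply: measureU => //.
    by rewrite -subset0 => t [] /=; rewrite !in_itv /= => ? ?; lra.
  rewrite [X in (X + _)%E]itvE [X in (_ + X)%E]itvE -EFinD /a1 /b2.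
  congr EFin.
  have len (u v : R) : u = v -> 0 <= v -> Num.max u 0 = v by move=> -> ?; rewrite max_l.
  have len0 (u : R) : u <= 0 -> Num.max u 0 = 0 by move=> ?; rewrite max_r.
  have [h1|/ltW h1] := leP (x - 1 + c) 0; have [h2|/ltW h2] := leP (x + 1 - c) 1.
  - by rewrite len0 ?(len _ (1 - 2 * c)) ?add0r //; lra.
  - by rewrite (len _ (x - c)) ?(len _ (1 - (x + c))) //; lra.
  - by rewrite (len _ (1 - 2 * c)) ?(len _ (1 - 2 * c)) //; lra.
  - by rewrite (len _ (1 - 2 * c)) ?len0 ?addr0 //; lra.
apply/seteqP; split=> t /=; rewrite !in_itv /= /a1 /b2 ge_max le_min /circ le_min.
  case=> /andP[t0 t1]; rewrite t0 t1 /=.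
  have [h|h] := leP 0 (x - t).
    by rewrite (ger0_norm h) => /andP[h1 h2]; left; apply/andP; split; lra.
  by rewrite (ltr0_norm h) => /andP[h1 h2]; right; apply/andP; split; lra.
move=> [/andP[/andP[h1 h2] h3]|/and3P[h1 h2 h3]].
  by rewrite ger0_norm; [split; [|apply/andP; split]|]; lra.
by rewrite ler0_norm; [split; [|apply/andP; split]|]; lra.
Qed.

Lemma measurable_circ : measurable_fun [set: R] (@circ R).
Proof.
apply: measurable_minr; first exact: normr_measurable.
by apply: measurable_funB => //; exact: normr_measurable.
Qed.

(** The rays generate the Borel sets. *)
Lemma circ_law (x x' : R) (B : set R) : 0 <= x <= 1 -> 0 <= x' <= 1 ->
  measurable B ->
  mu ((fun t => circ (x - t)) @^-1` B `&` `[0, 1]) =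
  mu ((fun t => circ (x' - t)) @^-1` B `&` `[0, 1]).
Proof.
move=> x01 x'01; have m01 : measurable (`[0%R, 1%R]%classic : set R) by [].
have mc y : measurable_fun [set: R] (fun t => circ (y - t)).
  apply: measurableT_comp; first exact: measurable_circ.
  exact: measurable_funB.
pose m0 : {measure set (measurableTypeR R) -> \bar R} := mrestr mu m01.
move=> mB.
change (m0 ((fun t => circ (x - t)) @^-1` B) = m0 ((fun t => circ (x' - t)) @^-1` B)).
have H := (@eq_preimage_measure R _ _ _ (measurableTypeR R) _ _ m0 m0
  (fun t => circ (x - t)) (fun t => circ (x' - t)) (@RGenCInfty.G R)).
refine (H _ _ _ _ _ _ _ B mB) => //.
- exact: mc.
- exact: mc.
- exact: RGenCInfty.measurableE.
- move=> _ _ [a ->] [b ->]; exists (Num.max a b).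
  by apply/seteqP; split => t /=; rewrite !in_itv /= !andbT ge_max => /andP.
- by rewrite /= /mrestr setTI lebesgue_measure_itv /= lte01 oppr0 adde0 ltry.
- move=> _ [c ->] //=.
  rewrite /mrestr /=.
  have E y : (fun t => circ (y - t)) @^-1` `[c, +oo[ `&` `[0, 1] =
     [set t | (0 <= t <= 1) /\ c <= circ (y - t)].
    apply/seteqP; split=> t /=; rewrite !in_itv /= andbT; by case.
  by rewrite !E !circ_ray_volume.
Qed.

End CubeVolume.

(** ** Balls of equal radius have equal volume *)

Section ProductSets.
Context {d} {T : measurableType d} {m : nat}.

Definition prod_set (B : 'I_m -> set T) : set (m.-tuple T) :=
  [set y | forall i, B i (tnth y i)].

Lemma measurable_prod_set (B : 'I_m -> set T) :
  (forall i, measurable (B i)) -> measurable (prod_set B).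
Proof.
move=> mB; rewrite (_ : prod_set B =
   \bigcap_(i in [set: 'I_m]) ((fun y => tnth y i) @^-1` B i)).
  apply: fin_bigcap_measurable => // i _.
  by rewrite -[X in measurable X]setTI; exact: measurable_tnth.
by apply/seteqP; split=> y /= h i; move: (h i) => //; apply.
Qed.

Definition prod_sets : set_system (m.-tuple T) :=
  [set A | exists2 B, (forall i, measurable (B i)) & A = prod_set B].

Lemma prod_sets_setI : setI_closed prod_sets.
Proof.
move=> _ _ [B mB ->] [C mC ->]; exists (fun i => B i `&` C i).
  by move=> i; exact: measurableI.
by apply/seteqP; split=> y /= h; [move=> i; split; apply h|split=> i; apply h].
Qed.

Lemma measurable_tupleE : @measurable _ (m.-tuple T) = <<s prod_sets >>.
Proof.
apply/seteqP; split.
  apply: smallest_sub; first exact: smallest_sigma_algebra.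
  move=> A; rewrite -bigcup_seq => -[i _ [B mB <-]].
  apply: sub_sigma_algebra; exists (fun j => if j == i then B else setT).
    by move=> j; case: ifP.
  rewrite setTI; apply/seteqP; split=> y /=.
    by move=> By j; case: eqP => // ->.
  by move=> /(_ i); rewrite eqxx.
apply: smallest_sub; first exact: sigma_algebra_measurable.
by move=> _ [B mB ->]; exact: measurable_prod_set.
Qed.

End ProductSets.

Section MeasurableNorm.
Context d (T : measurableType d) (R : realType) (m : nat) (r : \bar R).
Variable f : 'I_m -> T -> R.
Hypothesis mf : forall i, measurable_fun setT (f i).

Lemma measurable_lr_norm : measurable_fun setT (fun w => lr_norm r (f ^~ w)).
Proof.
have mn i : measurable_fun setT (fun w => `|f i w|).
  by apply: measurableT_comp => //; exact: normr_measurable.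
have maxm : measurable_fun setT
    (fun w => \big[Num.max/0]_(i < m) `|f i w|).
  elim: (index_enum _) => [|i s IH].
    by under eq_fun do rewrite big_nil; exact: measurable_cst.
  under eq_fun do rewrite big_cons; exact: measurable_maxr.
rewrite /lr_norm; case: r => [s| |] //.
apply: (@measurableT_comp _ _ _ _ _ _ (fun z : R => z `^ s^-1)).
  exact: measurable_powR.
apply: measurable_sum => i.
by apply: (@measurableT_comp _ _ _ _ _ _ (fun z : R => z `^ s)) => //;
  exact: measurable_powR.
Qed.

End MeasurableNorm.

Section Balls.
Variables (R : realType) (m : nat) (r : \bar R).
Hypotheses (hr : (1 <= r)%E) (hm : (0 < m)%N).
Notation mu := (@lebesgue_measure R).
Notation tup := (m.-tuple R).
Implicit Types x y : tup.

Lemma cubeE : @cube R m = prod_set (fun=> `[0, 1]%classic : set R).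
Proof. by apply/seteqP; split=> y /= h i; have := h i; rewrite /= in_itv. Qed.

Lemma measurable_cube : measurable (@cube R m).
Proof. by rewrite cubeE; apply: measurable_prod_set. Qed.

Definition circs x y : tup := [tuple circ (tnth x i - tnth y i) | i < m].

Lemma measurable_fun_circ d (T : measurableType d) (f g : T -> R) :
  measurable_fun setT f -> measurable_fun setT g ->
  measurable_fun setT (fun w => circ (f w - g w)).
Proof.
move=> mf mg; apply: (measurableT_comp (@measurable_circ R)).
exact: measurable_funB.
Qed.

Lemma measurable_circs x : measurable_fun setT (circs x).
Proof.
apply/measurable_fun_tnthP => i.
rewrite (_ : _ \o _ = fun y => circ (tnth x i - tnth y i)); last first.
  by apply/funext => y /=; rewrite tnth_mktuple.
by apply: measurable_fun_circ => //; exact: measurable_tnth.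
Qed.

Lemma torus_dist_circs x y : cube x -> cube y ->
  torus_dist r x y = lr_norm r (tnth (circs x y)).
Proof.
move=> cx cy; rewrite torus_distE //; apply: eq_lr_norm => // i.
by rewrite tnth_mktuple.
Qed.

Section Law.
Variable nu : probability tup R.
Hypothesis nuE : forall A, measurable A -> nu A = cube_volume A.

Lemma prod_set_volume (B : 'I_m -> set R) : (forall i, measurable (B i)) ->
  nu (prod_set B) = (\prod_(i < m) mu (B i `&` `[0%R, 1%R]))%E.
Proof.
move=> mB; rewrite nuE; last exact: measurable_prod_set.
exact: cube_volume_prod.
Qed.

(** Product sets generate the sigma-algebra, and on them the claim is the
    one-dimensional law of the circular distance. *)
Lemma circs_law x x' (A : set tup) : cube x -> cube x' -> measurable A ->
  nu (circs x @^-1` A `&` @cube R m) = nu (circs x' @^-1` A `&` @cube R m).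
Proof.
move=> cx cx' mA; pose n0 : {measure set tup -> \bar R} := mrestr nu measurable_cube.
change (n0 (circs x @^-1` A) = n0 (circs x' @^-1` A)).
apply: (eq_preimage_measure (G := prod_sets)) mA => //.
- exact: measurable_circs.
- exact: measurable_circs.
- exact: measurable_tupleE.
- exact: prod_sets_setI.
- rewrite /n0 /= /mrestr setTI (le_lt_trans (probability_le1 _ _)) ?ltry //.
  exact: measurable_cube.
- move=> _ [B mB ->]; rewrite /n0 /= /mrestr.
  have E z : circs z @^-1` prod_set B `&` @cube R m =
     prod_set (fun i => (fun t => circ (tnth z i - t)) @^-1` B i `&` `[0%R, 1%R]).
    rewrite cubeE; apply/seteqP; split=> y /=.
      by move=> [h1 h2] i; split; [have := h1 i; rewrite tnth_mktuple|apply: h2].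
    by move=> h; split=> i; have [] := h i; rewrite ?tnth_mktuple.
  have mB' z i : measurable ((fun t => circ (tnth z i - t)) @^-1` B i `&` `[0%R, 1%R]).
    apply: measurableI => //; rewrite -[X in measurable X]setTI.
    by apply: measurable_fun_circ.
  rewrite !E !prod_set_volume //; apply: eq_bigr => i _.
  by rewrite -!setIA !setIid; apply: circ_law.
Qed.

Lemma torus_ballE x rho : cube x ->
  torus_ball r x rho = circs x @^-1` [set z | lr_norm r (tnth z) <= rho] `&` @cube R m.
Proof.
move=> cx; apply/seteqP; split=> y /=.
  by move=> [cy]; rewrite torus_dist_circs.
by move=> [h cy]; split => //; rewrite torus_dist_circs.
Qed.

Lemma measurable_norm_le rho :
  measurable [set z : tup | lr_norm r (tnth z) <= rho].
Proof.
rewrite -[X in measurable X]setTI; apply: measurable_fun_ler => //.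
- by apply: (measurable_lr_norm r (f := fun i z => tnth z i)) => i; exact: measurable_tnth.
Qed.

Lemma measurable_torus_ball x rho : cube x -> measurable (torus_ball r x rho).
Proof.
move=> cx; rewrite torus_ballE //; apply: measurableI; last exact: measurable_cube.
rewrite -[X in measurable X]setTI; apply: measurable_circs => //.
exact: measurable_norm_le.
Qed.

(** A ball is the preimage of a set that does not depend on its centre under the
    distance vector [circs x], whose law does not depend on [x]. *)
Lemma torus_ball_volume x x' rho : cube x -> cube x' ->
  nu (torus_ball r x rho) = nu (torus_ball r x' rho).
Proof.
move=> cx cx'; rewrite !torus_ballE //; apply: circs_law => //.
exact: measurable_norm_le.
Qed.

End Law.
End Balls.

(** ** Spheres are null, so that every volume is the volume of a ball *)

Section LevelSets.
Variable R : realType.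
Notation mu := (@lebesgue_measure R).

Lemma cube_volumeS k (A : set (k.+1.-tuple R)) : cube_volume A =
  (\int[mu]_(x in `[0%R, 1%R]) cube_volume [set y : k.-tuple R | A [tuple of x :: y]])%E.
Proof. by []. Qed.

(** For every value of the first coordinate, the section is a level set of the
    same kind in one dimension less. *)
Lemma cube_volume_level0 m (phi : 'I_m.+1 -> R -> R) :
  (forall i, measurable_fun setT (phi i)) ->
  (forall i c, mu ([set t | phi i t = c] `&` `[0%R, 1%R]) = 0%E) ->
  forall c,
  cube_volume [set y : m.+1.-tuple R | \sum_i phi i (tnth y i) = c] = 0%E.
Proof.
move=> mphi phi0; elim: m phi mphi phi0 => [|m IH] phi mphi phi0 c.
  rewrite /=; set A := [set t | phi ord0 t = c].
  have mA : measurable A.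
    rewrite (_ : A = phi ord0 @^-1` [set c]) //.
    by rewrite -[X in measurable X]setTI; exact: mphi.
  have m01 : measurable (`[0%R, 1%R]%classic : set R) by [].
  rewrite -(phi0 ord0 c) -/A; apply: etrans (integral_indic mu m01 mA).
  apply: eq_integral => x _; rewrite !indicE; congr (_%:R)%:E; congr nat_of_bool.
  by apply/idP/idP => /set_mem h; apply/mem_set; move: h;
    rewrite /= big_ord_recl big_ord0 addr0 tnth0.
rewrite cube_volumeS; apply: integral0_eq => x _.
rewrite -(IH (fun i => phi (lift ord0 i)) _ _ (c - phi ord0 x)) //.
have E (y : m.+1.-tuple R) : \sum_i phi i (tnth [tuple of x :: y] i) =
    phi ord0 x + \sum_i phi (lift ord0 i) (tnth y i).
  by rewrite big_ord_recl tnth0; under eq_bigr do rewrite tnthS.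
congr cube_volume; apply/seteqP; split=> y /=; rewrite E.
  by move=> <-; rewrite addrC addKr.
by move=> ->; rewrite addrC subrK.
Qed.

Lemma cube_volume_level m (phi : 'I_m -> R -> R) : (0 < m)%N ->
  (forall i, measurable_fun setT (phi i)) ->
  (forall i c, mu ([set t | phi i t = c] `&` `[0%R, 1%R]) = 0%E) ->
  forall c,
  cube_volume [set y : m.-tuple R | \sum_i phi i (tnth y i) = c] = 0%E.
Proof. by case: m phi => // m phi _; exact: cube_volume_level0. Qed.

Lemma circ_level0 (x c : R) : mu ([set t | circ (x - t) = c] `&` `[0%R, 1%R]) = 0%E.
Proof.
apply: (@subset_measure0 _ _ _ mu _ [set` [:: x - c; x + c; x - (1 - c); x + (1 - c)]]) => //.
- apply: measurableI => //; rewrite (_ : [set t | _] =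
    (fun t => circ (x - t)) @^-1` [set c]) //.
  by rewrite -[X in measurable X]setTI; apply: measurable_fun_circ.
- apply: countable_measurable => //.
  by apply/finite_set_countable/finite_seqP; eexists.
- move=> t [/=]; rewrite /circ !inE.
  have [t0|t0] := leP 0 (x - t).
    rewrite (ger0_norm t0); case: leP => _ <- _.
      by apply/or4P; constructor 1; apply/eqP; lra.
    by apply/or4P; constructor 3; apply/eqP; lra.
  rewrite (ltr0_norm t0); case: leP => _ <- _.
    by apply/or4P; constructor 2; apply/eqP; lra.
  by apply/or4P; constructor 4; apply/eqP; lra.
- by apply/countable_lebesgue_measure0/finite_set_countable/finite_seqP; eexists.
Qed.

End LevelSets.

Section Spheres.
Variables (R : realType) (m : nat) (r : \bar R).
Hypotheses (hr : (1 <= r)%E) (hm : (0 < m)%N).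
Notation mu := (@lebesgue_measure R).
Notation tup := (m.-tuple R).
Variable nu : probability tup R.
Hypothesis nuE : forall A, measurable A -> nu A = cube_volume A.
Implicit Types x y : tup.

Lemma coord_level_null x i c :
  nu.-negligible [set y | cube y /\ circ (tnth x i - tnth y i) = c].
Proof.
pose B j := if j == i then [set t | circ (tnth x i - t) = c] `&` `[0%R, 1%R]
            else `[0%R, 1%R]%classic.
have mB j : measurable (B j).
  rewrite /B; case: ifP => // _; apply: measurableI => //.
  rewrite (_ : [set t | _] = (fun t => circ (tnth x i - t)) @^-1` [set c]) //.
  by rewrite -[X in measurable X]setTI; apply: measurable_fun_circ.
exists (prod_set B); split; first exact: measurable_prod_set.
  rewrite prod_set_volume // (bigD1 i) //= /B eqxx -setIA setIid circ_level0 mul0e //.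
rewrite /B => y /= [cy yc] j.
case: (eqVneq j i) => [->|_]; last by rewrite /= in_itv /=; exact: cy.
by split => //; rewrite /= in_itv /=; exact: cy.
Qed.

Definition sphere x rho : set tup := [set y | cube y /\ torus_dist r x y = rho].

Lemma sphereE x rho : cube x ->
  sphere x rho = circs x @^-1` [set z | lr_norm r (tnth z) = rho] `&` @cube R m.
Proof.
move=> cx; apply/seteqP; split=> y /=.
  by move=> [cy]; rewrite torus_dist_circs.
by move=> [h cy]; split => //; rewrite torus_dist_circs.
Qed.

Lemma measurable_sphere x rho : cube x -> measurable (sphere x rho).
Proof.
move=> cx; rewrite sphereE //; apply: measurableI; last exact: measurable_cube.
rewrite -[X in measurable X]setTI; apply: measurable_circs => //.
rewrite (_ : [set z | _] = (fun z : tup => lr_norm r (tnth z)) @^-1` [set rho]) //.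
rewrite -[X in measurable X]setTI.
by apply: (measurable_lr_norm r (f := fun i z => tnth z i)) => // i; exact: measurable_tnth.
Qed.

(** For finite [r] the sphere is a level set of a sum of functions of one
    coordinate each.  For the maximum norm this argument fails, but then some
    coordinate is at distance [rho]. *)
Lemma sphere_null x rho : cube x -> nu (sphere x rho) = 0%E.
Proof.
move=> cx; have ms := measurable_sphere rho cx.
have hs := hr; move: hs; case rE : r => [s| |] // hs.
- move: hs; rewrite lee_fin => s1; have s0 : 0 < s by rewrite (lt_le_trans ltr01).
  have sN0 : s != 0 by rewrite gt_eqF.
  have powK (a : R) : 0 <= a -> (a `^ s) `^ s^-1 = a.
    by move=> a0; rewrite -powRrM mulfV // powRr1.
  pose phi i t := circ (tnth x i - t) `^ s.
  have mphi i : measurable_fun setT (phi i).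
    apply: (measurableT_comp (@measurable_powR R s)).
    exact: measurable_fun_circ.
  have phi0 i c : mu ([set t | phi i t = c] `&` `[0%R, 1%R]) = 0%E.
    apply: subset_measure0 (circ_level0 (tnth x i) (c `^ s^-1)).
    + apply: measurableI => //; rewrite (_ : [set t | _] = phi i @^-1` [set c]) //.
      by rewrite -[X in measurable X]setTI; exact: mphi.
    + apply: measurableI => //; rewrite (_ : [set t | _] =
        (fun t => circ (tnth x i - t)) @^-1` [set c `^ s^-1]) //.
      by rewrite -[X in measurable X]setTI; exact: measurable_fun_circ.
    + move=> t [/= pc t01]; split => //=; rewrite -pc powK //.
      by apply: circ_ge0; apply: cube_diff_le1; [exact: cx|move: t01; rewrite in_itv].
  pose L := [set y : m.-tuple R | \sum_i phi i (tnth y i) = rho `^ s].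
  have mL : measurable L.
    rewrite (_ : L = (fun y => \sum_i phi i (tnth y i)) @^-1` [set rho `^ s]) //.
    rewrite -[X in measurable X]setTI.
    have : measurable_fun [set: m.-tuple R] (fun y => \sum_i phi i (tnth y i)).
      by apply: measurable_sum => i; apply: measurableT_comp => //; exact: measurable_tnth.
    by apply.
  apply: (subset_measure0 _ mL) => //.
  + move=> y [cy dE]; rewrite /L /= -dE torus_distE // /lr_norm rE.
    rewrite -powRrM mulVf // powRr1; last by apply: sumr_ge0 => i _; exact: powR_ge0.
    apply: eq_bigr => i _; rewrite /phi ger0_norm // circ_ge0 //.
    by apply: cube_diff_le1; [exact: cx|exact: cy].
  + by apply: etrans (nuE mL) _; exact: cube_volume_level.
- have sub : sphere x rho `<=` \big[setU/set0]_(i < m)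
      [set y | cube y /\ circ (tnth x i - tnth y i) = rho].
    move=> y [cy]; rewrite torus_distE // /lr_norm rE => dE.
    pose f i := circ (tnth x i - tnth y i).
    have f0 i : `|f i| = f i.
      by rewrite ger0_norm // circ_ge0 //; apply: cube_diff_le1; [exact: cx|exact: cy].
    have [i _ iE] : exists2 i, true & f i = rho.
      rewrite -dE; have [i0 _] : exists i0 : 'I_m, true by exists (Ordinal hm).
      have [i _ /esym fi] := @eq_bigmax _ _ _ 0 i0 xpredT (fun i => `|f i|) isT
          (fun i _ => normr_ge0 _).
      by exists i => //; rewrite -[LHS]f0.
    by rewrite (bigD1 i) //=; left.
  apply: (measure_negligible ms); apply: negligibleS sub _.
  elim: (index_enum _) => [|i e IH]; first by rewrite big_nil; exact: negligible_set0.
  rewrite big_cons; apply: negligibleU => //; exact: coord_level_null.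
Qed.

End Spheres.

Section Radius.
Variables (R : realType) (m : nat) (r : \bar R).
Notation tup := (m.-tuple R).
Implicit Types x y : tup.

Definition origin : tup := [tuple 0 | i < m].

Lemma cube_origin : cube origin.
Proof. by move=> i; rewrite tnth_mktuple lexx ler01. Qed.

(** The radius that [ball_of_volume] selects at the origin; by homogeneity it
    is the one selected at every point of the cube. *)
Definition vol_radius (a : R) : R :=
  get [set rho | 0 <= rho /\ cube_volume (torus_ball r origin rho) = a%:E].

Hypotheses (hr : (1 <= r)%E) (hm : (0 < m)%N).
Notation mu := (@lebesgue_measure R).
Variable nu : probability tup R.
Hypothesis nuE : forall A, measurable A -> nu A = cube_volume A.

Lemma ball_of_volumeE x a : cube x ->
  ball_of_volume r x a = torus_ball r x (vol_radius a).
Proof.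
move=> cx; rewrite /ball_of_volume /vol_radius; congr (torus_ball _ _ (get _)).
have mx rho := measurable_torus_ball hr rho cx.
have m0 rho := measurable_torus_ball hr rho cube_origin.
by apply/seteqP; split=> rho /= [rho0 E]; split => //; rewrite -E -!nuE //;
  [exact: (torus_ball_volume hr nuE rho cube_origin cx)|exact: (torus_ball_volume hr nuE rho cx cube_origin)].
Qed.

Let F rho := nu (torus_ball r origin rho).

Let mball rho := measurable_torus_ball hr rho cube_origin.

Let F_mono rho rho' : rho <= rho' -> (F rho <= F rho')%E.
Proof.
move=> h; apply: le_measure; rewrite ?inE; [exact: mball..|].
by move=> y [cy yd]; split => //; exact: le_trans h.
Qed.

Let nu_cube : nu (@cube R m) = 1%E.
Proof.
rewrite cubeE prod_set_volume //; apply: big1 => i _.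
by rewrite setIid lebesgue_measure_itv /= lte01 oppr0 adde0.
Qed.

Let ball_diameter : torus_ball r origin m%:R = @cube R m.
Proof.
apply/seteqP; split=> y; first by case.
move=> cy; split => //; rewrite torus_distE //; last exact: cube_origin.
apply: lr_norm_le_box => // i.
have d1 : `|tnth origin i - tnth y i| <= 1.
  by apply: cube_diff_le1; [exact: cube_origin|exact: cy].
rewrite divff ?pnatr_eq0 -?lt0n // ger0_norm ?circ_ge0 //.
by rewrite (le_trans (circ_le_half _)) // invf_le1 // ler1n.
Qed.

(** Intermediate value theorem for the volume of a ball as a function of its
    radius, which is continuous on the right because balls are closed, and on the
    left because spheres are null.  The witness is the supremum of the radii of
    the balls of volume at most [a]. *)
Lemma ball_volume_surj a : 0 <= a <= 1 -> exists2 rho, 0 <= rho & F rho = a%:E.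
Proof.
move=> /andP[a0 a1].
have [->|aN1] := eqVneq a 1.
  by exists m%:R => //; rewrite /F ball_diameter nu_cube.
have {a1 aN1} a1 : a < 1 by rewrite lt_neqAle aN1.
pose S := [set rho | 0 <= rho /\ (F rho <= a%:E)%E].
have S0 : S 0.
  split => //; rewrite /F (_ : torus_ball r origin 0 = sphere r origin 0).
    by rewrite (sphere_null hr hm nuE) ?lee_fin //; exact: cube_origin.
  apply/seteqP; split=> y [cy h]; split => //; last by rewrite h.
  apply/eqP; rewrite eq_le h torus_distE ?lr_norm_ge0 //; exact: cube_origin.
have ubS : ubound S m%:R.
  move=> rho [_ Fa]; rewrite leNgt; apply/negP => /ltW /F_mono.
  by rewrite /F ball_diameter nu_cube => /le_trans /(_ Fa); rewrite lee_fin leNgt a1.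
have supS : has_sup S by split; [exists 0|exists m%:R].
pose s := sup S; have s0 : 0 <= s by apply: ub_le_sup => //; exists m%:R.
exists s => //; apply/eqP; rewrite eq_le; apply/andP; split.
- pose G n := torus_ball r origin (s - n.+1%:R^-1).
  have Ga n : (nu (G n) <= a%:E)%E.
    have n0 : 0 < n.+1%:R^-1 :> R by rewrite invr_gt0.
    have [rho [rho0 Fa] lt_rho] := sup_adherent n0 supS.
    by apply: le_trans Fa; apply: F_mono; exact: ltW.
  have mG n : measurable (G n) by exact: mball.
  have mUG : measurable (\bigcup_n G n) by exact: bigcup_measurable.
  have ndG : nondecreasing_seq G.
    move=> n k nk; apply/subsetPset => y [cy h]; split => //.
    by rewrite (le_trans h) // lerD2l lerN2 lef_pV2 ?posrE // ler_nat ltnS.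
  have UGa : (nu (\bigcup_n G n) <= a%:E)%E.
    have cvgG := nondecreasing_cvg_mu mG mUG ndG (mu := nu).
    rewrite -(cvg_lim _ cvgG) //; apply: lime_le; first by apply/cvg_ex; eexists; exact: cvgG.
    by apply: nearW.
  have msph : measurable (sphere r origin s).
    by apply: measurable_sphere => //; exact: cube_origin.
  apply: (@le_trans _ _ (nu (sphere r origin s `|` \bigcup_n G n))).
    apply: le_measure; rewrite ?inE; [exact: mball|exact: measurableU|].
    move=> y [cy]; rewrite le_eqVlt => /predU1P[h|h]; first by left.
    right; have [n hn] := ltr_add_invr h.
    exists n => //; split => //.
    by rewrite lerBrDr ltW.
  apply: le_trans (measureU2 _ _ _) _ => //.
  by rewrite [X in (X + _)%E](sphere_null hr hm nuE) ?add0e //; exact: cube_origin.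
- pose G n := torus_ball r origin (s + n.+1%:R^-1).
  have Ga n : (a%:E <= nu (G n))%E.
    rewrite leNgt; apply/negP => /ltW Fa.
    have : S (s + n.+1%:R^-1) by split => //; rewrite addr_ge0 // invr_ge0.
    by move/(ub_le_sup supS.2); rewrite -/s gerDl leNgt invr_gt0 ltr0n.
  have mG n : measurable (G n) by exact: mball.
  have IGE : torus_ball r origin s = \bigcap_n G n.
    apply/seteqP; split=> y.
      by move=> [cy h] n _; split => //; rewrite (le_trans h) // lerDl invr_ge0.
    move=> h; split; first by have [] := h 0%N Logic.I.
    apply/ler_addgt0Pr => e e0.
    have [n hn] := ltr_add_invr e0; rewrite add0r in hn.
    have [_ yn] := h n Logic.I; apply: le_trans yn _.
    by rewrite lerD2l ltW.
  have mIG : measurable (\bigcap_n G n) by rewrite -IGE; exact: mball.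
  have niG : nonincreasing_seq G.
    move=> n k nk; apply/subsetPset => y [cy h]; split => //.
    by rewrite (le_trans h) // lerD2l lef_pV2 ?posrE // ler_nat ltnS.
  have G0 : (nu (G 0%N) < +oo)%E.
    by rewrite (le_lt_trans (probability_le1 _ (mG 0%N))) ?ltry.
  have cvgG := nonincreasing_cvg_mu G0 mG mIG niG.
  rewrite /F IGE -(cvg_lim _ cvgG) //; apply: lime_ge; first by apply/cvg_ex; eexists; exact: cvgG.
  by apply: nearW.
Qed.

Lemma vol_radiusP x a : cube x -> 0 <= a <= 1 ->
  0 <= vol_radius a /\ nu (torus_ball r x (vol_radius a)) = a%:E.
Proof.
move=> cx a01; have [rho rho0 Fa] := ball_volume_surj a01.
have [|g0 ga] := @getPex _ [set rho | 0 <= rho /\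
    cube_volume (torus_ball r origin rho) = a%:E].
  by exists rho; split => //; rewrite -nuE // mball.
split => //; rewrite (torus_ball_volume hr nuE _ cx cube_origin) nuE //.
Qed.

Lemma le_vol_radius a b : 0 <= a <= 1 -> 0 <= b <= 1 -> a <= b -> vol_radius a <= vol_radius b.
Proof.
move=> a01 b01; rewrite le_eqVlt => /predU1P[->//|ab].
have [_ Fa] := vol_radiusP cube_origin a01; have [_ Fb] := vol_radiusP cube_origin b01.
rewrite leNgt; apply/negP => /ltW /F_mono; rewrite /F Fa Fb.
by rewrite lee_fin leNgt ab.
Qed.

(** The volume of a ball bounds its radius, because the ball contains a box whose
    side is [2 / m] times the radius.  The box is centred at the origin, where the
    ball has the same volume. *)
Lemma torus_ball_coord x y a i : cube x -> 0 <= a <= 1 ->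
  torus_ball r x (vol_radius a) y ->
  (2 * circ (tnth x i - tnth y i) / m%:R) ^+ m <= a.
Proof.
move=> cx a01 [cy xy]; have [rad0 _] := vol_radiusP cx a01.
have d1 : `|tnth x i - tnth y i| <= 1 by apply: cube_diff_le1; [exact: cx|exact: cy].
set t := circ _; have t0 : 0 <= t by exact: circ_ge0.
have tr : t <= vol_radius a.
  rewrite torus_distE // in xy; apply: le_trans xy; rewrite -[leLHS]ger0_norm //.
  exact: (lr_norm_ge_coord hr (fun i => circ (tnth x i - tnth y i)) i).
pose c := vol_radius a / m%:R; have m0R : 0 < m%:R :> R by rewrite ltr0n.
have c0 : 0 <= c by rewrite divr_ge0.
pose A := [set s | circ (0 - s) <= c] `&` `[0%R, 1%R].
have mA : measurable A.
  apply: measurableI => //; rewrite -[X in measurable X]setTI.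
  by apply: measurable_fun_ler => //; exact: measurable_fun_circ.
have muA : (mu A <= 1)%E.
  have <- : mu `[0%R, 1%R]%classic = 1%E.
    by rewrite lebesgue_measure_itv /= lte01 oppr0 adde0.
  by apply: le_measure; rewrite ?inE //; exact: subIsetr.
have Afin : mu A \is a fin_num by rewrite ge0_fin_numE // (le_lt_trans muA) // ltry.
have At : 2 * t / m%:R <= fine (mu A).
  have [tm1 tc] : 2 * t / m%:R <= 1 /\ t / m%:R <= c.
    split; last by rewrite ler_pM2r ?invr_gt0.
    rewrite ler_pdivrMr // mul1r; have := circ_le_half (tnth x i - tnth y i).
    by have : 1 <= m%:R :> R; [rewrite ler1n|rewrite -/t; lra].
  pose B := [set s | (0 <= s <= 1) /\ c <= circ (0 - s)].
  have BE : mu B = _ := circ_ray_volume c (x := 0) ltac:(by rewrite lexx ler01).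
  have mB : measurable B.
    rewrite (_ : B = [set s | c <= circ (0 - s)] `&` `[0%R, 1%R]).
      apply: measurableI => //; rewrite -[X in measurable X]setTI.
      by apply: measurable_fun_ler => //; exact: measurable_fun_circ.
    by apply/seteqP; split => s /=; rewrite in_itv /= => -[].
  have : (1 <= mu A + mu B)%E.
    have <- : mu `[0%R, 1%R]%classic = 1%E.
      by rewrite lebesgue_measure_itv /= lte01 oppr0 adde0.
    apply: le_trans (measureU2 _ _ _) => //.
    apply: le_measure; rewrite ?inE //; first exact: measurableU.
    move=> s s01; have [h|h] := leP (circ (0 - s)) c; first by left.
    by right; split; [move: s01; rewrite /= in_itv|exact: ltW].
  rewrite BE -{1}(fineK Afin) -EFinD lee_fin -mulrA.
  have A0 : 0 <= fine (mu A) by exact: fine_ge0.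
  case: (leP c 0) => cc; last by rewrite /Order.max; case: ltP => ?; lra.
  have : t / m%:R <= 0 by exact: le_trans tc cc.
  by move=> *; lra.
have := vol_radiusP cube_origin a01; case=> _ volE.
rewrite -lee_fin -volE; apply: (@le_trans _ _ (nu (prod_set (fun=> A)))); last first.
  apply: le_measure; rewrite ?inE; [exact: measurable_prod_set|exact: mball|].
  move=> z /= zA.
  have cz : cube z by move=> j; have [_] := zA j; rewrite /= in_itv.
  split => //; rewrite torus_distE //; last exact: cube_origin.
  apply: lr_norm_le_box => // j; have [] := zA j; rewrite /= => zc _.
  rewrite tnth_mktuple ger0_norm // circ_ge0 // cube_diff_le1 ?lexx ?ler01 //.
rewrite prod_set_volume // (eq_bigr (fun=> (fine (mu A))%:E)); last first.
  by move=> j _; rewrite /A -setIA setIid fineK.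
rewrite prodEFin prodr_const card_ord lee_fin lerXn2r ?nnegrE //.
  by rewrite divr_ge0 // mulr_ge0.
by apply: fine_ge0.
Qed.

End Radius.

(** * Independence of the past and of fresh noise *)

Section Noise.
Variables (R : realType) (d : measure_display) (T : measurableType d).
Variable P : probability T R.
Variables (m : nat) (X : nat -> {RV P >-> m.-tuple R}).
Variable B : nat -> nat -> {RV P >-> bool}.
Notation tup := (m.-tuple R).
Notation index := (nat + nat * nat)%type.

Lemma noise_sigma_measurable i E : noise_sigma X B i E -> measurable E.
Proof.
case: i => [k|[u v]] [A mA <-]; rewrite setTI.
  by rewrite -[X in measurable X]setTI; exact: measurable_funPT.
by rewrite -[X in measurable X]setTI; exact: measurable_funPT.
Qed.

Lemma noise_sigmaT i : noise_sigma X B i setT.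
Proof. by case: i => [k|[u v]]; exists setT => //; rewrite setTI preimage_setT. Qed.

Lemma noise_sigmaI i : setI_closed (noise_sigma X B i).
Proof.
by case: i => [k|[u v]] _ _ [A mA <-] [A' mA' <-];
  exists (A `&` A'); [exact: measurableI|rewrite preimage_setI setIACA setIid|
    exact: measurableI|rewrite preimage_setI setIACA setIid].
Qed.

(** The pi-system of finite intersections of events, each about the noise of a
    single index in [D]. *)
Definition noise_gen (D : set index) : set_system T :=
  [set H | exists (J : seq index) (E : index -> set T),
     [/\ uniq J, (forall i, i \in J -> D i /\ noise_sigma X B i (E i)) &
         H = \bigcap_(i in [set` J]) E i]].

Definition noise_field D : set_system T := <<s noise_gen D >>.

Lemma noise_genT D : noise_gen D setT.
Proof.
exists [::], (fun=> setT); split => //.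
by rewrite set_nil bigcap_set0.
Qed.

Lemma noise_genI D : setI_closed (noise_gen D).
Proof.
move=> _ _ [J [E [uJ JE ->]]] [J' [E' [uJ' JE' ->]]].
pose F i := (if i \in J then E i else setT) `&` (if i \in J' then E' i else setT).
exists (undup (J ++ J')), F; split; first exact: undup_uniq.
  move=> i; rewrite mem_undup mem_cat => /orP iJ; split.
    by case: iJ => [iJ|iJ]; [have [] := JE i iJ|have [] := JE' i iJ].
  apply: noise_sigmaI; case: ifP => hJ; try exact: noise_sigmaT.
    by have [] := JE i hJ.
  by have [] := JE' i hJ.
apply/seteqP; split=> w.
  move=> [/= h h'] i; rewrite /= mem_undup mem_cat => iJ.
  by split; case: ifP => //; [exact: h|exact: h'].
move=> h; split=> i /= iJ; have := h i; rewrite /= mem_undup mem_cat iJ ?orbT;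
  by rewrite /F iJ => /(_ isT) [].
Qed.

Lemma noise_gen_measurable D : noise_gen D `<=` measurable.
Proof.
move=> _ [J [E [_ JE ->]]]; rewrite bigcap_seq.
rewrite big_seq; elim/big_ind : _ => //; first exact: measurableI.
by move=> i iJ; have [_ /noise_sigma_measurable] := JE i iJ.
Qed.

Lemma noise_field_measurable D : noise_field D `<=` measurable.
Proof.
apply: smallest_sub; first exact: sigma_algebra_measurable.
exact: noise_gen_measurable.
Qed.

Lemma noise_fieldI D : setI_closed (noise_field D).
Proof. exact: (@measurableI _ (g_sigma_algebraType (noise_gen D))). Qed.

Lemma noise_sigma_field D i E : D i -> noise_sigma X B i E -> noise_field D E.
Proof.
move=> Di Ei; apply: sub_sigma_algebra; exists [:: i], (fun=> E).
split => //; first by move=> j; rewrite inE => /eqP ->.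
by rewrite bigcap_seq big_seq1.
Qed.

Lemma noise_field_mono D D' : D `<=` D' -> noise_field D `<=` noise_field D'.
Proof.
move=> DD'; apply: smallest_sub; first exact: smallest_sigma_algebra.
move=> H [J [E [uJ JE HE]]]; apply: sub_sigma_algebra; exists J, E; split => //.
by move=> i iJ; have [/DD' ? ?] := JE i iJ.
Qed.

Hypothesis indep : mutually_independent P (noise_sigma X B).

(** As functions of [H], both sides are finite measures, and they agree on the
    pi-system [noise_gen D] by mutual independence. *)
Lemma noise_field_indep D i H E : ~ D i -> noise_field D H ->
  noise_sigma X B i E -> P (H `&` E) = (P H * P E)%E.
Proof.
move=> Di DH iE; have mE := noise_sigma_measurable iE.
have E0 : 0 <= fine (P E) by exact: fine_ge0.
have PEfin : P E \is a fin_num by exact: fin_num_measure.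
pose m1 : {measure set T -> \bar R} := mrestr P mE.
pose m2 : {measure set T -> \bar R} := mscale (NngNum E0) P.
suff : m1 H = m2 H.
  by rewrite /m1 /m2 /= /mrestr /mscale /= fineK // => ->; rewrite muleC.
apply: (g_sigma_algebra_measure_unique (noise_gen D) _ (fun=> setT)) => //.
- exact: noise_gen_measurable.
- by move=> _; exact: noise_genT.
- by rewrite bigcup_const.
- exact: noise_genI.
- move=> _ [J [F [uJ JF ->]]]; rewrite /m1 /m2 /= /mrestr /mscale /= fineK //.
  have iJ : i \notin J by apply/negP => iJ; have [] := JF i iJ.
  pose F' j := if j == i then E else F j.
  have F'F j : j \in J -> F' j = F j.
    by rewrite /F'; case: eqP => // -> /(negP iJ).
  have uiJ : uniq (i :: J) by rewrite /= iJ.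
  have h1 := indep uJ (fun j jJ => (JF j jJ).2).
  have /(@indep (i :: J) F' uiJ) h2 j : j \in i :: J -> noise_sigma X B j (F' j).
    rewrite inE => /predU1P[->|jJ]; first by rewrite /F' eqxx.
    by rewrite F'F //; have [] := JF j jJ.
  rewrite big_cons [in P (F' i)]/F' eqxx in h2.
  have <- : (\big[mule/1]_(j <- J) P (F' j) = P (\bigcap_(j in [set` J]) F j))%E.
    by rewrite h1; apply: eq_big_seq => j /F'F ->.
  rewrite -h2.
  congr (P _); apply/seteqP; split=> w /=.
    move=> [h wE] j /=; rewrite inE => /predU1P[->|jJ]; first by rewrite /F' eqxx.
    by rewrite F'F //; exact: h.
  move=> h; split; last by have := h i; rewrite /= inE eqxx /F' eqxx => /(_ isT).
  by move=> j /= jJ; have := h j; rewrite /= inE jJ orbT F'F // => /(_ isT).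
- move=> _; rewrite /m1 /= /mrestr setTI (le_lt_trans (probability_le1 _ mE)) ?ltry //.
Qed.

End Noise.

Section Fresh.
Variables (R : realType) (d : measure_display) (T : measurableType d).
Variable P : probability T R.
Variables (m : nat) (X : nat -> {RV P >-> m.-tuple R}).
Variable B : nat -> nat -> {RV P >-> bool}.
Notation tup := (m.-tuple R).
Notation index := (nat + nat * nat)%type.
Hypothesis indep : mutually_independent P (noise_sigma X B).
Hypothesis X_cube : forall k w, cube (X k w).

Notation fieldType D := (g_sigma_algebraType (noise_gen X B D)).

Lemma measurable_X_field D k : D (inl k) ->
  measurable_fun setT (X k : fieldType D -> tup).
Proof.
move=> Dk _ A mA; apply: (noise_sigma_field Dk).
by exists A.
Qed.

Lemma measurable_B_field D u v : D (inr (u, v)) ->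
  measurable_fun setT (B u v : fieldType D -> bool).
Proof.
move=> Dk _ A mA; apply: (noise_sigma_field Dk).
by exists A.
Qed.

(** By independence the joint law of the past and of a fresh position is a product
    measure, so the probability is the integral over the past of the volumes of
    the sections of [K].  These are assumed constant on the cube; this is how the
    homogeneity of the torus will enter. *)
Lemma prob_fresh D b f H (K : set (tup * tup)) (c : R) :
  D (inl b) -> ~ D (inl f) -> noise_field X B D H -> measurable K ->
  (forall x, cube x -> distribution P (X f) (xsection K x) = c%:E) ->
  P (H `&` [set w | K (X b w, X f w)]) = (P H * c%:E)%E.
Proof.
move=> Db Df DH mK Kc.
have mid : measurable_fun setT (id : T -> fieldType D).
  by move=> _ A mA; rewrite setTI; exact: noise_field_measurable mA.
pose idT : {mfun T >-> fieldType D} := mfun_Sub (mem_set mid).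
have mpair : measurable_fun setT ((fun w => (w, X f w)) : T -> fieldType D * tup).
  by apply: measurable_fun_pair => //; exact: measurable_funPT.
pose pr : {mfun T >-> (fieldType D * tup)%type} := mfun_Sub (mem_set mpair).
pose P' : probability (fieldType D) R := distribution P idT.
pose K' : set (fieldType D * tup) :=
  (fst @^-1` H) `&` ((fun z => (X b z.1, z.2)) @^-1` K).
have mH : measurable (H : set (fieldType D)) by exact: DH.
have mK' : measurable K'.
  apply: measurableI.
    rewrite -[X in measurable X]setTI; exact: measurable_fst.
  rewrite -[X in measurable X]setTI.
  have : measurable_fun setT (fun z : fieldType D * tup => (X b z.1, z.2)).
    apply: measurable_fun_pair => //.
    by apply: (measurableT_comp (measurable_X_field Db)).
  by apply.
have := @product_measure_unique _ _ _ _ R P' (distribution P (X f))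
  (distribution P pr) _ K' mK'.
rewrite /distribution /pushforward /product_measure1 => E.
have {E} : (\int[distribution P idT]_x (distribution P (X f) \o xsection K') x)%E = P (pr @^-1` K').
  apply: E => A C mA mC; rewrite -(noise_field_indep indep Df mA) //.
  by exists C => //; rewrite setTI.
rewrite (_ : pr @^-1` K' = H `&` [set w | K (X b w, X f w)]) // => <-.
have sec w : distribution P (X f) (xsection K' w) = (\1_H w * c)%:E.
  rewrite indicE; case: (boolP (w \in H)) => wH.
    rewrite mul1r -(Kc (X b w)) //; congr (distribution _ _ _).
    apply/seteqP; split=> y; rewrite /xsection /= !inE; first by case.
    by move=> Ky; split => //; exact: set_mem.
  rewrite mul0r (_ : xsection K' w = set0) ?measure0 //.
  by rewrite -subset0 => y; rewrite /xsection /= inE => -[Hw _]; move/negP: wH; apply; exact: mem_set.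
transitivity (\int[distribution P idT]_w (c%:E * (\1_H w)%:E))%E.
  by apply: eq_integral => w _ /=; rewrite sec EFinM muleC.
have c0 : 0 <= c.
  rewrite -lee_fin -(Kc (X b point)) //; exact: measure_ge0.
rewrite ge0_integralZl //.
  by rewrite integral_indic // setIT muleC.
by apply/measurable_EFinP; exact: measurable_indic.
Qed.

Lemma prob_coin D p u v H : (forall A, distribution P (B u v) A = bernoulli_prob p A) ->
  0 <= p <= 1 -> ~ D (inr (u, v)) -> noise_field X B D H ->
  P (H `&` [set w | B u v w]) = (P H * p%:E)%E.
Proof.
move=> Bp p01 Duv DH; rewrite (noise_field_indep indep Duv DH) //; last first.
  by exists [set true] => //; rewrite setTI; apply/seteqP; split => w /=.
congr (_ * _)%E; transitivity (distribution P (B u v) [set true]).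
  by congr (P _); apply/seteqP; split => w.
rewrite Bp bernoulli_probE // !diracE mem_set // memNset //.
by rewrite mule1 mule0 adde0.
Qed.

End Fresh.

(** * Growth of the in-degrees in a finite model *)

(** With [e] twice the exponent of the in-degrees, the left side is the factor by
    which their second moments grow at time [j.+2]; the bound telescopes.  It
    follows from [1 + x <= exp x] at [e / j.+2] and at [- 1 / j.+2]. *)
Lemma one_plus_le_powR (R : realType) (j : nat) (e : R) : 0 <= e ->
  1 + e / j.+2%:R <= (j.+2%:R / j.+1%:R) `^ e.
Proof.
move=> e0; apply: (@le_trans _ _ (expR (e / j.+2%:R))); first exact: expR_ge1Dx.
rewrite mulrC expRM; apply: ge0_ler_powR => //; rewrite ?nnegrE ?expR_ge0 //.
have h : 1 + - (j.+2%:R^-1) <= expR (- (j.+2%:R^-1)) :> R by exact: expR_ge1Dx.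
have E : 1 + - (j.+2%:R^-1) = j.+1%:R / j.+2%:R :> R.
  have -> : j.+1%:R = j.+2%:R - 1 :> R by rewrite -[j.+2]addn1 natrD addrK.
  by rewrite mulrBl divff ?pnatr_eq0 // mul1r.
rewrite -[leRHS]invrK invf_div -[leLHS]invrK -expRN lef_pV2 ?posrE ?expR_gt0 //.
by rewrite -E.
Qed.

Lemma harmonic_le_ln (R : realType) (n : nat) : (0 < n)%N ->
  \sum_(i < n) (i.+1%:R)^-1 <= 1 + ln n%:R :> R.
Proof.
case: n => // n _; elim: n => [|n IH].
  by rewrite big_ord_recr big_ord0 /= add0r invr1 ln1 addr0.
rewrite big_ord_recr /=; apply: le_trans (lerD IH (lexx _)) _.
rewrite -addrA lerD2l.
have h : ln (1 + - (n.+2%:R^-1)) <= - (n.+2%:R^-1) :> R.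
  by apply: le_ln1Dx; rewrite ltrN2 invf_lt1 // ltr1n.
have E : 1 + - (n.+2%:R^-1) = n.+1%:R / n.+2%:R :> R.
  have -> : n.+1%:R = n.+2%:R - 1 :> R by rewrite -[n.+2]addn1 natrD addrK.
  by rewrite mulrBl divff ?pnatr_eq0 // mul1r.
rewrite E ln_div ?posrE ?ltr0n // in h.
by rewrite -lerBrDl -lerN2 opprB.
Qed.

(** Below the scale [l] the first term suffices, above it the second one.
    Multiplied by [x], this bounds a moment of order [1 + th] by the first two
    moments. *)
Lemma powR_le_interp (R : realType) (x l th : R) : 0 < x -> 0 < l -> 0 <= th <= 1 ->
  x `^ th <= l `^ th + x * l `^ (th - 1).
Proof.
move=> x0 l0 /andP[th0 th1]; have [xl|lx] := leP x l.
  apply: (@le_trans _ _ (l `^ th)).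
    by apply: ge0_ler_powR => //; rewrite nnegrE ltW.
  by rewrite lerDl mulr_ge0 ?powR_ge0 // ltW.
apply: (@le_trans _ _ (x * l `^ (th - 1))); last by rewrite lerDr powR_ge0.
have -> : x `^ th = x * x `^ (th - 1).
  rewrite -[in LHS](subrK 1 th) [LHS]powRD; last by rewrite (gt_eqF x0) implybT.
  by rewrite (powRr1 (ltW x0)) mulrC.
rewrite ler_wpM2l ?(ltW x0) //.
rewrite -opprB !powRN lef_pV2 ?posrE ?powR_gt0 //.
by apply: ge0_ler_powR; rewrite ?nnegrE ?(ltW l0) ?(ltW x0) ?subr_ge0 // ltW.
Qed.

(** The sphere of influence of the [j]-th vertex at time [s] has a volume [V] of order
    [(s / j)^a / s], and with [th = 1/m] its expected contribution to the length of
    the links created at that time is of order [V^(1 + th)].  The lower bounds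
    [- th] and [a - 1] on [b] settle the cases [j = s] and [j = 1]; in between, the
    inequality is linear in [ln j] after taking logarithms. *)
Lemma growth_power_le (R : realType) (s j : nat) (a th b : R) :
  (0 < j <= s)%N -> 0 < a -> a < 1 -> 0 <= th -> - th <= b -> a - 1 <= b ->
  ((s%:R / j%:R) `^ a / s%:R) `^ (1 + th) <= s%:R `^ b / j%:R.
Proof.
move=> /andP[j0 js] a0 a1 th0 thb ab.
have jR : 0 < j%:R :> R by rewrite ltr0n.
have sR : 0 < s%:R :> R by rewrite ltr0n (leq_trans j0).
have j1 : 1 <= j%:R :> R by rewrite ler1n.
have s1 : 1 <= s%:R :> R by rewrite ler1n (leq_trans j0).
have jsR : j%:R <= s%:R :> R by rewrite ler_nat.
have lnj0 : 0 <= ln (j%:R : R) by exact: ln_ge0.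
have lnjs : ln (j%:R : R) <= ln (s%:R : R) by rewrite ler_ln ?posrE.
have lhs0 : 0 < (s%:R / j%:R) `^ a / s%:R :> R.
  by rewrite divr_gt0 // powR_gt0 // divr_gt0.
have sj0 : 0 < s%:R / j%:R :> R by rewrite divr_gt0.
rewrite -ler_ln ?posrE ?powR_gt0 ?divr_gt0 ?powR_gt0 //.
rewrite ln_powR !ln_div ?posrE ?powR_gt0 // !ln_powR ln_div ?posrE //.
set x := ln j%:R in lnj0 lnjs *; set y := ln s%:R in lnjs *.
have y0 : 0 <= y by exact: le_trans lnjs.
have [h|h] := leP (a * (1 + th)) 1.
  have h1 : (1 - a * (1 + th)) * x <= (1 - a * (1 + th)) * y by rewrite ler_wpM2l ?subr_ge0.
  have h2 : - th * y <= b * y by rewrite ler_wpM2r.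
  rewrite [leLHS](_ : _ = (1 - a * (1 + th)) * x - x + (a - 1) * (1 + th) * y); last by ring.
  have -> : b * y - x = (b * y - (- th) * y) + ((1 - a * (1 + th)) * y - x + (a - 1) * (1 + th) * y) by ring.
  lra.
have h1 : (a * (1 + th) - 1) * x >= 0 by rewrite mulr_ge0 // subr_ge0 ltW.
have h2 : (a - 1) * y <= b * y by rewrite ler_wpM2r.
have h3 : (1 - a) * th * y >= 0 by rewrite !mulr_ge0 // subr_ge0 ltW.
rewrite [leLHS](_ : _ = - x - (a * (1 + th) - 1) * x + (a - 1) * y - (1 - a) * th * y); last by ring.
lra.
Qed.

(** ** Expectations over a finite history *)

(** The volume of the sphere of influence of a vertex of in-degree [D] at time
    [s]. *)
Definition influence_vol (R : realType) (A1 A2 : R) (D s : nat) : R :=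
  Num.min ((A1 * D%:R + A2) / s%:R) 1.

Lemma influence_vol01 (R : realType) (A1 A2 : R) D s : 0 < A1 -> 0 < A2 ->
  0 <= influence_vol A1 A2 D s <= 1.
Proof.
move=> A10 A20; rewrite /influence_vol ge_min lexx orbT andbT le_min ler01 andbT.
by rewrite divr_ge0 // addr_ge0 ?(ltW A20) // mulr_ge0 // ltW.
Qed.

(** The estimates on the growth of the graph concern the joint law of finitely
    many links and of the cells of the vertices, hence a finite probability
    space.  Of the geometry only [Ex_link] and [Ex_cell] remain: given the past,
    a link is created with probability at most [p] times the volume of the
    sphere of influence, and a vertex falls into a given one of [N] cells with
    probability at most [1/N]. *)
Section FiniteModel.
Variables (R : realType) (Om : finType) (Pr : Om -> R).

Definition Ex (f : Om -> R) : R := \sum_z f z * Pr z.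

Hypothesis Pr_ge0 : forall z, 0 <= Pr z.

Lemma le_Ex f h : (forall z, Pr z != 0 -> f z <= h z) -> Ex f <= Ex h.
Proof.
move=> fh; apply: ler_sum => z _; have [->|z0] := eqVneq (Pr z) 0.
  by rewrite !mulr0.
by rewrite ler_wpM2r // fh.
Qed.

Lemma eq_Ex f h : (forall z, f z = h z) -> Ex f = Ex h.
Proof. by move=> fh; apply: eq_bigr => z _; rewrite fh. Qed.

Lemma ExD f h : Ex (fun z => f z + h z) = Ex f + Ex h.
Proof. by rewrite /Ex -big_split; apply: eq_bigr => z _; rewrite mulrDl. Qed.

Lemma ExZ c f : Ex (fun z => c * f z) = c * Ex f.
Proof. by rewrite /Ex mulr_sumr; apply: eq_bigr => z _; rewrite mulrA. Qed.

Lemma Ex_ge0 f : (forall z, 0 <= f z) -> 0 <= Ex f.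
Proof. by move=> f0; apply: sumr_ge0 => z _; rewrite mulr_ge0. Qed.

Lemma Ex_sum I (e : seq I) (Q : pred I) (f : I -> Om -> R) :
  Ex (fun z => \sum_(i <- e | Q i) f i z) = \sum_(i <- e | Q i) Ex (f i).
Proof.
by rewrite /Ex exchange_big; apply: eq_bigr => z _; rewrite mulr_suml.
Qed.

Hypothesis Pr_total : \sum_z Pr z = 1.

Lemma Ex_cst c : Ex (fun=> c) = c.
Proof. by rewrite /Ex -mulr_sumr Pr_total mulr1. Qed.

Lemma finite_markov (f : Om -> R) (t : R) : (forall z, 0 <= f z) -> 0 < t ->
  \sum_(z | t < f z) Pr z <= Ex f / t.
Proof.
move=> f0 t0; rewrite ler_pdivlMr // mulr_suml.
rewrite /Ex [leRHS](bigID (fun z => t < f z)) /= -[leLHS]addr0.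
apply: lerD; last by apply: sumr_ge0 => z _; rewrite mulr_ge0.
by apply: ler_sum => z /ltW tf; rewrite mulrC ler_wpM2r.
Qed.

Variables (n : nat) (link : Om -> nat -> nat -> bool) (cell : Om -> nat -> nat).
Variables (N : nat) (p A1 A2 : R).
Hypotheses (p_gt0 : 0 < p) (A1_gt0 : 0 < A1) (A2_gt0 : 0 < A2).

(** [h] is a function of what happens before vertex [s] arrives: this plays the
    role of measurability with respect to the past. *)
Definition determined (s : nat) (h : Om -> R) := forall z z',
  (forall u v, (u < s)%N -> link z u v = link z' u v) ->
  (forall u, (u < s)%N -> cell z u = cell z' u) -> h z = h z'.

Definition indeg z t v : nat := (\sum_(u < t) link z u v)%N.

Definition influence_volume z s v : R :=
  influence_vol A1 A2 (indeg z s v) s.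

Hypothesis link_lt : forall z u v, link z u v -> (v < u)%N.
Hypothesis Ex_link : forall s v h, (v < s < n)%N -> determined s h ->
  (forall z, 0 <= h z) ->
  Ex (fun z => h z * (link z s v)%:R) <=
  Ex (fun z => h z * (p * influence_volume z s v)).
Hypothesis Ex_cell : forall s c h, (s < n)%N -> determined s h ->
  (forall z, 0 <= h z) ->
  Ex (fun z => h z * (cell z s == c)%:R) <= Ex h / N%:R.

Let a := p * A1.
Let beta := A2 / A1 + 1.

Let a_gt0 : 0 < a. Proof. by rewrite /a mulr_gt0. Qed.
Let beta_ge1 : 1 <= beta.
Proof. by rewrite /beta lerDr divr_ge0 // ltW. Qed.

(** With the shift [A2 / A1] alone, the conditional probability of a link would be
    at most [a / s] times the shifted in-degree.  The additional [1] makes room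
    for the event that two in-degrees increase at the same time. *)
Definition sdeg z t v : R := (indeg z t v)%:R + beta.

Lemma sdeg_ge1 z t v : 1 <= sdeg z t v.
Proof. by rewrite /sdeg (le_trans beta_ge1) // lerDr. Qed.

Lemma sdeg_ge0 z t v : 0 <= sdeg z t v.
Proof. by rewrite (le_trans ler01) // sdeg_ge1. Qed.

Lemma sdegS z t v : sdeg z t.+1 v = sdeg z t v + (link z t v)%:R.
Proof. by rewrite /sdeg /indeg big_ord_recr /= natrD addrAC. Qed.

Lemma sdeg_birth z v : sdeg z v.+1 v = beta.
Proof.
rewrite /sdeg /indeg big1 ?add0r // => u _.
by apply/eqP; rewrite eqb0; apply/negP => /link_lt; have := ltn_ord u; lia.
Qed.

Lemma determined_sdeg s t v : (t <= s)%N -> determined s (sdeg ^~ t ^~ v).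
Proof.
move=> ts z z' hl _; rewrite /sdeg /indeg; congr (_%:R + _).
by apply: eq_bigr => u _; rewrite hl // (leq_trans (ltn_ord u)).
Qed.

Lemma determinedM s f h : determined s f -> determined s h ->
  determined s (fun z => f z * h z).
Proof. by move=> df dh z z' hl hc; rewrite (df z z') ?(dh z z'). Qed.

Lemma influence_volume_ge0 z s v : 0 <= influence_volume z s v.
Proof. by have /andP[] := influence_vol01 (indeg z s v) s A1_gt0 A2_gt0. Qed.

Lemma link_prob_le z s v : (0 < s)%N ->
  p * influence_volume z s v <= a / s%:R * (sdeg z s v - 1).
Proof.
move=> s0; rewrite /influence_volume /influence_vol.
apply: (@le_trans _ _ (p * ((A1 * (indeg z s v)%:R + A2) / s%:R))).
  by rewrite ler_wpM2l ?(ltW p_gt0) // ge_min lexx.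
rewrite /sdeg /beta /a le_eqVlt; apply/orP; left; apply/eqP.
field; rewrite (gt_eqF A1_gt0) /=; by rewrite pnatr_eq0 -lt0n.
Qed.

Lemma Ex_link_sdeg s v h : (v < s < n)%N -> determined s h ->
  (forall z, 0 <= h z) ->
  Ex (fun z => h z * (link z s v)%:R) <=
  a / s%:R * Ex (fun z => h z * (sdeg z s v - 1)).
Proof.
move=> vs dh h0; apply: le_trans (Ex_link vs dh h0) _.
rewrite -ExZ; apply: le_Ex => z _; rewrite [leRHS]mulrCA ler_wpM2l // link_prob_le //.
by case/andP: vs => vs _; apply: leq_ltn_trans vs.
Qed.

(** The event that both in-degrees increase is bounded by the event that one of them
    does, and is absorbed by the excess of the shift [beta] over [A2 / A1].  The
    argument is the same for [v = w]. *)
Lemma second_moment_step s v w h : (v < s)%N -> (w < s)%N -> (s < n)%N ->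
  determined s h -> (forall z, 0 <= h z) ->
  Ex (fun z => h z * (sdeg z s.+1 v * sdeg z s.+1 w)) <=
  (1 + 2 * a / s%:R) * Ex (fun z => h z * (sdeg z s v * sdeg z s w)).
Proof.
move=> vs ws sn dh h0.
have dv := @determined_sdeg s s v (leqnn s); have dw := @determined_sdeg s s w (leqnn s).
have g0 := sdeg_ge0.
apply: (@le_trans _ _ (Ex (fun z => h z * (sdeg z s v * sdeg z s w)) +
   (Ex (fun z => (h z * sdeg z s v) * (link z s w)%:R) +
   (Ex (fun z => (h z * sdeg z s w) * (link z s v)%:R) +
    Ex (fun z => h z * (link z s v)%:R))))).
  rewrite -!ExD; apply: le_Ex => z _; rewrite !sdegS.
  have : h z * ((link z s v)%:R * (link z s w)%:R) <= h z * (link z s v)%:R.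
    by rewrite ler_wpM2l //; case: (link z s v); case: (link z s w); rewrite /= ?mulr1 ?mulr0 ?ler01.
  move=> hb; rewrite [leLHS](_ : _ = h z * (sdeg z s v * sdeg z s w) +
    (h z * sdeg z s v * (link z s w)%:R + (h z * sdeg z s w * (link z s v)%:R +
     h z * ((link z s v)%:R * (link z s w)%:R)))); last by ring.
  by rewrite !lerD2l.
have sn' u : (u < s)%N -> (u < s < n)%N by move=> ->; rewrite sn.
have hv := Ex_link_sdeg (sn' _ vs) (determinedM dh dw) (fun z => mulr_ge0 (h0 z) (g0 z s w)).
have hw := Ex_link_sdeg (sn' _ ws) (determinedM dh dv) (fun z => mulr_ge0 (h0 z) (g0 z s v)).
have hb := Ex_link_sdeg (sn' _ vs) dh h0.
rewrite mulrDl mul1r lerD2l; apply: le_trans (lerD hw (lerD hv hb)) _.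
rewrite -!mulrDr -!ExD.
rewrite [leRHS](_ : _ = a / s%:R *
   Ex (fun z => 2 * (h z * (sdeg z s v * sdeg z s w)))); last by rewrite ExZ; ring.
rewrite ler_wpM2l ?divr_ge0 // ?(ltW a_gt0) //; apply: le_Ex => z _.
have := mulr_ge0 (h0 z) (g0 z s w); have := h0 z; lra.
Qed.

(** The steps at the times after [tau] telescope by [one_plus_le_powR]; the step
    at time [tau] itself costs the factor 3. *)
Lemma second_moment_growth tau t v w h : (v < tau)%N -> (w < tau)%N ->
  (tau <= t <= n)%N -> a < 1 ->
  determined tau h -> (forall z, 0 <= h z) ->
  Ex (fun z => h z * (sdeg z t v * sdeg z t w)) <=
  3 * (t%:R / tau%:R) `^ (2 * a) *
  Ex (fun z => h z * (sdeg z tau v * sdeg z tau w)).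
Proof.
move=> vt wt /andP[taut tn] a1 dh h0.
have tau0 : (0 < tau)%N by apply: leq_ltn_trans vt.
have tauR : 0 < tau%:R :> R by rewrite ltr0n.
have E0 s : 0 <= Ex (fun z => h z * (sdeg z s v * sdeg z s w)).
  by apply: Ex_ge0 => z; rewrite !mulr_ge0 ?sdeg_ge0.
have dh' s : (tau <= s)%N -> determined s h.
  move=> ts z z' hl hc; apply: dh => [u x ut|u ut]; first by apply: hl; exact: leq_trans ts.
  by apply: hc; exact: leq_trans ts.
have a20 : 0 <= 2 * a by rewrite mulr_ge0 // ltW.
have grow i : (tau + i < n)%N ->
  Ex (fun z => h z * (sdeg z (tau + i).+1 v * sdeg z (tau + i).+1 w)) <=
  3 * ((tau + i)%:R / tau%:R) `^ (2 * a) *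
  Ex (fun z => h z * (sdeg z tau v * sdeg z tau w)).
  elim: i => [|i IH] hi.
    rewrite addn0 in hi *; apply: le_trans (second_moment_step vt wt hi dh h0) _.
    rewrite divff ?gt_eqF // powR1 mulr1 ler_wpM2r // -[3]/(1 + 2 : R) lerD2l.
    rewrite -mulrA ler_piMr // ler_pdivrMr // mul1r (le_trans (ltW a1)) //.
    by rewrite ler1n.
  have ti : (tau <= tau + i.+1)%N by rewrite leq_addr.
  apply: le_trans (second_moment_step (leq_trans vt ti) (leq_trans wt ti) hi (dh' _ ti) h0) _.
  rewrite addnS in hi *.
  apply: le_trans (ler_wpM2l _ (IH (ltnW hi))) _.
    by rewrite addr_ge0 // divr_ge0.
  rewrite mulrA ler_wpM2r // mulrCA ler_wpM2l //.
  have -> : (tau + i).+1%:R / tau%:R =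
     ((tau + i).+1%:R / (tau + i)%:R) * ((tau + i)%:R / tau%:R) :> R.
    by rewrite mulrA divfK // pnatr_eq0 -lt0n addn_gt0 tau0.
  rewrite [leRHS]powRM ?divr_ge0 // ler_wpM2r ?powR_ge0 //.
  case: (tau + i)%N (leq_addr i tau) => [|j _]; first by rewrite leqNgt tau0.
  exact: one_plus_le_powR.
have le_pow (x y : nat) : (x <= y)%N ->
  (x%:R / tau%:R) `^ (2 * a) <= (y%:R / tau%:R) `^ (2 * a).
  move=> xy; apply: ge0_ler_powR => //; rewrite ?nnegrE ?divr_ge0 //.
  by rewrite ler_wpM2r ?invr_ge0 ?ler_nat ?ltW.
move: taut tn; rewrite leq_eqVlt => /predU1P[<- _|taut tn].
  by rewrite divff ?gt_eqF // powR1 mulr1 ler_peMl // ler1n.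
have [i ti] : exists i, t = (tau + i).+1 by exists (t - tau.+1)%N; lia.
rewrite ti in tn *; apply: le_trans (grow i tn) _.
by rewrite ler_wpM2r // ler_wpM2l // le_pow // ltnW.
Qed.

Hypothesis a_lt1 : a < 1.

Let C2 := 3 * beta ^+ 2.

Let C2_ge1 : 1 <= C2.
Proof.
have : 1 <= beta ^+ 2 by rewrite exprn_ege1.
by rewrite /C2; lra.
Qed.

Let C2_ge0 : 0 <= C2. Proof. exact: le_trans ler01 C2_ge1. Qed.

(** The order of magnitude at time [t] of the in-degree of vertex [v], which
    arrives at time [v.+1]. *)
Definition growth (t v : nat) : R := (t%:R / v.+1%:R) `^ a.

Lemma growth_gt0 t v : (0 < t)%N -> 0 < growth t v.
Proof. by move=> t0; rewrite powR_gt0 // divr_gt0 // ltr0n. Qed.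

Lemma growth_sqr t v : growth t v ^+ 2 = (t%:R / v.+1%:R) `^ (2 * a).
Proof. by rewrite /growth -powR_mulrn ?powR_ge0 // -powRrM [a * _]mulrC. Qed.

Lemma sdeg_sqr_le t v : (v < t <= n)%N ->
  Ex (fun z => sdeg z t v ^+ 2) <= C2 * growth t v ^+ 2.
Proof.
move=> vt; have d1 : determined v.+1 (fun=> 1) by [].
have := second_moment_growth (ltnSn v) (ltnSn v) vt a_lt1 d1 (fun=> ler01).
rewrite growth_sqr (_ : Ex (fun z => 1 * (sdeg z v.+1 v * sdeg z v.+1 v)) = beta ^+ 2).
  rewrite /C2 mulrAC; apply: le_trans; apply: le_Ex => z _.
  by rewrite mul1r expr2.
rewrite -[RHS]Ex_cst; apply: eq_Ex => z.
by rewrite mul1r sdeg_birth expr2.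
Qed.

(** From the second moment, by [g <= l / 2 + g ^ 2 / (2 l)] at the scale [l] of the
    in-degree. *)
Lemma sdeg_le t v : (v < t <= n)%N -> Ex (fun z => sdeg z t v) <= C2 * growth t v.
Proof.
move=> vt; have t0 : (0 < t)%N by case/andP: vt => vt _; apply: leq_ltn_trans vt.
have l0 := growth_gt0 v t0; set l := growth t v in l0 *.
apply: (@le_trans _ _ (Ex (fun z => l / 2 + (2 * l)^-1 * sdeg z t v ^+ 2))).
  apply: le_Ex => z _; set g := sdeg z t v.
  rewrite [leLHS](_ : _ = l / 2 + (2 * l)^-1 * g ^+ 2 - (2 * l)^-1 * (g - l) ^+ 2);
    last by field; rewrite gt_eqF.
  by rewrite gerBl mulr_ge0 ?sqr_ge0 // invr_ge0 mulr_ge0 // ltW.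
rewrite ExD Ex_cst ExZ.
apply: (@le_trans _ _ (l / 2 + (2 * l)^-1 * (C2 * l ^+ 2))).
  by rewrite lerD2l ler_wpM2l ?sdeg_sqr_le // invr_ge0 mulr_ge0 // ltW.
have -> : (2 * l)^-1 * (C2 * l ^+ 2) = C2 * l / 2 by field; rewrite gt_eqF.
have : l <= C2 * l by rewrite ler_peMl // ltW.
lra.
Qed.

Lemma sdeg_powR_le t v (th : R) : (v < t <= n)%N -> 0 <= th <= 1 ->
  Ex (fun z => sdeg z t v `^ (1 + th)) <= 2 * C2 * growth t v `^ (1 + th).
Proof.
move=> vt th01; have t0 : (0 < t)%N by case/andP: vt => vt _; apply: leq_ltn_trans vt.
have l0 := growth_gt0 v t0; set l := growth t v in l0 *.
have [th0 th1] := andP th01.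
have g0 z : 0 < sdeg z t v by rewrite (lt_le_trans ltr01) // sdeg_ge1.
have powS (x : R) : 0 < x -> x `^ (1 + th) = x * x `^ th.
  by move=> x0; rewrite powRD ?(gt_eqF x0) ?implybT // powRr1 // ltW.
apply: (@le_trans _ _ (Ex (fun z => l `^ th * sdeg z t v +
    l `^ (th - 1) * sdeg z t v ^+ 2))).
  apply: le_Ex => z _; rewrite powS //.
  apply: le_trans (ler_wpM2l (ltW (g0 z)) (powR_le_interp (g0 z) l0 th01)) _.
  by rewrite le_eqVlt; apply/orP; left; apply/eqP; ring.
rewrite ExD !ExZ.
apply: le_trans (lerD (ler_wpM2l (powR_ge0 _ _) (sdeg_le vt))
  (ler_wpM2l (powR_ge0 _ _) (sdeg_sqr_le vt))) _.
have -> : l `^ (th - 1) = l `^ th / l.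
  by rewrite powRB ?(gt_eqF l0) ?implybT // powRr1 // ltW.
rewrite -/l powS // le_eqVlt; apply/orP; left; apply/eqP.
by field; rewrite gt_eqF.
Qed.

Lemma growth_le_div t v : (v < t)%N -> growth t v <= t%:R / v.+1%:R.
Proof.
move=> vt; apply: ler1_powR; last exact: ltW.
by rewrite ler_pdivlMr ?ltr0n // mul1r ler_nat.
Qed.

Lemma sum_growth t : (0 < t)%N -> \sum_(v < t) growth t v <= t%:R * (1 + ln t%:R).
Proof.
move=> t0; apply: (@le_trans _ _ (\sum_(v < t) t%:R / v.+1%:R)).
  by apply: ler_sum => v _; exact: growth_le_div.
by rewrite -mulr_sumr ler_wpM2l // harmonic_le_ln.
Qed.

(** ** Pairs of vertices in the same strip *)

Section Strips.
Variables (st : nat -> nat) (K : nat).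
Hypotheses (n_gt0 : (0 < n)%N) (N_gt0 : (0 < N)%N).
Hypothesis cell_lt : forall z u, (u < n)%N -> (cell z u < N)%N.
Hypothesis st_card : forall i, (\sum_(c < N) (st c == i) <= K)%N.

(** When [w] arrives, the strip of [v] is already known and consists of at most
    [K] of the [N] cells, into one of which [w] has to fall. *)
Lemma same_strip_le v w : (v < w < n)%N ->
  Ex (fun z => (st (cell z v) == st (cell z w))%:R * sdeg z w v) <=
  K%:R / N%:R * Ex (fun z => sdeg z w v).
Proof.
move=> /andP[vw wn].
pose h (c : 'I_N) z : R := (st (cell z v) == st c)%:R * sdeg z w v.
have h0 c z : 0 <= h c z by rewrite mulr_ge0 // sdeg_ge0.
have dh c : determined w (h c).
  move=> z z' hl hc; congr (_ * _); first by rewrite hc.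
  exact: (@determined_sdeg w w v).
apply: (@le_trans _ _ (Ex (fun z => \sum_(c < N) h c z * (cell z w == c)%:R))).
  apply: le_Ex => z _; rewrite (bigD1 (Ordinal (cell_lt z wn))) //= eqxx mulr1.
  by rewrite /h /= lerDl; apply: sumr_ge0 => c _; rewrite !mulr_ge0 ?sdeg_ge0.
rewrite Ex_sum; apply: (@le_trans _ _ (\sum_(c < N) Ex (h c) / N%:R)).
  by apply: ler_sum => c _; apply: Ex_cell.
rewrite -mulr_suml -Ex_sum mulrAC ler_wpM2r ?invr_ge0 // -ExZ.
apply: le_Ex => z _; rewrite /h -mulr_suml ler_wpM2r ?sdeg_ge0 //.
rewrite -natr_sum ler_nat; apply: leq_trans (st_card (st (cell z v))).
by apply: leq_sum => c _; rewrite eq_sym.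
Qed.

Let e v : R := growth n v.

(** Back from time [n] to the arrival of [w] by [second_moment_growth], where the
    in-degree of [w] is zero and that of [v] is of order [growth w.+1 v].  The two
    powers combine to [e v * e w]. *)
Lemma same_strip_pair v w : (v < w < n)%N ->
  Ex (fun z => (st (cell z v) == st (cell z w))%:R * (sdeg z n v * sdeg z n w)) <=
  6 * beta * C2 * (K%:R / N%:R) * (e v * e w).
Proof.
move=> vwn; have /andP[vw wn] := vwn.
pose same z : R := (st (cell z v) == st (cell z w))%:R.
have same0 z : 0 <= same z by [].
have ds : determined w.+1 same.
  by move=> z z' _ hc; rewrite /same !hc // ltnS ltnW.
have vw1 : (v < w.+1)%N by rewrite ltnS ltnW.
apply: le_trans (second_moment_growth vw1 (ltnSn w) _ a_lt1 ds same0) _.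
  by rewrite wn leqnn.
have KN0 : 0 <= K%:R / N%:R :> R by rewrite divr_ge0.
have step : Ex (fun z => same z * (sdeg z w.+1 v * sdeg z w.+1 w)) <=
    2 * beta * (K%:R / N%:R * (C2 * growth w.+1 v)).
  apply: (@le_trans _ _ (Ex (fun z => 2 * beta * (same z * sdeg z w v)))).
    apply: le_Ex => z _; rewrite sdeg_birth sdegS.
    have : (link z w v)%:R <= sdeg z w v.
      by rewrite (le_trans _ (sdeg_ge1 z w v)) // lern1 leq_b1.
    move=> hl; rewrite [leRHS](_ : _ = same z * ((sdeg z w v + sdeg z w v) * beta)); last by ring.
    by rewrite ler_wpM2l // ler_wpM2r ?(le_trans ler01 beta_ge1) // lerD2l.
  rewrite ExZ ler_wpM2l ?mulr_ge0 ?(le_trans ler01 beta_ge1) //.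
  apply: le_trans (same_strip_le vwn) _; rewrite ler_wpM2l //.
  have vwn' : (v < w <= n)%N by rewrite vw ltnW.
  apply: le_trans (sdeg_le vwn') _.
  rewrite ler_wpM2l // /growth; apply: ge0_ler_powR; rewrite ?nnegrE ?divr_ge0 ?(ltW a_gt0) //.
  by rewrite ler_wpM2r ?invr_ge0 // ler_nat.
apply: le_trans (ler_wpM2l _ step) _; first by rewrite mulr_ge0 ?powR_ge0.
have E : (n%:R / w.+1%:R) `^ (2 * a) * growth w.+1 v = e v * e w.
  rewrite -growth_sqr expr2 -mulrA mulrC; congr (_ * _).
  rewrite /e /growth -powRM ?divr_ge0 //; congr (_ `^ _).
  by rewrite mulrA divfK.
rewrite -E le_eqVlt; apply/orP; left; apply/eqP; ring.
Qed.

(** The second term comes from the diagonal, where both vertices trivially lie in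
    the same strip; there [e v] is bounded by its value [n `^ a] for the oldest
    vertex. *)
Lemma same_strip_Ex_le :
  Ex (fun z => \sum_(v < n) \sum_(w < n)
     (st (cell z v) == st (cell z w))%:R * (sdeg z n v * sdeg z n w)) <=
  6 * beta * C2 * (K%:R / N%:R) * (n%:R * (1 + ln n%:R)) ^+ 2 +
  C2 * n%:R `^ a * (n%:R * (1 + ln n%:R)).
Proof.
have e0 v : 0 <= e v by exact: powR_ge0.
have S0 : 0 <= \sum_(v < n) e v by apply: sumr_ge0.
have SE := sum_growth n_gt0.
have KN0 : 0 <= K%:R / N%:R :> R by rewrite divr_ge0.
have beta0 : 0 <= beta by apply: le_trans beta_ge1.
rewrite Ex_sum.
apply: (@le_trans _ _ (\sum_(v < n) (\sum_(w < n)
   6 * beta * C2 * (K%:R / N%:R) * (e v * e w) + C2 * n%:R `^ a * e v))).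
  apply: ler_sum => v _; rewrite Ex_sum (bigD1 v) //= [in leRHS](bigD1 v) //=.
  rewrite [leRHS]addrAC; apply: lerD.
    rewrite -[leLHS]add0r; apply: lerD; first by rewrite !mulr_ge0.
    apply: (@le_trans _ _ (Ex (fun z => sdeg z n v ^+ 2))).
      by apply: le_Ex => z _; rewrite eqxx mul1r expr2.
    have vn : (v < n <= n)%N by rewrite ltn_ord leqnn.
    apply: le_trans (sdeg_sqr_le vn) _.
    rewrite expr2 -mulrA ler_wpM2l // ler_wpM2r //.
    apply: ge0_ler_powR; rewrite ?nnegrE ?divr_ge0 ?(ltW a_gt0) //.
    by rewrite ler_pdivrMr ?ltr0n // ler_peMr // ler1n.
  apply: ler_sum => w wv; have [vw|wv'] := ltnP v w.
    by apply: same_strip_pair; rewrite vw ltn_ord.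
  have {wv wv'}wv : (w < v)%N by rewrite ltn_neqAle wv' andbT; apply: contra wv => /eqP h; apply/eqP/val_inj.
  rewrite [e v * _]mulrC; apply: le_trans (same_strip_pair _); last by rewrite wv ltn_ord.
  by apply: le_Ex => z _; rewrite eq_sym [sdeg z n v * _]mulrC.
rewrite big_split /= -mulr_sumr; apply: lerD.
  under eq_bigr do rewrite -mulr_sumr -mulr_sumr.
  rewrite -mulr_sumr -mulr_suml ler_wpM2l ?mulr_ge0 // expr2.
  exact: ler_pM.
by rewrite ler_wpM2l ?mulr_ge0 ?powR_ge0.
Qed.

End Strips.

(** ** The expected number of crossing links *)

(** [c1 * V `^ th + c2] is to be the expected number of shifts for which a link
    inside a sphere of influence of volume [V] is crossing.  Since such a link has
    conditional probability [p * V], moments of order [1 + th] of the in-degrees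
    enter; [growth_power_le] and two harmonic sums do the rest. *)
Lemma crossing_cost_Ex_le (th b c1 c2 : R) : (0 < n)%N -> 0 <= th <= 1 -> - th <= b -> a - 1 <= b -> -1 <= b ->
  0 <= c1 -> 0 <= c2 ->
  \sum_(s < n) \sum_(v < s) Ex (fun z => (link z s v)%:R *
     (c1 * influence_volume z s v `^ th + c2)) <=
  c1 * (2 * p * C2 * A1 `^ (1 + th)) * (n%:R `^ (1 + b) * (1 + ln n%:R) ^+ 2) +
  c2 * (a * C2) * (n%:R * (1 + ln n%:R)).
Proof.
move=> n0 th01 thb ab b1 c10 c20; have [th0 th1] := andP th01.
have ln0 (s : nat) : (0 < s <= n)%N -> 0 <= ln (s%:R : R) <= ln n%:R.
  move=> /andP[s0 sn]; rewrite ln_ge0 ?ler1n //=.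
  by rewrite ler_ln ?posrE ?ltr0n // ?ler_nat // (leq_trans s0).
pose K1 := c1 * (2 * p * C2 * A1 `^ (1 + th)); pose K2 := c2 * (a * C2).
have p0 := ltW p_gt0; have a0 := ltW a_gt0.
have K10 : 0 <= K1.
  apply: mulr_ge0 => //; apply: mulr_ge0 (powR_ge0 _ _).
  by apply: mulr_ge0 C2_ge0; apply: mulr_ge0.
have K20 : 0 <= K2 by apply: mulr_ge0 => //; apply: mulr_ge0 C2_ge0.
have term (s v : nat) : (v < s < n)%N ->
  Ex (fun z => (link z s v)%:R * (c1 * influence_volume z s v `^ th + c2)) <=
  (c1 * (2 * p * C2 * A1 `^ (1 + th)) * s%:R `^ b + c2 * (a * C2)) * v.+1%:R^-1.
  move=> /andP[vs sn]; have s0 : (0 < s)%N by exact: leq_ltn_trans vs.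
  have sR : 0 < s%:R :> R by rewrite ltr0n.
  have vsn : (v < s <= n)%N by rewrite vs ltnW.
  pose h z := c1 * influence_volume z s v `^ th + c2.
  have h0 z : 0 <= h z by rewrite addr_ge0 // mulr_ge0 // powR_ge0.
  have dh : determined s h.
    move=> z z' hl hc; rewrite /h /influence_volume /influence_vol.
    have := @determined_sdeg s s v (leqnn s) z z' hl hc.
    by rewrite /sdeg => /addIr ->.
  rewrite (eq_Ex (h := fun z => h z * (link z s v)%:R)); last by move=> z; rewrite mulrC.
  apply: (le_trans (Ex_link _ dh h0)); first by rewrite vs.
  pose c3 := c1 * (p * (A1 / s%:R) `^ (1 + th)); pose c4 := c2 * (a / s%:R).
  apply: (@le_trans _ _ (Ex (fun z => c3 * sdeg z s v `^ (1 + th) + c4 * sdeg z s v))).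
    apply: le_Ex => z _; set V := influence_volume z s v; set g := sdeg z s v.
    have g0 : 0 < g by rewrite (lt_le_trans ltr01) // sdeg_ge1.
    have V0 : 0 <= V by exact: influence_volume_ge0.
    have pV : p * V <= a / s%:R * g.
      apply: le_trans (link_prob_le z v s0) _.
      by rewrite ler_wpM2l ?divr_ge0 ?(ltW a_gt0) // gerBl.
    pose W := A1 / s%:R * g; have W0 : 0 < W by rewrite mulr_gt0 // divr_gt0.
    have VW : V <= W.
      rewrite -(ler_pM2l p_gt0); apply: le_trans pV _.
      by rewrite /W /a !mulrA.
    rewrite /h -/V mulrDl; apply: lerD; last by rewrite /c4 -[leRHS]mulrA ler_wpM2l.
    rewrite /c3 -!mulrA ler_wpM2l // [leLHS]mulrCA ler_wpM2l ?(ltW p_gt0) //.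
    rewrite -powRM ?(ltW g0) ?divr_ge0 ?(ltW A1_gt0) // -/W.
    rewrite powRD ?(gt_eqF W0) ?implybT // (powRr1 (ltW W0)) [leRHS]mulrC.
    apply: ler_pM => //; first exact: powR_ge0.
    by apply: ge0_ler_powR; rewrite ?nnegrE ?(ltW W0).
  rewrite ExD !ExZ.
  have c30 : 0 <= c3 by rewrite !mulr_ge0 ?powR_ge0 // ltW.
  have c40 : 0 <= c4 by rewrite mulr_ge0 // divr_ge0 // ltW.
  apply: le_trans (lerD (ler_wpM2l c30 (sdeg_powR_le vsn th01))
    (ler_wpM2l c40 (sdeg_le vsn))) _.
  have l0 := growth_gt0 v s0; set l := growth s v in l0 *.
  have key : (l / s%:R) `^ (1 + th) <= s%:R `^ b / v.+1%:R.
    by apply: growth_power_le.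
  have key2 : l / s%:R <= v.+1%:R^-1.
    rewrite ler_pdivrMr // mulrC; exact: growth_le_div.
  have -> : c3 * (2 * C2 * l `^ (1 + th)) =
      c1 * (2 * p * C2 * A1 `^ (1 + th)) * (l / s%:R) `^ (1 + th).
    have E : (A1 / s%:R) `^ (1 + th) * l `^ (1 + th) = A1 `^ (1 + th) * (l / s%:R) `^ (1 + th).
      rewrite -!powRM ?divr_ge0 ?(ltW l0) ?(ltW A1_gt0) //; congr (_ `^ _); ring.
    rewrite /c3 [RHS](_ : _ = c1 * (2 * p * C2) * (A1 `^ (1 + th) * (l / s%:R) `^ (1 + th))); last by ring.
    by rewrite -E; ring.
  have -> : c4 * (C2 * l) = c2 * (a * C2) * (l / s%:R) by rewrite /c4; ring.
  rewrite [leRHS]mulrDl; apply: lerD.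
    by rewrite -/K1 -[leRHS]mulrA ler_wpM2l.
  by rewrite -/K2 ler_wpM2l.
pose L : R := 1 + ln n%:R.
have L0 : 0 <= L by rewrite addr_ge0 // ln_ge0 // ler1n.
have row (s : nat) : (s < n)%N ->
  \sum_(v < s) Ex (fun z => (link z s v)%:R * (c1 * influence_volume z s v `^ th + c2)) <=
  (K1 * n%:R `^ (1 + b) * s%:R^-1 + K2) * L.
  move=> sn; have [->|s0] := posnP s.
    rewrite big_ord0; apply: mulr_ge0 => //; apply: addr_ge0 => //.
    by rewrite invr0 mulr0.
  have sR : 0 < s%:R :> R by rewrite ltr0n.
  apply: (@le_trans _ _ (\sum_(v < s) (K1 * s%:R `^ b + K2) * v.+1%:R^-1)).
    by apply: ler_sum => v _; apply: term; rewrite ltn_ord.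
  rewrite -mulr_sumr; apply: ler_pM.
  - by apply: addr_ge0 => //; apply: mulr_ge0 => //; exact: powR_ge0.
  - by apply: sumr_ge0 => v _; rewrite invr_ge0.
  - rewrite lerD2r -mulrA ler_wpM2l //.
    have -> : s%:R `^ b = s%:R `^ (1 + b) * s%:R^-1 :> R.
      rewrite powRD ?(gt_eqF sR) ?implybT // (powRr1 (ltW sR)) mulrAC divff ?mul1r //.
      by rewrite gt_eqF.
    rewrite ler_wpM2r ?invr_ge0 //; apply: ge0_ler_powR; rewrite ?nnegrE //; first lra.
    by rewrite ler_nat ltnW.
  - apply: le_trans (harmonic_le_ln R s0) _; rewrite lerD2l.
    by have /andP[] := ln0 s ltac:(by rewrite s0 ltnW).
apply: (@le_trans _ _ (\sum_(s < n) (K1 * n%:R `^ (1 + b) * s%:R^-1 + K2) * L)).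
  by apply: ler_sum => s _; exact: row.
rewrite -mulr_suml big_split /= -mulr_sumr sumr_const card_ord.
have H : \sum_(s < n) s%:R^-1 <= L.
  apply: le_trans (harmonic_le_ln R n0); case: n => [|k]; first by rewrite !big_ord0.
  rewrite big_ord_recl invr0 add0r [leRHS]big_ord_recr /= lerDl invr_ge0 //.
have KH : K1 * n%:R `^ (1 + b) * \sum_(s < n) s%:R^-1 <= K1 * n%:R `^ (1 + b) * L.
  by apply: ler_wpM2l => //; apply: mulr_ge0 => //; exact: powR_ge0.
rewrite -[K2 *+ n]mulr_natr [leLHS]mulrDl -/K1 -/K2 -/L.
apply: (le_trans (lerD (ler_wpM2r L0 KH) (lexx _))).
by rewrite le_eqVlt; apply/orP; left; apply/eqP; ring.
Qed.

End FiniteModel.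

(** * Cells and strips *)

(** The first coordinate axis, a circle, is cut into [k * k] cells, and for each of
    [k] shifts [th] the cells are grouped into [k] strips of [k] cyclically
    consecutive ones.  Averaging over the shifts replaces a uniform random
    translation of the strips, and keeps the model finite. *)
Definition strip (k th c : nat) : nat := (((c + th) %/ k) %% k)%N.

Section Strips.
Variable k : nat.
Hypothesis k_gt0 : (0 < k)%N.

Lemma ltn_strip th c : (strip k th c < k)%N.
Proof. by rewrite ltn_mod. Qed.

Lemma strip_period th c : strip k th (c + k * k) = strip k th c.
Proof. by rewrite /strip addnC addnA addnC divnMDl // modnDl addnC. Qed.

Lemma strip_card th i : (\sum_(c < k * k) (strip k th c == i) <= k)%N.
Proof.
rewrite -[leqRHS]card_ord.
have -> : (\sum_(c < k * k) (strip k th c == i) =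
   #|[pred c : 'I_(k * k) | strip k th c == i]|)%N.
  rewrite -sum1_card [RHS]big_mkcond /=; apply: eq_bigr => c _.
  by rewrite inE; case: (_ == _).
pose f (c : 'I_(k * k)) : 'I_k := Ordinal (ltn_pmod (c + th) k_gt0).
apply: (@leq_card_in _ _ f) => c c'; rewrite !inE /strip => /eqP ci /eqP ci' /(congr1 val) /= r.
have E (x : nat) : ((x + th) %% (k * k) = ((x + th) %/ k %% k) * k + (x + th) %% k)%N.
  by rewrite modn_divl mulnC; have := divn_eq ((x + th) %% (k * k)) k; rewrite modn_dvdm ?dvdn_mulr // mulnC.
have : (c + th = c' + th %[mod k * k])%N by rewrite !E ci ci' r.
by move/eqP; rewrite eqn_modDr !modn_small // => /eqP /val_inj.
Qed.

(** A boundary between strips lies between the cells [c] and [c.+1] for the single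
    shift [th] such that [k] divides [c.+1 + th]. *)
Lemma strip_step c : (\sum_(th < k) (strip k th c != strip k th c.+1) <= 1)%N.
Proof.
have dv (th : 'I_k) : strip k th c != strip k th c.+1 -> (k %| c.+1 + th)%N.
  apply: contraNT => h; rewrite /strip addSn divnS // -addSn.
  by rewrite (negbTE h) add0n.
have [[th0 h0]|no] := pselect (exists th : 'I_k, strip k th c != strip k th c.+1).
  rewrite (bigD1 th0) //= h0 big1 ?addn0 // => th thN; apply/eqP; rewrite eqb0.
  apply: contra thN => h; apply/eqP/val_inj.
  have : (c.+1 + th = c.+1 + th0 %[mod k])%N by rewrite (eqP (dv _ h)) (eqP (dv _ h0)).
  by move/eqP; rewrite eqn_modDl !modn_small // => /eqP.
rewrite big1 // => th _; apply/eqP; rewrite eqb0; apply/negP => h; apply: no.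
by exists th.
Qed.

Lemma strip_path c D : (\sum_(th < k) (strip k th c != strip k th (c + D)) <= D)%N.
Proof.
elim: D => [|D IH]; first by rewrite addn0 big1 // => th _; rewrite eqxx.
rewrite -[D.+1]addn1 addnA; apply: leq_trans (leq_add IH (strip_step (c + D))).
rewrite -big_split /= addn1; apply: leq_sum => th _.
have tri (x y z : nat) : ((x != z) <= (x != y) + (y != z))%N.
  by case: (x =P y) => [->|_] /=; [rewrite add0n|case: (x == z)].
exact: tri.
Qed.

(** The two alternatives are the two ways around the circle. *)
Lemma strip_shifts c c' D : (c < k * k)%N -> (c' < k * k)%N ->
  ((maxn c c' - minn c c' <= D) || (k * k - (maxn c c' - minn c c') <= D))%N ->
  (\sum_(th < k) (strip k th c != strip k th c') <= D)%N.
Proof.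
wlog cc' : c c' / (c <= c')%N => [H|].
  case/orP: (leq_total c c') => h; first exact: H.
  rewrite maxnC minnC => hc' hc hD; have := H _ _ h hc hc' hD.
  by under eq_bigr do rewrite eq_sym.
rewrite (maxn_idPr cc') (minn_idPl cc') => ck ck' /orP[] h.
  by have := strip_path c (c' - c); rewrite subnKC // => /leq_trans; apply.
have := strip_path c' (c + k * k - c'); rewrite subnKC; last by lia.
under eq_bigr do rewrite strip_period eq_sym.
by move=> /leq_trans; apply; lia.
Qed.

End Strips.

Section Cells.
Variable R : realType.
Implicit Types x y : R.

(** The minimum puts the point 1 into the last cell. *)
Definition cell_index (N : nat) (x : R) : nat := minn (Num.truncn (N%:R * x)) N.-1.

Lemma ltn_cell_index N x : (0 < N)%N -> (cell_index N x < N)%N.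
Proof. by move=> N0; rewrite /cell_index; lia. Qed.

Lemma cell_index_bounds N x : (0 < N)%N -> 0 <= x <= 1 ->
  (cell_index N x)%:R <= N%:R * x <= (cell_index N x).+1%:R.
Proof.
move=> N0 /andP[x0 x1]; have Nx0 : 0 <= N%:R * x by rewrite mulr_ge0.
rewrite /cell_index; case: (leqP (Num.truncn (N%:R * x)) N.-1) => h.
  by apply/andP; split; [rewrite truncn_le|apply/ltW/truncnS_gt].
rewrite prednK // -{3}[N%:R]mulr1 ler_wpM2l // andbT.
apply: (@le_trans _ _ (Num.truncn (N%:R * x))%:R); last by rewrite truncn_le.
by rewrite ler_nat ltnW.
Qed.

Lemma strip_shifts_circ k x y : (0 < k)%N -> 0 <= x <= 1 -> 0 <= y <= 1 ->
  (\sum_(th < k) (strip k th (cell_index (k * k) x) != strip k th (cell_index (k * k) y)))%N%:R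
  <= (k * k)%:R * circ (x - y) + 1.
Proof.
move=> k0 x01 y01; have N0 : (0 < k * k)%N by rewrite muln_gt0 k0.
have /andP[xl xu] := cell_index_bounds N0 x01; have /andP[yl yu] := cell_index_bounds N0 y01.
set N := (k * k)%N in N0 xl xu yl yu *.
have cxN := ltn_cell_index x N0; have cyN := ltn_cell_index y N0.
set cx := cell_index N x in xl xu cxN *; set cy := cell_index N y in yl yu cyN *.
have bound D : ((maxn cx cy - minn cx cy <= D) || (N - (maxn cx cy - minn cx cy) <= D))%N ->
   D%:R <= N%:R * circ (x - y) + 1 ->
  (\sum_(th < k) (strip k th cx != strip k th cy))%N%:R <= N%:R * circ (x - y) + 1.
  by move=> hD; apply: le_trans; rewrite ler_nat; exact: strip_shifts.
have DE : (maxn cx cy - minn cx cy)%N%:R = `|cx%:R - cy%:R| :> R.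
  case: (leqP cx cy) => h; first by rewrite natrB // ler0_norm ?opprB // subr_le0 ler_nat.
  by rewrite natrB ?(ltnW h) // ger0_norm // subr_ge0 ler_nat ltnW.
have NR : 0 < N%:R :> R by rewrite ltr0n.
rewrite -!natr1 in xu yu.
have [E|E] : circ (x - y) = `|x - y| \/ circ (x - y) = 1 - `|x - y|.
  by rewrite /circ; case: leP => _; [left|right].
- apply: (bound (maxn cx cy - minn cx cy)%N); first by rewrite leqnn.
  rewrite DE E -[X in X * `|_|](ger0_norm (ltW NR)) -normrM mulrBr ler_norml.
  have := ler_norm (N%:R * x - N%:R * y); have := ler_norm (- (N%:R * x - N%:R * y)).
  by rewrite normrN => h1 h2; apply/andP; split; lra.
- apply: (bound (N - (maxn cx cy - minn cx cy))%N); first by rewrite leqnn orbT.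
  have le : (maxn cx cy - minn cx cy <= N)%N.
    by apply: leq_trans (leq_subr _ _) _; rewrite geq_max (ltnW cxN) (ltnW cyN).
  rewrite natrB // DE E mulrBr mulr1 -[X in X * `|_|](ger0_norm (ltW NR)) -normrM mulrBr.
  suff : `|N%:R * x - N%:R * y| <= `|cx%:R - cy%:R| + 1 by lra.
  rewrite ler_norml.
  have := ler_norm (cx%:R - cy%:R : R); have := ler_norm (- (cx%:R - cy%:R) : R).
  by rewrite normrN => h1 h2; apply/andP; split; lra.
Qed.

Lemma measurable_cell_index N : measurable_fun [set: R] (cell_index N).
Proof.
(* Counting the cell boundaries that do not exceed [x]. *)
rewrite (_ : cell_index N = fun x =>
    (\sum_(j < N.-1) nat_of_bool (j.+1%:R <= N%:R * x)%R)%N).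
  elim: N.-1 => [|M IH].
    by under eq_fun do rewrite big_ord0; exact: measurable_cst.
  under eq_fun do rewrite big_ord_recr /=.
  apply: measurable_fun_addn => //.
  apply: (@measurableT_comp _ _ _ _ _ _ nat_of_bool) => //.
  by apply: measurable_fun_ler => //; exact: measurable_funM.
apply/funext => x; rewrite /cell_index.
have count (t M : nat) : minn t M = (\sum_(j < M) (j < t))%N.
  elim: M => [|M IH]; first by rewrite big_ord0 minn0.
  by rewrite big_ord_recr /= -IH; case: ltnP; lia.
rewrite count; apply: eq_bigr => j _; congr nat_of_bool.
have [x0|x0] := leP 0 (N%:R * x); first by rewrite truncn_ge_nat.
rewrite (_ : Num.truncn (N%:R * x) = 0%N); last first.
  by apply/truncn0Pn; rewrite -ltNge (lt_trans x0).
by rewrite ltn0 leNgt (lt_trans x0).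
Qed.

End Cells.

(** * The links of the SPA graph *)

Section SpaLinks.
Variables (R : realType) (m : nat) (r : \bar R) (A1 A2 : R).
Notation tup := (m.-tuple R).

(** The links do not depend on the time at which the graph is observed, except
    that only the vertices present have links. *)
Definition spa_link (pos : nat -> tup) (coin : nat -> nat -> bool) (u v : nat) : bool :=
  [&& (v < u)%N,
      `[< influence r A1 A2 pos u (spa_graph r A1 A2 pos coin u) v (pos u) >] &
      coin u v].

Definition link_indeg pos coin (t v : nat) : nat := (\sum_(u < t) spa_link pos coin u v)%N.

Lemma spa_graphE pos coin t u v :
  spa_graph r A1 A2 pos coin t u v = (u < t)%N && spa_link pos coin u v.
Proof.
elim: t => [|t IH] //=; rewrite IH [in RHS]ltnS [in RHS]leq_eqVlt.
by have [->|_] := eqVneq u t; rewrite /= ?ltnn ?orbF.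
Qed.

Lemma in_degreeE pos coin t v :
  in_degree t (spa_graph r A1 A2 pos coin t) v = link_indeg pos coin t v.
Proof.
rewrite /in_degree -sum1_card big_mkcond; apply: eq_bigr => u _ /=.
by rewrite inE spa_graphE ltn_ord /=; case: (spa_link _ _ _ _).
Qed.

Hypotheses (hr : (1 <= r)%E) (hm : (0 < m)%N) (A1_gt0 : 0 < A1) (A2_gt0 : 0 < A2).
Variable nu : probability tup R.
Hypothesis nuE : forall A, measurable A -> nu A = cube_volume A.

Lemma spa_linkE pos coin u v : (forall k, cube (pos k)) ->
  spa_link pos coin u v =
  [&& (v < u)%N, torus_dist r (pos v) (pos u) <=
                 vol_radius m r (influence_vol A1 A2 (link_indeg pos coin u v) u) & coin u v].
Proof.
move=> cpos; rewrite /spa_link; congr [&& _, _ & _].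
rewrite /influence in_degreeE (ball_of_volumeE hr nuE) //.
by apply/asboolP/idP => [[]|].
Qed.

Section Measurability.
Context d (T : measurableType d).
Variables (pos : nat -> T -> tup) (coin : nat -> nat -> T -> bool).
Hypothesis pos_cube : forall k w, cube (pos k w).

Notation slink w u v := (spa_link (pos ^~ w) (fun u v => coin u v w) u v).

Lemma measurable_torus_dist u v :
  measurable_fun setT (pos u) -> measurable_fun setT (pos v) ->
  measurable_fun setT (fun w => torus_dist r (pos u w) (pos v w)).
Proof.
move=> mu mv; under eq_fun do rewrite torus_distE //.
apply: measurable_lr_norm => i; apply: measurable_fun_circ.
  exact: (measurableT_comp (measurable_tnth i)).
exact: (measurableT_comp (measurable_tnth i)).
Qed.

(** By strong induction on [u]: a link from [u] is decided by the two positions, the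
    coin and the in-degree of [v] at time [u], which counts links from vertices
    older than [u]. *)
Lemma measurable_spa_link s :
  (forall u, (u < s)%N -> measurable_fun setT (pos u)) ->
  (forall u v, (u < s)%N -> measurable_fun setT (coin u v)) ->
  forall u v, (u < s)%N -> measurable_fun setT (fun w => slink w u v).
Proof.
move=> mpos mcoin; elim/ltn_ind => u IH v us.
have [vu|uv] := ltnP v u; last first.
  rewrite (_ : (fun w => _) = cst false); first exact: measurable_cst.
  by apply/funext => w; rewrite /spa_link ltnNge uv.
have mdeg t : (t <= u)%N -> measurable_fun setT
    (fun w => link_indeg (pos ^~ w) (fun u v => coin u v w) t v).
  elim: t => [|t IHt] tu; rewrite /link_indeg.
    by under eq_fun do rewrite big_ord0; exact: measurable_cst.
  under eq_fun do rewrite big_ord_recr /=.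
  apply: measurable_fun_addn; first by apply: IHt; exact: ltnW.
  apply: (@measurableT_comp _ _ _ _ _ _ nat_of_bool) => //.
  by apply: IH => //; exact: ltn_trans us.
under eq_fun do rewrite spa_linkE // vu /=.
apply: measurable_and; last exact: mcoin.
apply: measurable_fun_ler.
  by apply: measurable_torus_dist; apply: mpos => //; exact: ltn_trans us.
apply: (@measurableT_comp _ _ _ _ _ _
  (fun D => vol_radius m r (influence_vol A1 A2 D u))) => //.
exact: mdeg.
Qed.

End Measurability.

End SpaLinks.

(** * The finite model of the SPA process *)

(** ** Events that depend on a map to a finite set *)

Section FiniteMap.
Variables (R : realType) (d : measure_display) (T : measurableType d).
Variables (P : probability T R) (Om : finType) (f : T -> Om).
Hypothesis mf : forall z, measurable [set w | f w = z].

Lemma measurable_fmap (Q : pred Om) : measurable [set w | Q (f w)].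
Proof.
rewrite (_ : [set w | _] = \bigcup_(z in [set z | Q z]) [set w | f w = z]).
  apply: fin_bigcup_measurable => [|z _]; last exact: mf.
  by apply: (@sub_finite_set _ _ [set: Om]) => //; exact: finite_finset.
by apply/seteqP; split=> w /=; [move=> h; exists (f w)|move=> [z Qz ->]].
Qed.

Definition atom_prob (z : Om) : R := fine (P [set w | f w = z]).

Lemma atom_prob_ge0 z : 0 <= atom_prob z.
Proof. exact: fine_ge0. Qed.

Lemma prob_fmap (Q : pred Om) : P [set w | Q (f w)] = (\sum_(z | Q z) atom_prob z)%:E.
Proof.
have H (e : seq Om) : uniq e ->
    P [set w | f w \in e] = (\sum_(z <- e) atom_prob z)%:E.
  elim: e => [|z e IH] /=.
    by move=> _; rewrite big_nil (_ : [set w | _] = set0) ?measure0 // -subset0.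
  move=> /andP[ze ue]; rewrite big_cons EFinD -IH // /atom_prob fineK ?fin_num_measure //.
  rewrite -measureU //.
  - congr (P _); apply/seteqP; split=> w /=; rewrite inE.
      by move=> /predU1P[->|h]; [left|right].
    by move=> [->|->]; rewrite ?eqxx ?orbT.
  - exact: measurable_fmap (mem e).
  - by rewrite -subset0 => w [/= ->]; rewrite (negbTE ze).
have := H (enum Q) (enum_uniq _); rewrite big_enum => <-.
by congr (P _); apply/seteqP; split=> w /=; rewrite mem_enum.
Qed.

Lemma atom_prob_total : \sum_z atom_prob z = 1.
Proof.
have := prob_fmap xpredT; rewrite (_ : [set w | _] = setT); last by apply/seteqP; split.
by rewrite probability_setT => -[].
Qed.

Lemma atom_prob_neq0 z : atom_prob z != 0 -> exists w, f w = z.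
Proof.
have [//|no] := pselect (exists w, f w = z).
rewrite /atom_prob (_ : [set w | _] = set0) ?measure0 ?eqxx //.
by rewrite -subset0 => w h; apply: no; exists w.
Qed.

End FiniteMap.

(** Chebyshev's inequality for the number of occurring events in a family of pairwise
    independent events of equal probability. *)
Section Chebyshev.
Variables (R : realType) (d : measure_display) (T : measurableType d).
Variables (P : probability T R) (I : finType) (A : I -> T -> bool) (q : R).
Hypothesis mA : forall i, measurable [set w | A i w].
Hypothesis PA : forall i, P [set w | A i w] = q%:E.
Hypothesis PAA : forall i j, i != j -> P [set w | A i w && A j w] = (q ^+ 2)%:E.

Let f (w : T) : {ffun I -> bool} := [ffun i => A i w].

Lemma measurable_pattern z : measurable [set w | f w = z].
Proof.
rewrite (_ : [set w | _] = \bigcap_(i in [set: I]) [set w | A i w = z i]).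
  apply: fin_bigcap_measurable => // i _; case: (z i); first exact: mA.
  rewrite (_ : [set w | _] = ~` [set w | A i w]); first exact: measurableC.
  by apply/seteqP; split=> w /=; [move=> -> //|move/negP/negbTE].
apply/seteqP; split=> w /=; first by move=> <- i _ /=; rewrite ffunE.
by move=> h; apply/ffunP => i; rewrite ffunE; exact: h.
Qed.

Lemma measurable_count c : measurable [set w | ((\sum_i A i w)%N%:R < c :> R)%R].
Proof.
pose Q (z : {ffun I -> bool}) := ((\sum_i z i)%N%:R < c :> R)%R.
have E w : (\sum_i A i w)%N = (\sum_i f w i)%N.
  by apply: eq_bigr => i _; rewrite ffunE.
by under eq_set do rewrite E; exact: (measurable_fmap measurable_pattern Q).
Qed.

Lemma count_lower_bound : 0 < #|I|%:R * q ->
  (P [set w | ((\sum_i A i w)%N%:R < #|I|%:R * q / 2)%R] <= (4 / (#|I|%:R * q))%:E)%E.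
Proof.
set mu := #|I|%:R * q => mu0.
pose Pr := atom_prob P f; pose cnt (z : {ffun I -> bool}) : R := (\sum_i z i)%N%:R.
have Pr0 := atom_prob_ge0 P f.
have cntE w : cnt (f w) = (\sum_i A i w)%N%:R.
  by rewrite /cnt; under eq_bigr do rewrite ffunE.
have E1 i : Ex Pr (fun z : {ffun I -> bool} => (z i)%:R) = q.
  rewrite /Ex; under eq_bigr do rewrite mulrC mulr_natr mulrb.
  rewrite -big_mkcond /=; apply: EFin_inj.
  rewrite -(prob_fmap P measurable_pattern (fun z : {ffun I -> bool} => z i)) -(PA i).
  by congr (P _); apply/seteqP; split=> w /=; rewrite ffunE.
have E2 i j : i != j -> Ex Pr (fun z : {ffun I -> bool} => (z i)%:R * (z j)%:R) = q ^+ 2.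
  move=> ij; rewrite /Ex (eq_bigr (fun z : {ffun I -> bool} => if z i && z j then Pr z else 0)); last first.
    by move=> z _; case: (z i); case: (z j); rewrite /= ?mul1r ?mul0r.
  rewrite -big_mkcond /=; apply: EFin_inj.
  rewrite -(prob_fmap P measurable_pattern (fun z : {ffun I -> bool} => z i && z j)) -(PAA ij).
  by congr (P _); apply/seteqP; split=> w /=; rewrite !ffunE.
have Ecnt : Ex Pr cnt = mu.
  rewrite (@eq_Ex _ _ _ _ (fun z : {ffun I -> bool} => \sum_i (z i)%:R)); last first.
    by move=> z; rewrite /cnt natr_sum.
  by rewrite Ex_sum (eq_bigr (fun=> q)) // sumr_const /mu mulr_natl.
have Ecnt2 : Ex Pr (fun z : {ffun I -> bool} => cnt z ^+ 2) <= mu + mu ^+ 2.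
  rewrite (@eq_Ex _ _ _ _ (fun z : {ffun I -> bool} => \sum_i \sum_j (z i)%:R * (z j)%:R)); last first.
    move=> z; rewrite /cnt natr_sum expr2 mulr_suml; apply: eq_bigr => i _.
    by rewrite mulr_sumr.
  rewrite Ex_sum; apply: (@le_trans _ _ (\sum_(i : I) (q + #|I|%:R * q ^+ 2))).
    apply: ler_sum => i _; rewrite Ex_sum (bigD1 i) //=; apply: lerD.
      rewrite -(E1 i); apply: le_Ex => // z _.
      by case: (z i); rewrite ?mulr1 ?mulr0.
    rewrite (eq_bigr (fun=> q ^+ 2)); last by move=> j ji; rewrite E2 // eq_sym.
    rewrite sumr_const -[leLHS]mulr_natl ler_wpM2r ?sqr_ge0 // ler_nat.
    exact: max_card.
  rewrite sumr_const -[leLHS]mulr_natl /mu le_eqVlt; apply/orP; left; apply/eqP; ring.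
have Evar : Ex Pr (fun z : {ffun I -> bool} => (cnt z - mu) ^+ 2) <= mu.
  rewrite (@eq_Ex _ _ _ _ (fun z : {ffun I -> bool} => cnt z ^+ 2 + ((- 2 * mu) * cnt z + mu ^+ 2))); last first.
    by move=> z; ring.
  rewrite !ExD ExZ Ex_cst ?Ecnt; last exact: (atom_prob_total P measurable_pattern).
  by apply: le_trans (lerD Ecnt2 (lexx _)) _; rewrite le_eqVlt; apply/orP; left; apply/eqP; ring.
have M := @finite_markov _ _ Pr Pr0 (fun z => (cnt z - mu) ^+ 2) (mu ^+ 2 / 4) (fun z => sqr_ge0 _)
  ltac:(by rewrite divr_gt0 ?exprn_gt0).
apply: (@le_trans _ _ (P [set w | (mu ^+ 2 / 4 < (cnt (f w) - mu) ^+ 2)%R])).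
  apply: le_measure; rewrite ?inE.
  - exact: measurable_count.
  - exact: (measurable_fmap measurable_pattern (fun z : {ffun I -> bool} => mu ^+ 2 / 4 < (cnt z - mu) ^+ 2)).
  - move=> w /=; rewrite -cntE => h.
    have -> : mu ^+ 2 / 4 = (mu / 2) ^+ 2 by field.
    rewrite -(sqrrN (_ - _)) ltrXn2r //; lra.
rewrite (prob_fmap P measurable_pattern (fun z : {ffun I -> bool} => mu ^+ 2 / 4 < (cnt z - mu) ^+ 2)) lee_fin.
apply: le_trans M _; apply: (@le_trans _ _ (mu / (mu ^+ 2 / 4))).
  by rewrite ler_wpM2r // invr_ge0 divr_ge0 // sqr_ge0.
by rewrite le_eqVlt; apply/orP; left; apply/eqP; field; rewrite gt_eqF.
Qed.

End Chebyshev.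

(** ** The outcomes of the process *)

Section SpaModel.
Variables (R : realType) (m : nat) (r : \bar R) (p A1 A2 : R).
Hypotheses (hr : (1 <= r)%E) (hm : (0 < m)%N).
Hypotheses (p_gt0 : 0 < p) (p_le1 : p <= 1) (A1_gt0 : 0 < A1) (A2_gt0 : 0 < A2).
Variables (d : measure_display) (T : measurableType d) (P : probability T R).
Variables (X : nat -> {RV P >-> m.-tuple R}) (B : nat -> nat -> {RV P >-> bool}).
Hypothesis noise : spa_noise X B p.
Notation tup := (m.-tuple R).
Notation index := (nat + nat * nat)%type.

Let X_cube k w : cube (X k w). Proof. by case: noise => h _ _ _; apply: h. Qed.
Let X_law k A : measurable A -> distribution P (X k) A = cube_volume A.
Proof. by case: noise => _ h _ _; apply: h. Qed.
Let B_law u v A : distribution P (B u v) A = bernoulli_prob p A.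
Proof. by case: noise => _ _ h _; apply: h. Qed.
Let indep : mutually_independent P (noise_sigma X B).
Proof. by case: noise. Qed.

Definition slink (w : T) : nat -> nat -> bool :=
  spa_link r A1 A2 (fun k => X k w) (fun u v => B u v w).
Definition sindeg (w : T) : nat -> nat -> nat :=
  link_indeg r A1 A2 (fun k => X k w) (fun u v => B u v w).

Lemma slinkE w u v : slink w u v =
  [&& (v < u)%N, torus_dist r (X v w) (X u w) <=
                 vol_radius m r (influence_vol A1 A2 (sindeg w u v) u) & B u v w].
Proof. by apply: (spa_linkE A1 A2 hr (@X_law 0%N)) => l. Qed.

(** The noise that determines the graph before vertex [s] arrives. *)
Definition past (s : nat) : set index :=
  [set i | match i with inl k => (k < s)%N | inr (u, _) => (u < s)%N end].

Lemma measurable_past_X s k : (k < s)%N ->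
  measurable_fun setT (X k : g_sigma_algebraType (noise_gen X B (past s)) -> tup).
Proof. by move=> ks; apply: measurable_X_field. Qed.

Lemma measurable_past_link s u v : (u < s)%N ->
  measurable_fun setT ((fun w => slink w u v) :
    g_sigma_algebraType (noise_gen X B (past s)) -> bool).
Proof.
move=> us; apply: (measurable_spa_link A1 A2 hr (@X_law 0%N)
  (T := g_sigma_algebraType (noise_gen X B (past s))) (pos := fun k w => X k w)
  (coin := fun u v w => B u v w) X_cube) us.
- by move=> k; exact: measurable_past_X.
- by move=> k l ks; apply: measurable_B_field.
Qed.

(** The past [H] and the centre are known from [D], the position [f] is fresh, and
    the coin is fresh even after the position is revealed; so the three
    probabilities multiply. *)
Lemma prob_ball_coin (D : set index) H b f u v a :
  0 <= a <= 1 -> D (inl b) -> ~ D (inl f) -> ~ D (inr (u, v)) -> noise_field X B D H ->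
  P (H `&` [set w | (torus_dist r (X b w) (X f w) <= vol_radius m r a) && B u v w]) =
  (P H * a%:E * p%:E)%E.
Proof.
move=> a01 Db Df Duv DH.
pose rho := vol_radius m r a.
pose K : set (tup * tup) :=
  snd @^-1` @cube R m `&` [set q | lr_norm r (tnth (circs q.1 q.2)) <= rho].
have mK : measurable K.
  apply: measurableI.
    have m2 : measurable_fun setT (@snd tup tup) by [].
    by rewrite -[X in measurable X]setTI; apply: m2 => //; exact: measurable_cube.
  rewrite -[X in measurable X]setTI; apply: measurable_fun_ler => //.
  apply: (measurable_lr_norm r (f := fun i q => tnth (circs q.1 q.2) i)) => i.
  under eq_fun do rewrite tnth_mktuple.
  apply: measurable_fun_circ.
    exact: (measurableT_comp (measurable_tnth i)).
  exact: (measurableT_comp (measurable_tnth i)).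
have Kc x : cube x -> distribution P (X f) (xsection K x) = a%:E.
  move=> cx; rewrite -((vol_radiusP hr hm (@X_law f) cx a01).2); congr (distribution _ _ _).
  apply/seteqP; split=> y; rewrite /xsection /= inE /K /=.
    by move=> [cy h]; split => //; rewrite torus_dist_circs.
  by move=> [cy h]; split => //; rewrite -torus_dist_circs.
have KE : [set w | K (X b w, X f w)] = [set w | torus_dist r (X b w) (X f w) <= rho].
  apply/seteqP; split=> w; rewrite /K /=.
    by move=> [_ h]; rewrite torus_dist_circs.
  by move=> h; split => //; rewrite -torus_dist_circs.
rewrite (_ : H `&` _ = (H `&` [set w | K (X b w, X f w)]) `&` [set w | B u v w]); last first.
  by rewrite KE -setIA; congr (_ `&` _); apply/seteqP; split=> w /= /andP.
have p01 : 0 <= p <= 1 by rewrite ltW.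
rewrite (prob_coin indep (D := D `|` [set inl f]) (@B_law u v) p01) //.
- by rewrite (prob_fresh indep X_cube Db Df DH mK Kc).
- by move=> [|].
- apply: noise_fieldI; first by apply: noise_field_mono DH; left.
  rewrite KE; rewrite -[X in noise_field _ _ _ X]setTI.
  have : measurable_fun setT ((fun w => torus_dist r (X b w) (X f w) <= rho) :
      g_sigma_algebraType (noise_gen X B (D `|` [set inl f])) -> bool).
    apply: measurable_fun_ler => //.
    apply: (measurable_torus_dist hr
      (T := g_sigma_algebraType (noise_gen X B (D `|` [set inl f])))
      (pos := fun k w => X k w) X_cube).
      by apply: measurable_X_field; left.
    by apply: measurable_X_field; right.
  by move=> /(_ measurableT [set true]); apply.
Qed.

Variables (n k : nat).
Hypothesis k_gt0 : (0 < k)%N.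
Notation N := (k * k)%N.
Let N_gt0 : (0 < N)%N. Proof. by rewrite muln_gt0 k_gt0. Qed.

(** The coordinate along which the torus is cut into strips. *)
Definition coord0 : 'I_m := Ordinal hm.

(** These finitely many data determine the graph on the first [n] vertices, and the
    strip of every vertex for every shift. *)
Definition outcome := ({ffun 'I_n * 'I_n -> bool} * {ffun 'I_n -> 'I_N})%type.

Definition observe (w : T) : outcome :=
  ([ffun x : 'I_n * 'I_n => slink w x.1 x.2],
   [ffun i : 'I_n => Ordinal (ltn_cell_index (tnth (X i w) coord0) N_gt0)]).

(** The links and cells of an outcome, extended to all numbers by default values,
    so that outcomes fit the finite model of the growth estimates. *)
Definition olink (z : outcome) (u v : nat) : bool :=
  if insub u is Some i then
    if insub v is Some j then (v < u)%N && z.1 (i, j) else false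
  else false.

Definition ocell (z : outcome) (u : nat) : nat := if insub u is Some i then z.2 i else 0%N.

Lemma olink_lt z u v : olink z u v -> (v < u)%N.
Proof. by rewrite /olink; case: insubP => // i _ _; case: insubP => // j _ _ /andP[]. Qed.

Lemma olink_observe w u v : (u < n)%N -> olink (observe w) u v = slink w u v.
Proof.
move=> un; rewrite /olink (insubT (fun u => u < n)%N un).
case: insubP => [j vn <-|vn].
  by rewrite ffunE /=; case: ltnP => // uv; rewrite /slink /spa_link ltnNge uv.
by rewrite /slink /spa_link ltnNge (leq_trans (ltnW un)) // leqNgt.
Qed.

Lemma ocell_observe w u : (u < n)%N ->
  ocell (observe w) u = cell_index N (tnth (X u w) coord0).
Proof. by move=> un; rewrite /ocell (insubT (fun u => u < n)%N un) ffunE. Qed.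

Lemma ocell_lt z u : (u < n)%N -> (ocell z u < N)%N.
Proof. by move=> un; rewrite /ocell (insubT (fun u => u < n)%N un) ltn_ord. Qed.

(** What an outcome tells about the time before vertex [s] arrives. *)
Definition trunc_outcome (s : nat) (z : outcome) : outcome :=
  ([ffun x : 'I_n * 'I_n => (x.1 < s)%N && z.1 x],
   [ffun i : 'I_n => if (i < s)%N then z.2 i else Ordinal N_gt0]).

Lemma trunc_outcome_id z : trunc_outcome n z = z.
Proof.
case: z => f g; congr pair; apply/ffunP => x; rewrite !ffunE ?ltn_ord //.
Qed.

Lemma determined_trunc s (h : outcome -> R) z : determined olink ocell s h -> h (trunc_outcome s z) = h z.
Proof.
move=> dh; apply: dh.
  move=> u v us; rewrite /olink; case: insubP => // i _ iu; case: insubP => // j _ _.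
  by rewrite ffunE /= iu us.
by move=> u us; rewrite /ocell; case: insubP => // i _ iu; rewrite ffunE iu us.
Qed.

Lemma past_field_outcome s z : (s <= n)%N ->
  noise_field X B (past s) [set w | trunc_outcome s (observe w) = z].
Proof.
move=> sn; pose FT := g_sigma_algebraType (noise_gen X B (past s)).
have ml (x : 'I_n * 'I_n) : measurable_fun setT
    ((fun w => (x.1 < s)%N && slink w x.1 x.2) : FT -> bool).
  case: (ltnP x.1 s) => xs /=; last exact: measurable_cst.
  exact: measurable_past_link.
have mc (i : 'I_n) : measurable_fun setT
    ((fun w => if (i < s)%N then cell_index N (tnth (X i w) coord0) else 0%N) : FT -> nat).
  case is_: (i < s)%N; last exact: measurable_cst.
  apply: (measurableT_comp (@measurable_cell_index R N)).
  apply: (measurableT_comp (measurable_tnth coord0)).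
  exact: measurable_past_X.
rewrite (_ : [set w | _] =
  (\bigcap_(x in [set: 'I_n * 'I_n]) ((fun w => (x.1 < s)%N && slink w x.1 x.2) @^-1` [set z.1 x])) `&`
  (\bigcap_(i in [set: 'I_n])
    ((fun w => if (i < s)%N then cell_index N (tnth (X i w) coord0) else 0%N) @^-1` [set val (z.2 i)]))).
  apply: noise_fieldI.
    apply: (@fin_bigcap_measurable _ FT) => // x _.
    by rewrite -[X in measurable X]setTI; exact: ml.
  apply: (@fin_bigcap_measurable _ FT) => // i _.
  by rewrite -[X in measurable X]setTI; exact: mc.
apply/seteqP; split=> w.
  move=> /= <-; split=> [x _|i _] /=; rewrite !ffunE //.
  by case: ifP.
move=> [h1 h2] /=; case: z h1 h2 => f g h1 h2; congr pair; apply/ffunP => x; rewrite !ffunE.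
  exact: (h1 x).
by apply/val_inj; have /= <- := h2 x Logic.I; case: ifP.
Qed.

Lemma measurable_outcome s z : (s <= n)%N ->
  measurable [set w | trunc_outcome s (observe w) = z].
Proof. by move=> sn; apply: noise_field_measurable; exact: past_field_outcome. Qed.

Lemma measurable_atom z : measurable [set w | observe w = z].
Proof.
have := measurable_outcome z (leqnn n).
by under eq_set do rewrite trunc_outcome_id.
Qed.

Definition outcome_prob : outcome -> R := atom_prob P observe.

Notation OEx := (Ex outcome_prob).

(** Conditioning on the past: it determines [h] and [c], so the bound may be checked
    on each of the finitely many truncated outcomes [y]. *)
Lemma Ex_past s (h : outcome -> R) (Q : pred outcome) (c : outcome -> R) :
  (s <= n)%N -> determined olink ocell s h -> determined olink ocell s c ->
  (forall z, 0 <= h z) ->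
  (forall y, (P ([set w | trunc_outcome s (observe w) = y] `&` [set w | Q (observe w)]) <=
     (c y)%:E * P [set w | trunc_outcome s (observe w) = y])%E) ->
  OEx (fun z => h z * (Q z)%:R) <= OEx (fun z => h z * c z).
Proof.
move=> sn dh dc h0 bound; rewrite /Ex.
rewrite (partition_big (trunc_outcome s) xpredT) //=.
rewrite [leRHS](partition_big (trunc_outcome s) xpredT) //=.
apply: ler_sum => y _.
have det (g : outcome -> R) z : determined olink ocell s g ->
    trunc_outcome s z == y -> g z = g y.
  by move=> dg /eqP <-; apply/esym; exact: determined_trunc.
have -> : \sum_(z | trunc_outcome s z == y) h z * (Q z)%:R * outcome_prob z =
    h y * \sum_(z | (trunc_outcome s z == y) && Q z) outcome_prob z.
  rewrite mulr_sumr [RHS]big_mkcondr /=; apply: eq_bigr => z zy.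
  by rewrite (det h z dh zy); case: (Q z); rewrite ?mulr1 ?mulr0 ?mul0r.
have -> : \sum_(z | trunc_outcome s z == y) h z * c z * outcome_prob z =
    h y * (c y * \sum_(z | trunc_outcome s z == y) outcome_prob z).
  rewrite !mulr_sumr; apply: eq_bigr => z zy.
  by rewrite (det h z dh zy) (det c z dc zy) !mulrA.
rewrite ler_wpM2l //; have := bound y.
pose Q1 z := trunc_outcome s z == y; pose Q2 z := Q1 z && Q z.
have -> : [set w | trunc_outcome s (observe w) = y] = [set w | Q1 (observe w)].
  by apply/seteqP; split=> w /eqP.
have -> : [set w | Q1 (observe w)] `&` [set w | Q (observe w)] = [set w | Q2 (observe w)].
  by apply/seteqP; split=> w /andP.
by rewrite !(prob_fmap P measurable_atom) -EFinM lee_fin.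
Qed.

Lemma sindeg_observe w t v : (t <= n)%N -> sindeg w t v = indeg olink (observe w) t v.
Proof.
move=> tn; apply: eq_bigr => u _; rewrite olink_observe //.
by rewrite (leq_trans (ltn_ord u)).
Qed.

Lemma indeg_trunc z s v : indeg olink (trunc_outcome s z) s v = indeg olink z s v.
Proof.
apply/eqP; rewrite -(eqr_nat R); apply/eqP.
apply: (determined_trunc (h := fun z => (indeg olink z s v)%:R)) => z1 z2 hl _.
by congr (_%:R); apply: eq_bigr => u _; rewrite hl.
Qed.

Lemma spa_Ex_link s v (h : outcome -> R) : (v < s < n)%N ->
  determined olink ocell s h -> (forall z, 0 <= h z) ->
  OEx (fun z => h z * (olink z s v)%:R) <=
  OEx (fun z => h z * (p * influence_volume olink A1 A2 z s v)).
Proof.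
move=> /andP[vs sn] dh h0; apply: (Ex_past (s := s)) => //; first exact: ltnW.
  move=> z z' hl _; rewrite /influence_volume; congr (_ * influence_vol _ _ _ _).
  by apply: eq_bigr => u _; rewrite hl.
move=> y; pose D := indeg olink y s v.
rewrite (_ : _ `&` _ = [set w | trunc_outcome s (observe w) = y] `&`
   [set w | (torus_dist r (X v w) (X s w) <= vol_radius m r (influence_vol A1 A2 D s))
            && B s v w]).
  rewrite (prob_ball_coin (D := past s)) //.
  - by rewrite EFinM muleC muleA muleAC -muleA muleC -/D.
  - exact: influence_vol01.
  - by rewrite /past /= ltnn.
  - by rewrite /past /= ltnn.
  - by apply: past_field_outcome; exact: ltnW.
apply/seteqP; split=> w /= [wy]; rewrite olink_observe // slinkE vs /=;
  by rewrite sindeg_observe ?(ltnW sn) // -indeg_trunc wy.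
Qed.

(** A cell is contained in a slab of width [1 / N]. *)
Lemma cell_prob s c : (P [set w | cell_index N (tnth (X s w) coord0) = c] <= (N%:R^-1)%:E)%E.
Proof.
have NR : 0 < N%:R :> R by rewrite ltr0n.
pose I : set R := `[c%:R / N%:R, c.+1%:R / N%:R]%classic.
pose A := prod_set (fun i : 'I_m => if i == coord0 then I else setT).
have mI : measurable I by exact: measurable_itv.
have mB (i : 'I_m) : measurable (if i == coord0 then I else setT) by case: ifP.
have mA : measurable A by exact: measurable_prod_set.
have le1 (S : set R) : measurable S -> (lebesgue_measure (S `&` `[0%R, 1%R]) <= 1)%E.
  move=> mS; have <- : lebesgue_measure (`[0%R, 1%R]%classic : set R) = 1%E.
    by rewrite lebesgue_measure_itv /= lte01 oppr0 adde0.
  have mSI : measurable (S `&` `[0%R, 1%R]) by exact: measurableI.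
  by apply: le_measure; rewrite ?inE.
apply: (@le_trans _ _ (distribution P (X s) A)).
  apply: le_measure; rewrite ?inE.
  - have : measurable_fun setT (fun w => cell_index N (tnth (X s w) coord0)).
      apply: (measurableT_comp (@measurable_cell_index R N)).
      by apply: (measurableT_comp (measurable_tnth coord0)); exact: measurable_funPT.
    by move=> /(_ measurableT [set c]); rewrite setTI; apply.
  - by rewrite -[X in measurable X]setTI; apply: measurable_funPT.
  - move=> w /= wc i; case: eqP => // ->.
    have /andP[h1 h2] := cell_index_bounds N_gt0 (X_cube s w coord0).
    rewrite /I /= in_itv /= ler_pdivrMr // ler_pdivlMr //.
    by rewrite -wc [_ * N%:R]mulrC h1 h2.
rewrite (prod_set_volume (nu := distribution P (X s)) (@X_law s)) //.
rewrite (bigD1 coord0) //= ?eqxx -[leRHS]mule1; apply: lee_pmul => //.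
- by apply: prode_ge0.
- apply: (@le_trans _ _ (lebesgue_measure I)).
    have mI' : measurable (I `&` `[0%R, 1%R]) by exact: measurableI.
    by apply: le_measure; rewrite ?inE.
  rewrite /I lebesgue_measure_itv /= lte_fin; case: ifP => _; last by rewrite lee_fin invr_ge0.
  by rewrite -EFinB lee_fin -mulrBl -natr1 addrAC subrr add0r mul1r.
- suff /andP[] : (0 <= \prod_(i < m | i != coord0)
      lebesgue_measure ((if i == coord0 then I else setT) `&` `[0%R, 1%R]) <= 1)%E by [].
  elim/big_ind : _ => [|a b /andP[a0 a1] /andP[b0 b1]|i _].
  + by rewrite lee01 lexx.
  + by rewrite mule_ge0 //= -[leRHS]mule1 lee_pmul.
  + by rewrite measure_ge0 le1.
Qed.

Lemma spa_Ex_cell s c (h : outcome -> R) : (s < n)%N ->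
  determined olink ocell s h -> (forall z, 0 <= h z) ->
  OEx (fun z => h z * (ocell z s == c)%:R) <= OEx h / N%:R.
Proof.
move=> sn dh h0.
rewrite [leRHS](_ : _ = OEx (fun z => h z * N%:R^-1)); last first.
  by rewrite mulrC -ExZ; apply: eq_Ex => z; rewrite mulrC.
apply: (Ex_past (s := s)) => //; first exact: ltnW.
move=> y; rewrite (_ : [set w | ocell (observe w) s == c] =
  X s @^-1` [set x | cell_index N (tnth x coord0) = c]); last first.
  by apply/seteqP; split=> w /=; rewrite ocell_observe // => /eqP.
have mc : measurable [set x : tup | cell_index N (tnth x coord0) = c].
  have : measurable_fun setT (fun x : tup => cell_index N (tnth x coord0)).
    apply: (measurableT_comp (@measurable_cell_index R N)).
    exact: measurable_tnth.
  by move=> /(_ measurableT [set c]); rewrite setTI; apply.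
rewrite (noise_field_indep indep (D := past s) (i := inl s)).
- by rewrite muleC lee_wpmul2r // cell_prob.
- by rewrite /past /= ltnn.
- by apply: past_field_outcome; exact: ltnW.
- by exists [set x | cell_index N (tnth x coord0) = c]; rewrite ?setTI.
Qed.

(** The ends of a link differ by at most the radius of the sphere of influence,
    which is of order the [m]-th root of its volume, and the number of shifts
    that separate them is governed by the distance of their first coordinates.
    Outcomes of probability zero are excluded because they need not come from any
    positions. *)
Lemma spa_crossing_shifts z s v : outcome_prob z != 0 -> (s < n)%N -> olink z s v ->
  (\sum_(th < k) (strip k th (ocell z s) != strip k th (ocell z v)))%N%:R <=
  N%:R * (m%:R / 2) * influence_volume olink A1 A2 z s v `^ m%:R^-1 + 1.
Proof.
move=> /atom_prob_neq0[w <-] sn; have mR : 0 < m%:R :> R by rewrite ltr0n.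
rewrite olink_observe // slinkE => /and3P[vs dvs _].
have vn : (v < n)%N by exact: ltn_trans sn.
rewrite !ocell_observe //; apply: le_trans (strip_shifts_circ k_gt0 _ _) _.
- exact: X_cube.
- exact: X_cube.
rewrite lerD2r -[leRHS]mulrA ler_wpM2l //.
rewrite sindeg_observe ?(ltnW sn) // in dvs.
have a01 := influence_vol01 (indeg olink (observe w) s v) s A1_gt0 A2_gt0.
have [a0 a1] := andP a01.
have := torus_ball_coord hr hm (@X_law 0%N) coord0 (X_cube v w) a01 (conj (X_cube s w) dvs).
rewrite -circN opprB; set t := circ _.
have t0 : 0 <= t by apply: circ_ge0; apply: cube_diff_le1; exact: X_cube.
have tm0 : 0 <= 2 * t / m%:R by rewrite divr_ge0 // mulr_ge0.
move=> ta; have : 2 * t / m%:R <= influence_volume olink A1 A2 (observe w) s v `^ m%:R^-1.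
  have -> : 2 * t / m%:R = ((2 * t / m%:R) ^+ m) `^ m%:R^-1.
    by rewrite -powR_mulrn // -powRrM mulfV ?gt_eqF // powRr1.
  by apply: ge0_ler_powR; rewrite ?nnegrE ?invr_ge0 ?exprn_ge0.
move=> h; rewrite -[leLHS](_ : m%:R / 2 * (2 * t / m%:R) = t); first by rewrite ler_wpM2l.
by field; rewrite gt_eqF.
Qed.

(** ** There are linearly many links *)

Definition vertex_pair := {x : 'I_n * 'I_n | (x.2 < x.1)%N}.

Lemma card_vertex_pair : (2 <= n)%N -> (n * n <= 4 * #|{: vertex_pair}|)%N.
Proof.
move=> n2; rewrite card_sig -sum1_card.
have -> : (\sum_(x in [pred x : 'I_n * 'I_n | (x.2 < x.1)%N]) 1 = \sum_(s < n) s)%N.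
  rewrite (eq_bigl (fun x : 'I_n * 'I_n => (x.2 < x.1)%N)) //.
  rewrite -(pair_big_dep xpredT (fun s v : 'I_n => (v < s)%N) (fun _ _ => 1%N)) /=.
  apply: eq_bigr => s _.
  by rewrite -(big_ord_widen n (fun=> 1%N) (ltnW (ltn_ord s))) sum1_card card_ord.
rewrite -(big_mkord xpredT (fun i => i)) /= bin2_sum bin2.
have := odd_double_half (n * n.-1); have -> : odd (n * n.-1) = false.
  by case: (n) => // l; rewrite oddM /= ; case: (odd l).
by rewrite add0n -mul2n => E; move: n2 E; case: (n) => // l /= *; nia.
Qed.

(** The volume [A2 / n] is a lower bound for that of every sphere of influence up to
    time [n].  The links inside the concentric balls of this volume do not depend
    on the evolution of the graph, and since the torus is homogeneous, any two of
    them are independent. *)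
Let base_vol : R := A2 / n%:R.

Definition base_link (x : vertex_pair) (w : T) : bool :=
  (torus_dist r (X (val x).2 w) (X (val x).1 w) <= vol_radius m r base_vol) &&
  B (val x).1 (val x).2 w.

Hypothesis n_large : A2 <= n%:R.
Hypothesis n_ge2 : (2 <= n)%N.

Let base_vol01 : 0 <= base_vol <= 1.
Proof.
rewrite /base_vol; apply/andP; split; first by rewrite divr_ge0 // ltW.
by rewrite ler_pdivrMr ?mul1r // ltr0n ltnW.
Qed.

Lemma base_link_slink x w : base_link x w -> slink w (val x).1 (val x).2.
Proof.
case: x => -[s v] /= vs; rewrite /base_link /= => /andP[dvs Bsv].
rewrite slinkE vs Bsv andbT /=; apply: le_trans dvs _.
have s0 : (0 < s)%N by exact: leq_ltn_trans vs.
apply: (le_vol_radius hr hm (@X_law 0%N)) => //; first exact: influence_vol01.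
case/andP: base_vol01 => _ b1.
rewrite /influence_vol le_min b1 andbT /base_vol.
apply: (@le_trans _ _ (A2 / s%:R)).
  by rewrite ler_wpM2l ?(ltW A2_gt0) // lef_pV2 ?posrE ?ltr0n ?ler_nat ?(ltnW n_ge2) // ltnW.
by rewrite ler_wpM2r ?invr_ge0 // lerDr mulr_ge0 // ltW.
Qed.

Lemma base_link_field (D : set index) x : D (inl (val (val x).1)) -> D (inl (val (val x).2)) ->
  D (inr (val (val x).1, val (val x).2)) -> noise_field X B D [set w | base_link x w].
Proof.
move=> D1 D2 D3.
have : measurable_fun setT (base_link x : g_sigma_algebraType (noise_gen X B D) -> bool).
  apply: measurable_and; last exact: measurable_B_field.
  apply: measurable_fun_ler => //.
  by apply: (measurable_torus_dist hr (T := g_sigma_algebraType (noise_gen X B D))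
    (pos := fun k w => X k w) X_cube); exact: measurable_X_field.
by move=> /(_ measurableT [set true]); rewrite setTI; apply.
Qed.

Lemma base_link_prob x : P [set w | base_link x w] = (base_vol * p)%:E.
Proof.
case: x => -[s v] /= vs; rewrite -[X in P X]setTI.
rewrite (prob_ball_coin (D := [set inl (val v)])) //.
- by rewrite probability_setT mul1e -EFinM.
- by move=> [] h; move: vs; rewrite h ltnn.
- exact: sub_sigma_algebra (noise_genT _ _ _).
Qed.

Lemma base_link_pair x y : x != y ->
  P [set w | base_link x w && base_link y w] = ((base_vol * p) ^+ 2)%:E.
Proof.
have swapE (z : vertex_pair) w : base_link z w =
    (torus_dist r (X (val z).1 w) (X (val z).2 w) <= vol_radius m r base_vol) &&
    B (val z).1 (val z).2 w by rewrite /base_link torus_distC.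
have andE (z z' : vertex_pair) : [set w | base_link z w && base_link z' w] =
    [set w | base_link z w] `&` [set w | base_link z' w].
  by apply/seteqP; split=> w /= /andP.
(* The later of the two later endpoints is independent of the other link,
   unless the two links share it; then an earlier endpoint is. *)
have later (z z' : vertex_pair) : ((val z).1 < (val z').1)%N ->
    P [set w | base_link z w && base_link z' w] = ((base_vol * p) ^+ 2)%:E.
  move=> lt; rewrite andE; case: z' lt => -[s' v'] /= vs' lt.
  pose D : set index := [set inl (val (val z).1); inl (val (val z).2);
    inr (val (val z).1, val (val z).2)] `|` [set inl (val v')].
  have zlt := valP z.
  rewrite [X in _ `&` X](_ : _ = [set w | (torus_dist r (X v' w) (X s' w) <=
    vol_radius m r base_vol) && B s' v' w]) //.
  rewrite (prob_ball_coin (D := D)) //.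
  - by rewrite base_link_prob -!EFinM expr2 !mulrA.
  - by right.
  - by move=> [[[|]|//]|] /= [] h; first [by move: lt; rewrite h ltnn
      | by move: (ltn_trans zlt lt); rewrite h ltnn | by move: vs'; rewrite h ltnn].
  - by move=> [[[//|//]|]|//] /= [] h _; move: lt; rewrite h ltnn.
  - by apply: base_link_field => /=; left; [left; left|left; right|right].
move=> xy; have [lt|lt|eq1] := ltngtP (val x).1 (val y).1.
- exact: later.
- by under eq_set do rewrite andbC; exact: later.
have eq1' : (val x).1 = (val y).1 by exact: val_inj.
case: x y xy eq1 eq1' => -[s v] /= vs [[s' v'] /= vs'] xy _ /= ss'.
subst s'; have vv' : v != v' by apply: contra xy => /eqP vv'; subst v'; apply/eqP/val_inj.
rewrite andE.
pose D : set index := [set inl (val s); inl (val v); inr (val s, val v)].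
have -> : [set w | base_link (exist _ (s, v') vs') w] =
    [set w | (torus_dist r (X s w) (X v' w) <= vol_radius m r base_vol) && B s v' w].
  by apply/seteqP; split=> w; rewrite /= swapE.
rewrite (prob_ball_coin (D := D)) //.
- by rewrite base_link_prob -!EFinM expr2 !mulrA.
- by left; left.
- by move=> [[|]|//] /= [] h; [have := vs'; rewrite h ltnn|have := vv'; rewrite (val_inj h) eqxx].
- by move=> [[//|//]|] /= [] h; have := vv'; rewrite (val_inj h) eqxx.
- by apply: base_link_field => /=; [left; left|left; right|right].
Qed.

(** Already the base links number more than half their mean, which is at least
    [p * A2 / 4 * n], except with the probability given by Chebyshev's
    inequality. *)
Lemma few_links_prob :
  (P [set w | (#|links (fun u v : 'I_n => slink w u v)|%:R < p * A2 / 8 * n%:R)%R] <=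
   (16 / (p * A2) * n%:R^-1)%:E)%E.
Proof.
have nR : 0 < n%:R :> R by rewrite ltr0n ltnW.
pose q := base_vol * p; pose M : R := #|{: vertex_pair}|%:R * q.
have MB : p * A2 / 4 * n%:R <= M.
  have := card_vertex_pair n_ge2; rewrite -(ler_nat R) !natrM => h.
  rewrite /M /q /base_vol [leLHS](_ : _ = (n%:R * n%:R / 4) * (A2 / n%:R * p)); last first.
    by field; rewrite gt_eqF.
  apply: ler_wpM2r; first by rewrite mulr_ge0 ?divr_ge0 ?(ltW A2_gt0) ?(ltW p_gt0).
  by rewrite ler_pdivrMr // [leRHS]mulrC.
have B0 : 0 < p * A2 / 4 * n%:R by rewrite mulr_gt0 // divr_gt0 // mulr_gt0.
have M0 : 0 < M by exact: lt_le_trans MB.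
have mb (x : vertex_pair) : measurable [set w | base_link x w].
  by apply: (@noise_field_measurable _ _ _ _ _ X B setT); exact: base_link_field.
have := count_lower_bound mb base_link_prob base_link_pair M0.
set Few := (X in (P X <= _)%E -> _) => PFew.
apply: (@le_trans _ _ (P Few)); last first.
  apply: le_trans PFew _; rewrite lee_fin.
  rewrite [leRHS](_ : _ = 4 / (p * A2 / 4 * n%:R)); last first.
    by field; rewrite !gt_eqF.
  by rewrite ler_wpM2l // lef_pV2 ?posrE.
apply: le_measure; rewrite ?inE.
- pose Q z := (#|links (fun u v : 'I_n => olink z u v)|%:R < p * A2 / 8 * n%:R :> R)%R.
  have lE w : links (fun u v : 'I_n => slink w u v) =
      links (fun u v : 'I_n => olink (observe w) u v).
    by apply/finset.setP => x; rewrite !inE olink_observe.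
  by under eq_set do rewrite lE; exact: (measurable_fmap measurable_atom Q).
- exact: measurable_count.
- move=> w /= few; rewrite /Few /=.
  apply: (@lt_le_trans _ _ (p * A2 / 8 * n%:R)); last by move: MB; rewrite -/q -/M; lra.
  apply: le_lt_trans few; rewrite ler_nat.
  have -> : (\sum_x base_link x w = #|[pred x | base_link x w]|)%N.
    rewrite -sum1_card [RHS]big_mkcond /=; apply: eq_bigr => x _.
    by rewrite inE; case: (base_link x w).
  rewrite -(fintype.card_image val_inj); apply: subset_leq_card.
  apply/fintype.subsetP => x /fintype.imageP[y]; rewrite !inE => hy ->.
  exact: base_link_slink.
Qed.

End SpaModel.

(** * The modularity of the SPA graph *)

Section Assembly.
Variables (R : realType) (m : nat) (r : \bar R) (p A1 A2 : R).
Hypotheses (hr : (1 <= r)%E) (hm : (0 < m)%N).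
Hypotheses (p_gt0 : 0 < p) (p_le1 : p <= 1) (A1_gt0 : 0 < A1) (A2_gt0 : 0 < A2).
Hypothesis pA1_lt1 : p * A1 < 1.

Let a := p * A1.
Let b : R := Num.max (- m%:R^-1) (-1 + a).
Let beta := A2 / A1 + 1.
Let C2 := 3 * beta ^+ 2.
Let K1 := 2 * p * C2 * A1 `^ (1 + m%:R^-1).
Let D3 := m%:R * K1 + a * C2.
Let D4 := 6 * beta * C2 + C2.
Let c0 := p * A2 / 8.

Let mR : 0 < m%:R :> R. Proof. by rewrite ltr0n. Qed.
Let a_gt0 : 0 < a. Proof. by rewrite mulr_gt0. Qed.
Let beta_gt0 : 0 < beta. Proof. by rewrite /beta addr_gt0 // divr_gt0. Qed.
Let C2_gt0 : 0 < C2. Proof. by rewrite /C2 mulr_gt0 // exprn_gt0. Qed.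
Let K1_gt0 : 0 < K1.
Proof. by rewrite /K1 mulr_gt0 ?powR_gt0 // mulr_gt0 // mulr_gt0. Qed.
Let D3_gt0 : 0 < D3. Proof. by rewrite /D3 addr_gt0 // mulr_gt0. Qed.
Let D4_gt0 : 0 < D4. Proof. by rewrite /D4 addr_gt0 // mulr_gt0 // mulr_gt0. Qed.
Let c0_gt0 : 0 < c0. Proof. by rewrite /c0 divr_gt0 // mulr_gt0. Qed.

Let minv1 : 0 <= (m%:R^-1 : R) <= 1.
Proof. by rewrite invr_ge0 ler0n /= invf_le1 // ler1n. Qed.

Let b_le0 : b <= 0.
Proof. by rewrite /b ge_max; case/andP: minv1 => h _; apply/andP; split; [|have := pA1_lt1; rewrite -/a]; lra. Qed.
Let b_geN1 : -1 <= b.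
Proof. by rewrite /b le_max; case/andP: minv1 => _ h; rewrite lerN2 h. Qed.
Let b_gem : - m%:R^-1 <= b.
Proof. by rewrite /b le_max lexx. Qed.
Let b_gea : a - 1 <= b.
Proof. by rewrite /b le_max addrC lexx orbT. Qed.

(** Up to powers of [n] and [ln n], [D3] and [D4] bound the expectations of the number
    of crossing links and of the sum over pairs in a common strip, and [c0 * n] is
    the lower bound on the number of links. *)
Definition modularity_const : R := 4 * (3 / 2 * (D3 / c0) + 2 * (D4 / c0 ^+ 2)).

Variables (d : measure_display) (T : measurableType d) (P : probability T R).
Variables (X : nat -> {RV P >-> m.-tuple R}) (B : nat -> nat -> {RV P >-> bool}).
Hypothesis noise : spa_noise X B p.

Section FixedTime.
Variables (n k : nat).
Hypotheses (k_gt0 : (0 < k)%N) (n_gt0 : (0 < n)%N).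

Notation Pr := (outcome_prob r A1 A2 hm X B (n := n) k_gt0).
Notation obs := (observe r A1 A2 hm X B n k_gt0).
Let L : R := 1 + ln n%:R.

Let Pr_ge0 z : 0 <= Pr z. Proof. exact: atom_prob_ge0. Qed.
Let Pr_total : \sum_z Pr z = 1.
Proof. exact: (atom_prob_total P (measurable_atom A1 A2 hr hm noise k_gt0)). Qed.

Definition ocross (th : nat) (z : outcome n k) : nat :=
  (\sum_(s < n) \sum_(v < s)
     (olink z s v && (strip k th (ocell z s) != strip k th (ocell z v))))%N.

Definition opairs (th : nat) (z : outcome n k) : R :=
  \sum_(v < n) \sum_(w < n)
     (strip k th (ocell z v) == strip k th (ocell z w))%:R *
     (sdeg (@olink n k) A1 A2 z n v * sdeg (@olink n k) A1 A2 z n w).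

Lemma opairs_ge0 th z : 0 <= opairs th z.
Proof.
by apply: sumr_ge0 => v _; apply: sumr_ge0 => w _; rewrite !mulr_ge0 // sdeg_ge0.
Qed.

(** Summing over the shifts inside the expectation, a link costs the number of shifts
    for which it is crossing. *)
Lemma ocross_sum_le :
  \sum_(th < k) Ex Pr (fun z => (ocross th z)%:R) <=
  (k * k)%:R * (m%:R / 2) * K1 * (n%:R `^ (1 + b) * L ^+ 2) + a * C2 * (n%:R * L).
Proof.
have Ew := fun s v h => @spa_Ex_link _ _ _ _ A1 A2 hr hm p_gt0 p_le1 A1_gt0 A2_gt0 _ _ _ _ _ noise n k k_gt0 s v h.
apply: (@le_trans _ _ (\sum_(s < n) \sum_(v < s) Ex Pr (fun z => (olink z s v)%:R *
   ((k * k)%:R * (m%:R / 2) * influence_volume (@olink n k) A1 A2 z s v `^ m%:R^-1 + 1)))).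
  rewrite -Ex_sum.
  under [leRHS]eq_bigr do rewrite -Ex_sum.
  rewrite -Ex_sum; apply: (le_Ex Pr_ge0) => z zP.
  rewrite -natr_sum /ocross exchange_big natr_sum; apply: ler_sum => s _.
  rewrite exchange_big natr_sum; apply: ler_sum => v _.
  case lsv : (olink z s v); last by rewrite mul0r big1.
  rewrite mul1r /=; exact: (spa_crossing_shifts hr A1_gt0 A2_gt0 noise zP (ltn_ord s) lsv).
have := crossing_cost_Ex_le Pr_ge0 Pr_total p_gt0 A1_gt0 A2_gt0 (@olink_lt n k) Ew pA1_lt1 n_gt0
  minv1 b_gem b_gea b_geN1.
by move=> /(_ ((k * k)%:R * (m%:R / 2)) 1); rewrite !mul1r; apply => //.
Qed.

(** The shift may depend on the model but not on the outcome, so that the same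
    partition rule works with high probability. *)
Lemma good_shift : exists th : 'I_k, Ex Pr (fun z => (ocross th z)%:R) <=
  k%:R * (m%:R / 2) * K1 * (n%:R `^ (1 + b) * L ^+ 2) + a * C2 * (n%:R * L) / k%:R.
Proof.
apply/not_existsP => no; have := ocross_sum_le; apply/negP; rewrite -ltNge.
have kR : 0 < k%:R :> R by rewrite ltr0n.
pose Y : R := k%:R * (m%:R / 2) * K1 * (n%:R `^ (1 + b) * L ^+ 2) + a * C2 * (n%:R * L) / k%:R.
have -> : (k * k)%:R * (m%:R / 2) * K1 * (n%:R `^ (1 + b) * L ^+ 2) + a * C2 * (n%:R * L) =
    \sum_(th < k) Y.
  rewrite sumr_const card_ord -mulr_natl natrM /Y; field; by rewrite gt_eqF.
apply: ltr_sum.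
  by apply/hasP; exists (Ordinal k_gt0) => //; exact: mem_index_enum.
by move=> th _; rewrite ltNge; apply/negP; exact: no.
Qed.

Lemma opairs_Ex_le th : Ex Pr (opairs th) <=
  6 * beta * C2 * (k%:R / (k * k)%:R) * (n%:R * L) ^+ 2 + C2 * n%:R `^ a * (n%:R * L).
Proof.
have Ew := fun s v h => @spa_Ex_link _ _ _ _ A1 A2 hr hm p_gt0 p_le1 A1_gt0 A2_gt0 _ _ _ _ _ noise n k k_gt0 s v h.
have Ec := fun s c => @spa_Ex_cell _ _ _ _ A1 A2 hr hm _ _ _ _ _ noise n k k_gt0 s c.
by have := same_strip_Ex_le Pr_ge0 Pr_total p_gt0 A1_gt0 A2_gt0 (@olink_lt n k) Ew Ec pA1_lt1 n_gt0
  (@ocell_lt n k) (strip_card k_gt0 th).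
Qed.

Let slinkb (w : T) : rel 'I_n := fun u v => slink r A1 A2 X B w u v.

(** Valid for every outcome: the randomness enters only through [ocross], [opairs]
    and the number of links. *)
Lemma modularity_outcome_ge (th : 'I_k) w : (0 < #|links (slinkb w)|)%N ->
  1 - 3 / 2 * ((ocross th (obs w))%:R / #|links (slinkb w)|%:R)
    - 2 * opairs th (obs w) / #|links (slinkb w)|%:R ^+ 2 <=
  modularity R (spa_undirected r A1 A2 (fun k => X k w) (fun u v => B u v w) (n := n)).
Proof.
move=> E0.
have -> : spa_undirected r A1 A2 (fun k => X k w) (fun u v => B u v w) (n := n) =
    sym_link (slinkb w).
  apply/funext => u; apply/funext => v.
  by rewrite /spa_undirected !spa_graphE !ltn_ord.
pose st (v : 'I_n) : 'I_k := Ordinal (ltn_strip k_gt0 th (ocell (obs w) v)).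
have l_lt u v : slinkb w u v -> (v < u)%N by rewrite /slinkb /slink /spa_link => /and3P[].
apply: le_trans (modularity_ge R st l_lt E0).
have ER : 0 < #|links (slinkb w)|%:R :> R by rewrite ltr0n.
have lE (u v : 'I_n) : slinkb w u v = olink (obs w) u v by rewrite olink_observe.
apply: lerB; last first.
  rewrite ler_wpM2r ?invr_ge0 ?exprn_ge0 // ler_wpM2l //.
  apply: ler_sum => u _; apply: ler_sum => v _; apply: ler_wpM2l => //.
  have ind (x : 'I_n) : (in_deg (slinkb w) x)%:R <= sdeg (@olink n k) A1 A2 (obs w) n x.
    rewrite /sdeg /in_deg /indeg; under eq_bigr do rewrite lE.
    by rewrite lerDl ltW.
  exact: ler_pM.
rewrite lerD2l lerN2 ler_wpM2l // ler_wpM2r ?invr_ge0 // ler_nat.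
have -> : #|crossing (slinkb w) st| =
    (\sum_(u < n) \sum_(v < n) if (u, v) \in crossing (slinkb w) st then 1 else 0)%N.
  rewrite -sum1_card big_mkcond /= pair_bigA; by apply: eq_bigr => -[].
apply: leq_sum => u _.
rewrite (big_ord_widen n (fun v => nat_of_bool (olink (obs w) u v &&
  (strip k th (ocell (obs w) u) != strip k th (ocell (obs w) v)))) (ltnW (ltn_ord u))).
rewrite [leqRHS]big_mkcond; apply: leq_sum => v _.
rewrite !inE /= lE; case luv : (olink _ _ _) => //=.
by rewrite (olink_lt luv); case: ifP.
Qed.

End FixedTime.

(** With [k] strips, the crossing ratio is of order [k * n `^ b] and the sum over pairs
    of order [1 / k] relative to the square of the number of links; the choice of
    [k] about [n `^ (- b / 2)] makes both of order [n `^ (b / 2)], up to logarithms.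
    Markov's inequality at [ln n] times the expectation leaves probabilities
    [1 / ln n], and costs one of the logarithms of the rate. *)
Lemma modularity_prob n (G := [set w | 1 - modularity_const * spa_rate m p A1 n <=
     modularity R (spa_undirected r A1 A2 (fun k => X k w) (fun u v => B u v w) (n := n))]) :
  A2 <= n%:R -> (2 <= n)%N -> 1 <= ln (n%:R : R) ->
  measurable G /\ ((1 - (16 / (p * A2) * n%:R^-1 + 2 * (ln (n%:R : R))^-1))%:E <= P G)%E.
Proof.
move=> nA2 n2 l1; have n_gt0 : (0 < n)%N by exact: ltnW.
have nR : 0 < n%:R :> R by rewrite ltr0n.
have n1 : 1 <= n%:R :> R by rewrite ler1n.
set l : R := ln n%:R in l1 *; have l0 : 0 < l by exact: lt_le_trans l1.
set N : R := n%:R in nA2 nR n1 *.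
pose rt : R := N `^ (b / 2); have rt0 : 0 < rt by exact: powR_gt0.
pose y : R := N `^ (- (b / 2)).
have rtE : rt = y^-1 by rewrite /y powRN invrK.
have y1 : 1 <= y.
  by rewrite -(powRr0 N); apply: ler_powR => //; have := b_le0; lra.
have y0 : 0 < y by exact: lt_le_trans y1.
pose k := (Num.truncn y).+1; have k_gt0 : (0 < k)%N by [].
have ky : y <= k%:R by apply: ltW; exact: truncnS_gt.
have k2y : k%:R <= 2 * y.
  have h : (Num.truncn y)%:R <= y by rewrite truncn_le // ltW.
  by rewrite /k -natr1; lra.
have kR : 0 < k%:R :> R by rewrite ltr0n.
have kinv : k%:R^-1 <= rt by rewrite rtE lef_pV2 ?posrE.
have krt : k%:R * rt <= 2 by rewrite rtE ler_pdivrMr.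
have powb : N `^ (1 + b) = N * rt ^+ 2.
  rewrite [in LHS](_ : 1 + b = 1 + (b / 2 + b / 2)); last lra.
  by rewrite !powRD ?(gt_eqF nR) ?implybT // powRr1 ?ltW // expr2.
have powa : N `^ a <= N * rt.
  rewrite -{2}(powRr1 (ltW nR)) -powRD ?(gt_eqF nR) ?implybT //.
  by apply: ler_powR => //; have := b_gea; have := b_le0; lra.
pose L : R := 1 + l; have L1 : 1 <= L by rewrite lerDl ltW.
have L0 : 0 < L by exact: lt_le_trans L1.
have LL : L <= L ^+ 2 by rewrite expr2 -[leLHS]mulr1 ler_wpM2l // ltW.
(* The common order of magnitude of the two expectations; the second one has an
   additional factor [n]. *)
pose U : R := N * rt * L ^+ 2.
have U0 : 0 < U by rewrite mulr_gt0 ?exprn_gt0 // mulr_gt0.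
have [th cross_le] := @good_shift n k k_gt0 n_gt0.
have crossU : Ex (outcome_prob r A1 A2 hm X B (n := n) k_gt0)
    (fun z => (ocross th z)%:R) <= D3 * U.
  apply: le_trans cross_le _; rewrite -/N -/l -/L powb /D3 mulrDl; apply: lerD.
    rewrite [leLHS](_ : _ = (k%:R * rt) * (m%:R / 2 * K1 * U)); last by rewrite /U; ring.
    rewrite [leRHS](_ : _ = 2 * (m%:R / 2 * K1 * U)); last by field.
    by apply: ler_wpM2r krt; rewrite ltW // mulr_gt0 // mulr_gt0 // divr_gt0.
  rewrite -[leLHS]mulrA; apply: ler_wpM2l; first by rewrite ltW // mulr_gt0.
  rewrite /U -[leRHS]mulrA -[leLHS]mulrA; apply: ler_wpM2l; first exact: ltW.
  rewrite mulrC; apply: ler_pM => //; exact: ltW.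
have pairsU : Ex (outcome_prob r A1 A2 hm X B (n := n) k_gt0) (opairs th) <= D4 * (N * U).
  apply: le_trans (opairs_Ex_le k_gt0 n_gt0 th) _.
  rewrite -/N -/l -/L /D4 [leRHS]mulrDl; apply: lerD.
    rewrite -mulrA; apply: ler_wpM2l; first by rewrite ltW // mulr_gt0 // mulr_gt0.
    have -> : k%:R / (k * k)%:R = k%:R^-1 :> R.
      by rewrite natrM invfM mulVKf // gt_eqF.
    rewrite [leRHS](_ : _ = rt * (N * L) ^+ 2); last by rewrite /U; ring.
    by apply: ler_wpM2r kinv; rewrite sqr_ge0.
  rewrite -mulrA; apply: ler_wpM2l; first exact: ltW.
  rewrite [leRHS](_ : _ = (N * rt) * (N * L ^+ 2)); last by rewrite /U; ring.
  apply: ler_pM => //; first exact: powR_ge0.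
    by rewrite mulr_ge0 // ltW.
  by apply: ler_wpM2l => //; exact: ltW.
pose obs := observe r A1 A2 hm X B n k_gt0.
have mobs : forall z, measurable [set w | obs w = z].
  by move=> z; exact: (measurable_atom A1 A2 hr hm noise k_gt0).
(* Outside the exceptional events [F1], [F2] and [E0], which depend only on the
   outcome, the bound of [modularity_outcome_ge] is good enough. *)
pose F1 := [set w | D3 * U * l < (ocross th (obs w))%:R].
pose F2 := [set w | D4 * (N * U) * l < opairs th (obs w)].
have markov (f : outcome n k -> R) c : (forall z, 0 <= f z) -> 0 < c ->
    Ex (outcome_prob r A1 A2 hm X B (n := n) k_gt0) f <= c ->
    measurable [set w | c * l < f (obs w)] /\
    (P [set w | (c * l < f (obs w))%R] <= (l^-1)%:E)%E.
  move=> f0 c0' fc; split; first exact: (measurable_fmap mobs (fun z => c * l < f z)).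
  rewrite (prob_fmap P mobs (fun z => c * l < f z)) lee_fin.
  apply: le_trans (finite_markov _ f0 (mulr_gt0 c0' l0)) _.
    by move=> z; exact: atom_prob_ge0.
  by rewrite ler_pdivrMr ?mulr_gt0 // mulrC mulfK ?gt_eqF.
have [mF1 PF1] := markov _ _ (fun z => ler0n R (ocross th z)) (mulr_gt0 D3_gt0 U0) crossU.
have [mF2 PF2] := markov _ _ (@opairs_ge0 n k th) (mulr_gt0 D4_gt0 (mulr_gt0 nR U0)) pairsU.
pose E0 := [set w : T | #|links (fun u v : 'I_n => slink r A1 A2 X B w u v)|%:R < c0 * N].
have PE0 := few_links_prob hr hm p_gt0 p_le1 A1_gt0 A2_gt0 noise k_gt0 nA2 n2.
pose lk (z : outcome n k) := links (fun u v : 'I_n => olink z u v).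
have lkE w : links (fun u v : 'I_n => slink r A1 A2 X B w u v) = lk (obs w).
  by apply/setP => x; rewrite !inE olink_observe.
have mE0 : measurable E0.
  rewrite /E0; under eq_set do rewrite lkE.
  exact: (measurable_fmap mobs (fun z => #|lk z|%:R < c0 * N)).
have mG : measurable G.
  have graphE w : spa_undirected r A1 A2 (fun k => X k w) (fun u v => B u v w) (n := n) =
      sym_link (fun u v : 'I_n => olink (obs w) u v).
    apply/funext => u; apply/funext => v.
    by rewrite /spa_undirected !spa_graphE !ltn_ord /sym_link !olink_observe.
  rewrite /G; under eq_set do rewrite graphE.
  exact: (measurable_fmap mobs (fun z => 1 - modularity_const * spa_rate m p A1 n <=
    modularity R (sym_link (fun u v : 'I_n => olink z u v)))).
have sub : ~` G `<=` E0 `|` F1 `|` F2.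
  move=> w Gw; apply: contrapT => /not_orP[/not_orP[/negP] hE /negP hF1 /negP hF2].
  move: hE hF1 hF2; rewrite -!leNgt => hE hF1 hF2; apply: Gw => /=.
  have cN : 0 < c0 * N by rewrite mulr_gt0.
  have Epos : 0 < #|links (fun u v : 'I_n => slink r A1 A2 X B w u v)|%:R :> R.
    exact: lt_le_trans hE.
  apply: le_trans (@modularity_outcome_ge n k k_gt0 th w _); last first.
    by rewrite ltr0n in Epos.
  set E : R := #|links _|%:R in hE Epos *.
  have Ei : E^-1 <= (c0 * N)^-1 by rewrite lef_pV2 ?posrE.
  pose W := rt * (L ^+ 2 * l).
  have cross_ratio : (ocross th (obs w))%:R / E <= D3 / c0 * W.
    rewrite [leRHS](_ : _ = (D3 * U * l) * (c0 * N)^-1); last first.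
      by rewrite /W /U; field; rewrite !gt_eqF.
    by apply: ler_pM => //; rewrite invr_ge0 ltW.
  have pairs_ratio : opairs th (obs w) / E ^+ 2 <= D4 / c0 ^+ 2 * W.
    rewrite [leRHS](_ : _ = (D4 * (N * U) * l) * (c0 * N)^-1 ^+ 2); last first.
      by rewrite /W /U; field; rewrite !gt_eqF.
    rewrite -exprVn; apply: ler_pM => //; first exact: opairs_ge0.
      by rewrite exprn_ge0 // invr_ge0 ltW.
    by rewrite lerXn2r // nnegrE invr_ge0 ltW.
  have W_le : W <= 4 * spa_rate m p A1 n.
    rewrite /spa_rate -/a -/b -/N -/l -/rt /W [leRHS]mulrCA; apply: ler_wpM2l; first exact: ltW.
    have -> : l `^ (9 / 2) = l ^+ 3 * l `^ (3 / 2).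
      rewrite -powR_mulrn ?ltW // -powRD; last by rewrite (gt_eqF l0) implybT.
      by congr (_ `^ _); field.
    have l32 : 1 <= l `^ (3 / 2) by rewrite -[leLHS](powRr0 l); apply: ler_powR => //; rewrite divr_ge0.
    apply: (@le_trans _ _ (4 * l ^+ 3)).
      rewrite (exprSr l 2) [leRHS]mulrA; apply: ler_wpM2r; first exact: ltW.
      rewrite (_ : 4 * l ^+ 2 = (2 * l) ^+ 2); last by ring.
      by rewrite lerXn2r ?nnegrE ?mulr_ge0 ?(ltW L0) ?(ltW l0) // /L mulr2n mulrDl mul1r lerD2r.
    by rewrite -[leLHS]mulr1 -mulrA ler_pM2l // ler_wpM2l // exprn_ge0 // ltW.
  have q1 : 0 < D3 / c0 by rewrite divr_gt0.
  have q2 : 0 < D4 / c0 ^+ 2 by rewrite divr_gt0 // exprn_gt0.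
  rewrite -addrA -opprD lerD2l lerN2 /modularity_const.
  apply: (@le_trans _ _ ((3 / 2 * (D3 / c0) + 2 * (D4 / c0 ^+ 2)) * W)).
    rewrite [leRHS](_ : _ = 3 / 2 * (D3 / c0 * W) + 2 * (D4 / c0 ^+ 2 * W)); last by ring.
    rewrite -[X in _ + X <= _]mulrA; apply: lerD; first by apply: ler_wpM2l; rewrite // divr_ge0.
    exact: ler_wpM2l.
  rewrite [leRHS](_ : _ = (3 / 2 * (D3 / c0) + 2 * (D4 / c0 ^+ 2)) *
    (4 * spa_rate m p A1 n)); last by ring.
  by apply: ler_wpM2l => //; rewrite ltW // addr_gt0 // mulr_gt0.
split => //; rewrite -(setCK G) probability_setC; last exact: measurableC.
rewrite EFinB; apply: leeB => //.
apply: (@le_trans _ _ (P (E0 `|` F1 `|` F2))).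
  by apply: le_measure => //; rewrite ?inE; [exact: measurableC|do 2?apply: measurableU].
apply: (@le_trans _ _ (P E0 + P F1 + P F2)%E).
  apply: le_trans (measureU2 _ _ _) _ => //; first exact: measurableU.
  by apply: leeD => //; apply: measureU2.
have -> : 16 / (p * A2) * N^-1 + 2 * l^-1 = 16 / (p * A2) * N^-1 + l^-1 + l^-1 by ring.
by rewrite !EFinD; apply: leeD => //; apply: leeD.
Qed.

End Assembly.

(** * The rate, and the conclusion *)

Lemma ln_cvgy (R : realType) : (ln n%:R : R) @[n --> \oo] --> +oo.
Proof.
apply/cvgryPge => M; near=> n.
have h : expR M <= n%:R by near: n; exact: nbhs_infty_ger.
have n0 : 0 < n%:R :> R by exact: lt_le_trans (expR_gt0 M) h.
by rewrite -[M]expRK ler_ln ?posrE ?expR_gt0.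
Unshelve. all: by end_near. Qed.

Lemma powR_natN_cvg0 (R : realType) (c : R) : 0 < c ->
  n%:R `^ (- c) @[n --> \oo] --> (0 : R).
Proof.
move=> c0.
have h : (c * ln n%:R : R) @[n --> \oo] --> +oo.
  apply/cvgryPge => M; near=> n.
  rewrite mulrC -ler_pdivrMr //; near: n.
  by move/cvgryPge: (@ln_cvgy R); apply.
have := cvg_comp _ _ h (@cvgr_expR R); apply: cvg_trans.
apply: near_eq_cvg; near=> n.
have n0 : (0 < n)%N by near: n; exact: nbhs_infty_gt.
by rewrite /= /powR pnatr_eq0 gtn_eqF // mulNr.
Unshelve. all: by end_near. Qed.

(** Half of the polynomial decay, [n `^ (b / 4)], absorbs the power of the logarithm,
    by [ln x <= x `^ e / e] with [e] small. *)
Lemma spa_rate_cvg0 (R : realType) (m : nat) (p A1 : R) : (1 <= m)%N -> p * A1 < 1 ->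
  spa_rate m p A1 n @[n --> \oo] --> (0 : R).
Proof.
move=> hm a1; rewrite /spa_rate; set b := Num.max _ _.
have b0 : b < 0.
  by rewrite /b gt_max oppr_lt0 invr_gt0 ltr0n hm /=; lra.
pose c := - (b / 4); have c0 : 0 < c by rewrite /c; lra.
pose e := - (b / 18); have e0 : 0 < e by rewrite /e; lra.
have lim : e^-1 `^ (9 / 2) * n%:R `^ (- c) @[n --> \oo] --> (0 : R).
  rewrite -[X in _ --> X](mulr0 (e^-1 `^ (9 / 2))); apply: cvgMr.
  exact: powR_natN_cvg0.
apply: (squeeze_cvgr _ (cvg_cst 0) lim).
near=> n; have n0 : (0 < n)%N by near: n; exact: nbhs_infty_gt.
have nR : 0 < n%:R :> R by rewrite ltr0n.
rewrite mulr_ge0 ?powR_ge0 //=.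
have l0 : 0 <= ln n%:R :> R by rewrite ln_ge0 // ler1n.
have le : ln n%:R <= e^-1 * n%:R `^ e :> R.
  rewrite mulrC ler_pdivlMr // mulrC -ln_powR; apply/ltW/ln_sublinear.
  exact: powR_gt0.
apply: (@le_trans _ _ (n%:R `^ (b / 2) * (e^-1 * n%:R `^ e) `^ (9 / 2))).
  apply: ler_wpM2l; first exact: powR_ge0.
  by apply: ge0_ler_powR => //; rewrite ?nnegrE ?mulr_ge0 ?powR_ge0 ?invr_ge0 ?divr_ge0 // ltW.
rewrite powRM ?powR_ge0 ?invr_ge0 ?(ltW e0) // -powRrM mulrCA -powRD; last first.
  by rewrite pnatr_eq0 gtn_eqF // implybT.
apply: ler_wpM2l; first exact: powR_ge0.
rewrite (_ : b / 2 + e * (9 / 2) = - c) //; rewrite /e /c; field.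
Unshelve. all: by end_near. Qed.

Theorem theorem14 (R : realType) (m : nat) (r : \bar R) (p A1 A2 : R)
    (hm : (1 <= m)%N) (hr : (1 <= r)%E) (hp0 : 0 < p) (hp1 : p <= 1)
    (hA1 : 0 < A1) (hA2 : 0 < A2) (hpA1 : p * A1 < 1) :
  (exists C : R,
     forall (d : measure_display) (T : measurableType d) (P : probability T R)
       (X : nat -> {RV P >-> m.-tuple R}) (B : nat -> nat -> {RV P >-> bool}),
       spa_noise X B p ->
       let q (n : nat) (w : T) : R :=
         modularity R (spa_undirected r A1 A2 (fun k => X k w)
                         (fun u v => B u v w) (n := n)) in
       asymptotically_almost_surely P
         (fun n => [set w | 1 - C * spa_rate m p A1 n <= q n w])
       /\ (forall n w, q n w <= 1))
  /\ spa_rate m p A1 n @[n --> \oo] --> (0 : R).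
Proof.
split; last exact: spa_rate_cvg0.
exists (modularity_const m p A1 A2) => d T P X B noise q; split; last first.
  by move=> n w; exact: modularity_le1.
rewrite /asymptotically_almost_surely.
pose err (n : nat) : R := 16 / (p * A2) * n%:R^-1 + 2 * (ln n%:R)^-1.
have errE : err n @[n --> \oo] --> (0 : R).
  rewrite [X in _ --> X](_ : 0 = 16 / (p * A2) * 0 + 2 * 0 :> R); last by rewrite !mulr0 addr0.
  apply: cvgD; apply: cvgMr.
    apply/gtr0_cvgV0; last exact: cvgr_idn.
    by near=> n; rewrite ltr0n; near: n; exact: nbhs_infty_gt.
  apply/gtr0_cvgV0; last exact: ln_cvgy.
  by move/cvgryPgt: (@ln_cvgy R); apply.
have lim : (1 - err n)%:E @[n --> \oo] --> 1%E.
  apply: cvg_EFin; first by apply: nearW.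
  rewrite -[X in _ --> X]subr0; apply: cvgB => //; exact: cvg_cst.
apply: (squeeze_cvge _ lim (cvg_cst _)); near=> n.
have n2 : (2 <= n)%N by near: n; exact: nbhs_infty_ge.
have nA : A2 <= n%:R by near: n; exact: nbhs_infty_ger.
have l1 : 1 <= ln n%:R :> R by near: n; move/cvgryPge: (@ln_cvgy R); apply.
have [mE PE] := modularity_prob hr hm hp0 hp1 hA1 hA2 hpA1 noise nA n2 l1.
by apply/andP; split; [exact: PE|exact: probability_le1].
Unshelve. all: by end_near. Qed.
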